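(* Let $U$ be a separable real Banach space and let $W=(W(t):t\ge 0)$ be an adapted cylindrical process in $U$. The following are equivalent: (a) $W$ is a strongly cylindrical Wiener process; (b) there exist a Hilbert space $H$ with an orthonormal basis $(e_n)_{n\in\mathbb{N}}$, an operator $F\in L(H,U)$ and independent real-valued standard Wiener processes $(B_n)_{n\in\mathbb{N}}$ such that for all $t\ge 0$ and all $u^\ast\in U^\ast$ $$W(t)u^\ast=\sum_{k=1}^\infty \langle Fe_k,u^\ast\rangle B_k(t)\qquad\text{in } L^2(\Omega).$$
   Context: $U^\ast$ is the dual of $U$, $\langle u,u^\ast\rangle$ the dual pairing, $L(H,U)$ the bounded linear operators from $H$ to $U$. $(\Omega,\mathcal{A},P)$ is a probability space with a filtration $(\mathcal{F}_t)_{t\ge0}$, and $L^0(\Omega)$ is the space of (equivalence classes of) real random variables. A cylindrical random variable in $U$ is a linear map $X:U^\ast\to L^0(\Omega)$. A cylindrical process in $U$ is a family $(X(t):t\ge0)$ of cylindrical random variables in $U$; it is adapted if $X(t)u^\ast$ is $\mathcal{F}_t$-measurable for all $t\ge0$, $u^\ast\in U^\ast$. An $\mathbb{R}^n$-valued Wiener process is an adapted process $B=(B(t):t\ge0)$ with $B(0)=0$ a.s. and with independent, stationary increments such that $B(t)-B(s)$ is normally distributed with mean $0$ and covariance matrix $|t-s|C$ for a fixed symmetric non-negative definite matrix $C$; it is standard if $C=\mathrm{Id}$. A weakly cylindrical Wiener process in $U$ is an adapted cylindrical process $W$ such that for all $n\in\mathbb{N}$ and $u_1^\ast,\dots,u_n^\ast\in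 U^\ast$ the process $((W(t)u_1^\ast,\dots,W(t)u_n^\ast):t\ge0)$ is an $\mathbb{R}^n$-valued Wiener process. It is a strongly cylindrical Wiener process if in addition the cylindrical distribution of $W(1)$ is strongly Gaussian, i.e. the covariance operator $Q:U^\ast\to (U^\ast)'$ (algebraic dual), $(Qu^\ast)v^\ast=E[(W(1)u^\ast)(W(1)v^\ast)]$, takes values in $U$ (regarded as a subspace of $(U^\ast)'$ via $u\mapsto\langle u,\cdot\rangle$). Index convention: if $H$ is finite dimensional, the families $(e_n)$, $(B_n)$ are indexed by $\{1,\dots,\dim H\}$ and the sum is finite. *)

(* Defs.v *)
From HB Require Import structures.
From mathcomp Require Import all_boot all_order all_algebra.
From mathcomp Require Import all_classical all_reals all_analysis.
From mathcomp Require Import sesquilinear.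

Set Implicit Arguments.
Unset Strict Implicit.
Unset Printing Implicit Defensive.

Import Order.TTheory GRing.Theory Num.Theory.
Import numFieldNormedType.Exports.

Local Open Scope classical_set_scope.
Local Open Scope ring_scope.

Definition separable (T : topologicalType) := exists2 D : set T, countable D & dense D.

Section Dual.
Context {R : realType} (U : normedModType R).

Definition dual_pred : {pred U -> R^o} :=
  mem [set f : U -> R^o | linear f /\ continuous f].

Fact dual_submod_closed : submod_closed dual_pred.
Proof.
split=> [|a f g].
  rewrite inE/=; split=> [b x y|x]; last exact: cvg_cst.
  by rewrite -![(0 : U -> R^o) _]/(0 : R^o) scaler0 addr0.
rewrite !inE/= => -[lf cf] [lg cg]; split=> [b x y|x].
  rewrite -![(a *: f + g) _]/(a *: f _ + g _) lf lg !scalerDr !scalerA (mulrC a).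
  by rewrite -!addrA; congr (_ + _); rewrite addrCA.
by apply: cvgD; [apply: cvgZl_tmp; exact: cf|exact: cg].
Qed.

HB.instance Definition _ :=
  GRing.isSubmodClosed.Build R (U -> R^o) dual_pred dual_submod_closed.

Record dual := Dual { dual_fun :> U -> R^o; dual_funP : dual_fun \in dual_pred }.

HB.instance Definition _ := [isSub for dual_fun].
HB.instance Definition _ := [Choice of dual by <:].
HB.instance Definition _ := [SubChoice_isSubLmodule of dual by <:].

End Dual.

Section Hilbert.
Context {R : realType} {H : completeNormedModType R} (ip : {dot H for idfun}).

Definition hilbert_norm := forall x : H, ip x x = `|x| ^+ 2.

(* The basis is indexed by J, which is nat itself when H is infinite
   dimensional and {0, ..., dim H - 1} otherwise; e is irrelevant off J. *)
Definition orthonormal_basis (J : set nat) (e : nat -> H) :=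
  [/\ J = [set: nat] \/ (exists n, J = `I_n),
      (forall i j, J i -> J j -> ip (e i) (e j) = (i == j)%:R) &
      dense [set x : H | exists n (c : nat -> R),
                 x = \sum_(k < n | (k : nat) \in J) c k *: e k]].

End Hilbert.

Section Probability.
Context {R : realType} d {Omega : measurableType d} (P : probability Omega R).

(* Evaluating a class at w : Omega goes through a chosen representative; all
   the notions below are insensitive to that choice. *)
Local Notation L0 := {mfun_ P, Omega >-> R}.

Definition filtration (F : R -> set (set Omega)) :=
  [/\ (forall t, 0 <= t -> sigma_algebra [set: Omega] (F t)),
      (forall t, 0 <= t -> F t `<=` @measurable d Omega) &
      (forall s t, 0 <= s -> s <= t -> F s `<=` F t)].

(* Measurability of a class: some representative is measurable. *)
Definition L0_measurable (G : set (set Omega)) (X : L0) :=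
  exists2 g : Omega -> R,
    (forall A : set R, measurable A -> G (g @^-1` A)) & X = g %[ae P].

Definition independent_systems (I : eqType) (J : set I)
    (G : I -> set (set Omega)) :=
  forall s : seq I, uniq s -> (forall i, i \in s -> J i) ->
  forall A : I -> set Omega, (forall i, i \in s -> G i (A i)) ->
  P (\bigcap_(i in [set` s]) A i) = (\prod_(i <- s) fine (P (A i)))%:E.

Definition independent_variables d' (T : measurableType d') (I : eqType)
    (J : set I) (X : I -> Omega -> T) :=
  independent_systems J (fun i => preimage_set_system [set: Omega] (X i) measurable).

Definition process_sigma_algebra (X : R -> L0) : set (set Omega) :=
  <<s \bigcup_(t in [set t | 0 <= t])
        preimage_set_system [set: Omega] (X t : Omega -> R) measurable >>.

Definition independent_processes (I : eqType) (J : set I) (X : I -> R -> L0) :=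
  independent_systems J (fun i => process_sigma_algebra (X i)).

Definition same_law d' (T : measurableType d') (X Y : Omega -> T) :=
  forall A : set T, measurable A -> pushforward P X A = pushforward P Y A.

(* normal_prob takes the standard deviation and is not a point mass when that
   is 0. *)
Definition normal_law (m v : R) (A : set R) : \bar R :=
  if v == 0 then dirac m A else normal_prob m (Num.sqrt v) A.

Definition multivariate_normal n (X : Omega -> n.-tuple R)
    (m : 'rV[R]_n) (C : 'M[R]_n) :=
  forall (a : 'rV[R]_n) (A : set R), measurable A ->
  pushforward P (fun w => \sum_(i < n) a 0 i * tnth (X w) i) A =
  normal_law ((a *m m^T) 0 0) ((a *m C *m a^T) 0 0) A.

Definition increment n (B : R -> 'I_n -> L0) (s t : R) (w : Omega) : n.-tuple R :=
  [tuple B t i w - B s i w | i < n].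

Record wiener_with_covariance (F : R -> set (set Omega)) n
    (C : 'M[R]_n) (B : R -> 'I_n -> L0) : Prop := {
  wiener_adapted : forall t i, 0 <= t -> L0_measurable (F t) (B t i);
  wiener_start : forall i, B 0 i = cst 0 %[ae P];
  wiener_independent : forall m (t : nat -> R), 0 <= t 0%N ->
    (forall k, t k <= t k.+1) ->
    independent_variables [set: 'I_m] (fun k => increment B (t k) (t k.+1));
  wiener_stationary : forall s t h, 0 <= s -> s <= t -> 0 <= h ->
    same_law (increment B (s + h) (t + h)) (increment B s t);
  wiener_normal : forall s t, 0 <= s -> 0 <= t ->
    multivariate_normal (increment B s t) 0 (`|t - s| *: C) }.

Definition wiener_process F n (B : R -> 'I_n -> L0) :=
  exists C : 'M[R]_n, [/\ C^T = C,
    (forall a : 'rV[R]_n, 0 <= (a *m C *m a^T) 0 0) &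
    wiener_with_covariance F C B].

Definition standard_real_wiener F (b : R -> L0) :=
  wiener_with_covariance F 1%:M (fun t (_ : 'I_1) => b t).

Definition L2_cvg (f : nat -> Omega -> R) (g : Omega -> R) :=
  ('N[P]_2%:E [EFin \o (g \- f n)%R])%E @[n --> \oo] --> 0%E.

Section Cylindrical.
Context {U : completeNormedModType R}.
Implicit Types (X : dual U -> L0) (W : R -> dual U -> L0).

Definition cylindrical_variable X :=
  forall (a : R) (u v : dual U),
    X (a *: u + v) = (fun w => a * X u w + X v w) %[ae P].

Definition cylindrical_process W :=
  forall t, 0 <= t -> cylindrical_variable (W t).

Definition adapted (F : R -> set (set Omega)) W :=
  forall t (u : dual U), 0 <= t -> L0_measurable (F t) (W t u).

Definition weakly_cylindrical_wiener F W :=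
  [/\ cylindrical_process W, adapted F W &
      forall n (u : 'I_n -> dual U), wiener_process F (fun t i => W t (u i))].

Definition covariance_operator X (u v : dual U) : \bar R :=
  ('E_P[(fun w => X u w * X v w)%R])%E.

Definition strongly_cylindrical_wiener F W :=
  weakly_cylindrical_wiener F W /\
  forall u : dual U, exists x : U, forall v : dual U,
    covariance_operator (W 1) u v = (v x)%:E.

End Cylindrical.

End Probability.

(* Main.v *)
(* Both sides say that W is centred Gaussian with independent increments and
   variance rate q(u) = <Qu, u> for some Q : U* -> U; all laws and independences
   are read off from expectations of cosines of linear combinations.

   From a strongly cylindrical Wiener process to the expansion: a gliding hump
   argument bounds |Qu|^2 by a multiple of q(u). As U is separable, countably
   many functionals separate its points; Gram-Schmidt for the form <Qu, v> turns
   them into an orthonormal family (u_k). Then F e_k = Q u_k extends to a bounded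
   operator on l^2, B_k(t) = W(t) u_k are independent standard Wiener processes,
   and Parseval's identity q(v) = sum_k <Q u_k, v>^2 gives the L^2 convergence.

   Conversely, by Bessel's inequality h_u = sum_k <F e_k, u> e_k converges in H,
   and Q u = F h_u is the covariance operator. *)

From HB Require Import structures.
Require Import Defs.
From mathcomp Require Import all_boot all_order all_algebra.
From mathcomp Require Import all_classical all_reals all_analysis.
From mathcomp Require Import sesquilinear measurable_realfun ring lra.

Import Order.TTheory GRing.Theory Num.Theory.
Import numFieldNormedType.Exports.

Set Implicit Arguments.
Unset Strict Implicit.
Unset Printing Implicit Defensive.

Local Open Scope classical_set_scope.
Local Open Scope ring_scope.

(** * Expectations of bounded random variables *)

Section BoundedMeasurable.
Context {R : realType} d {T : measurableType d}.
Implicit Types f g : T -> R.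

(** Complex exponentials are avoided by a free phase: cos(Y + b) for all b carries the real part (b
    = 0) and the imaginary part (b = -pi/2) of exp(iY), and for a centred Gaussian Y its expectation
    is cos b times a real exponential. All expectations manipulated this way are of bounded
    functions, so integrability has to be argued only for second moments.

    Three obstacles shape the rest. The operator u |-> Qu is known only pointwise, and [dual U] is
    used as a bare vector space; the bound on |Qu|^2 has to be extracted from the mere finiteness of
    <Qf, f> for every single functional f. The form <Qu, v> may be degenerate, so orthonormalization
    discards null vectors, spans only modulo null vectors, and may stop after finitely many steps,
    which is why an index set J accompanies every family. Finally, independence of the B_k concerns
    the sigma-algebras of whole trajectories, whereas the hypotheses speak of successive increments
    of one process; the passage goes through the covariance min(s, t) <Qu, v> of values at
    arbitrary, unordered times. *)

Definition bounded_measurable f :=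
  measurable_fun setT f /\ exists M, forall x, `|f x| <= M.

Lemma bounded_measurable_cst (a : R) : bounded_measurable (fun=> a).
Proof. by split; [exact: measurable_cst|exists `|a|]. Qed.

Lemma bounded_measurableD f g : bounded_measurable f -> bounded_measurable g ->
  bounded_measurable (fun x => f x + g x).
Proof.
move=> [mf [M fM]] [mg [N gN]]; split; first exact: measurable_funD.
by exists (M + N) => x; rewrite (le_trans (ler_normD _ _))// lerD.
Qed.

Lemma bounded_measurableM f g : bounded_measurable f -> bounded_measurable g ->
  bounded_measurable (fun x => f x * g x).
Proof.
move=> [mf [M fM]] [mg [N gN]]; split; first exact: measurable_funM.
by exists (M * N) => x; rewrite normrM ler_pM.
Qed.

Lemma bounded_measurableZ (a : R) f : bounded_measurable f ->
  bounded_measurable (fun x => a * f x).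
Proof. by move=> bf; apply: bounded_measurableM => //; exact: bounded_measurable_cst. Qed.

Lemma bounded_measurableB f g : bounded_measurable f -> bounded_measurable g ->
  bounded_measurable (fun x => f x - g x).
Proof.
move=> [mf [M fM]] [mg [N gN]]; split; first exact: measurable_funB.
by exists (M + N) => x; rewrite (le_trans (ler_normB _ _))// lerD.
Qed.

Lemma bounded_measurable_cos f : measurable_fun setT f ->
  bounded_measurable (fun x => cos (f x)).
Proof.
move=> mf; split; last first.
  by exists 1 => x; rewrite ler_norml cos_geN1 cos_le1.
by apply: measurableT_comp mf; apply: continuous_measurable_fun; exact: continuous_cos.
Qed.

Lemma bounded_measurable_indic (A : set T) : measurable A ->
  bounded_measurable (\1_A : T -> R).
Proof.
move=> mA; split; first exact: measurable_indic.
by exists 1 => x; rewrite indicE; case: (_ \in _); rewrite ?normr1 ?normr0.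
Qed.

Lemma bounded_measurable_prod (I : Type) (s : seq I) (F : I -> T -> R) :
  (forall i, bounded_measurable (F i)) ->
  bounded_measurable (fun x => \prod_(i <- s) F i x).
Proof.
move=> bF; elim: s => [|i s IH].
  under eq_fun do rewrite big_nil; exact: bounded_measurable_cst.
by under eq_fun do rewrite big_cons; exact: bounded_measurableM.
Qed.

End BoundedMeasurable.

Section Expectation.
Context {R : realType} d {T : measurableType d} (P : probability T R).
Implicit Types f g : T -> R.

Local Notation E f := (Rintegral P setT f).

Lemma bounded_measurable_integrable f : bounded_measurable f ->
  P.-integrable setT (EFin \o f).
Proof.
move=> [mf [M fM]]; apply: measurable_bounded_integrable => //.
  by rewrite (le_lt_trans (probability_le1 P measurableT))// ltry.
exists M; split; first exact: num_real.
by move=> x Mx y _; apply: (le_trans (fM y)); exact: ltW.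
Qed.
Local Notation bi := bounded_measurable_integrable.

Lemma ExpD f g : bounded_measurable f -> bounded_measurable g ->
  E (fun x => f x + g x) = E f + E g.
Proof. by move=> bf bg; rewrite RintegralD//; exact: bi. Qed.

Lemma ExpB f g : bounded_measurable f -> bounded_measurable g ->
  E (fun x => f x - g x) = E f - E g.
Proof. by move=> bf bg; rewrite RintegralB//; exact: bi. Qed.

Lemma ExpZ (a : R) f : bounded_measurable f ->
  E (fun x => a * f x) = a * E f.
Proof. by move=> bf; rewrite RintegralZl//; exact: bi. Qed.

Lemma Exp_cst (a : R) : E (fun=> a) = a.
Proof. by rewrite /Rintegral integral_cst//= probability_setT mule1. Qed.

Lemma Exp_indic (A : set T) : measurable A -> E (\1_A) = fine (P A).
Proof. by move=> mA; rewrite /Rintegral integral_indic// setIT. Qed.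

Lemma ler_Exp f g : bounded_measurable f -> bounded_measurable g ->
  (forall x, f x <= g x) -> E f <= E g.
Proof. by move=> bf bg fg; apply: le_Rintegral => //; exact: bi. Qed.

Lemma cvg_Exp (F : nat -> T -> R) f (M : R) :
  (forall n, measurable_fun setT (F n)) -> (forall n x, `|F n x| <= M) ->
  (forall x, F n x @[n --> \oo] --> f x) ->
  bounded_measurable f /\ E (F n) @[n --> \oo] --> E f.
Proof.
move=> mF FM Ff.
have mf : measurable_fun setT f.
  by apply: (measurable_fun_cvg mF) => x _; exact: Ff.
have bf : bounded_measurable f.
  split => //; exists M => x.
  have h : `|F n x| @[n --> \oo] --> `|f x| by apply: cvg_norm; exact: Ff.
  by apply: (cvgr_to_le h); exact: nearW.
split => //; have iM : P.-integrable setT (EFin \o cst M).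
  exact/bi/bounded_measurable_cst.
have [|||||_ _ h] := @dominated_convergence _ _ _ P setT measurableT
  (fun n => EFin \o F n) (EFin \o f) (EFin \o cst M).
- by move=> n; exact/measurable_EFinP.
- exact/measurable_EFinP.
- apply/aeW => x _; apply: cvg_EFin; [exact: nearW|exact: Ff].
- by [].
- by apply/aeW => x n _; rewrite /= lee_fin.
apply: fine_cvg; rewrite fineK; first exact: h.
by apply: integrable_fin_num => //; exact: bi.
Qed.

End Expectation.

(** * Laws determined by their cosine transforms *)

Section SignPolynomials.
Context {R : realType}.

(** Iterates of y |-> (3 y - y^3) / 2, an odd map of [-1, 1] into itself that fixes 0 and drives
    every point of ]0, 1] to 1. On [-1, 1] they converge boundedly to the sign function, and
    composed with a cosine they stay trigonometric polynomials. *)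
Definition sign_poly (k : nat) : {poly R} :=
  iter k (fun p => (3 / 2) *: p - (1 / 2) *: p ^+ 3) 'X.

Lemma horner_sign_polyS k (y : R) : (sign_poly k.+1).[y] =
  (3 * (sign_poly k).[y] - (sign_poly k).[y] ^+ 3) / 2.
Proof. by rewrite /= hornerD hornerN !hornerZ horner_exp; field. Qed.

Lemma horner_sign_polyN k (y : R) : (sign_poly k).[- y] = - (sign_poly k).[y].
Proof.
elim: k => [|k IH]; first by rewrite /= !hornerX.
by rewrite !horner_sign_polyS IH; ring.
Qed.

(* 1 - s(y) = (1 - y)(1 - y(1 + y)/2) for s(y) = (3y - y^3)/2. *)
Lemma sign_poly_rate k (y : R) : 0 <= y <= 1 ->
  y <= (sign_poly k).[y] <= 1 /\ 1 - (sign_poly k).[y] <= (1 - y / 2) ^+ k.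
Proof.
move=> /andP[y0 y1]; elim: k => [|k [/andP[ys s1] IH]].
  by rewrite /= hornerX lexx y1 expr0; split => //; lra.
rewrite horner_sign_polyS; set s := (sign_poly k).[y] in ys s1 IH *.
have e : 1 - (3 * s - s ^+ 3) / 2 = (1 - s * (1 + s) / 2) * (1 - s) by field.
have s2 : s ^+ 2 <= 1 by rewrite expr_le1//; lra.
have ss2 : 0 <= s ^+ 2 by apply: sqr_ge0.
split; last first.
  by rewrite e [leRHS]exprS; apply: ler_pM => //; nra.
have : 0 <= (1 - s * (1 + s) / 2) * (1 - s) by apply: mulr_ge0; nra.
rewrite -e => h; apply/andP; split; last lra.
have : 0 <= s * (1 - s ^+ 2) by apply: mulr_ge0; lra.
rewrite (_ : s ^+ 3 = s * s ^+ 2); last by ring.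
lra.
Qed.

Lemma sign_poly_le1 k (y : R) : `|y| <= 1 -> `|(sign_poly k).[y]| <= 1.
Proof.
have pos z : 0 <= z -> `|z| <= 1 -> `|(sign_poly k).[z]| <= 1.
  move=> z0; rewrite ger0_norm// => z1.
  have [/andP[a b] _] := @sign_poly_rate k z (introT andP (conj z0 z1)).
  by rewrite ger0_norm// (le_trans z0).
have [y0|y0] := leP 0 y; first exact: pos.
move=> y1; rewrite -(opprK y) horner_sign_polyN normrN; apply: pos.
  by rewrite oppr_ge0 ltW.
by rewrite normrN.
Qed.

Lemma cvg_sign_poly (y : R) : `|y| <= 1 ->
  (sign_poly k).[y] @[k --> \oo] --> Num.sg y.
Proof.
have pos z : 0 < z -> `|z| <= 1 -> (sign_poly k).[z] @[k --> \oo] --> (1 : R).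
  move=> z0; rewrite gtr0_norm// => z1.
  have g : (1 - z / 2) ^+ k @[k --> \oo] --> (0 : R).
    by apply: cvg_expr; rewrite ger0_norm; lra.
  apply: (@squeeze_cvgr _ _ _ _ (fun k : nat => 1 - (1 - z / 2) ^+ k) (fun=> 1)).
  - apply: nearW => k.
    have z01 : 0 <= z <= 1 by rewrite z1 ltW.
    by have [/andP[_ ->] ?] := sign_poly_rate k z01; rewrite andbT; lra.
  - by rewrite -[X in _ --> X]subr0; apply: cvgB => //; exact: cvg_cst.
  - exact: cvg_cst.
move=> y1; have [y0|y0|y0] := ltgtP y 0.
- rewrite ltr0_sg//.
  rewrite (_ : (fun k => _) = fun k => - (sign_poly k).[- y]); last first.
    by apply/funext => k; rewrite horner_sign_polyN opprK.
  by apply: cvgN; apply: pos; rewrite ?normrN// oppr_gt0.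
- by rewrite gtr0_sg//; exact: pos.
- rewrite y0 sgr0.
  rewrite (_ : (fun k => _) = fun=> 0); first exact: cvg_cst.
  apply/funext => k; have := horner_sign_polyN k 0; rewrite oppr0; lra.
Qed.

End SignPolynomials.

Section CramerWold.
Context {R : realType} {I : Type}.

(** Coefficients come as a list of pairs with repetitions allowed, so that one more frequency is
    added by a cons even if its index already occurs. *)
Definition lincomb (T : Type) (X : I -> T -> R) (l : seq (I * R)) (x : T) : R :=
  \sum_(p <- l) p.2 * X p.1 x.

Lemma lincomb_cons (T : Type) (X : I -> T -> R) p l x :
  lincomb X (p :: l) x = p.2 * X p.1 x + lincomb X l x.
Proof. exact: big_cons. Qed.

Lemma measurable_lincomb d (T : measurableType d) (X : I -> T -> R) l :
  (forall i, measurable_fun setT (X i)) -> measurable_fun setT (lincomb X l).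
Proof.
move=> mX; elim: l => [|p l IH].
  by rewrite (_ : lincomb X [::] = fun=> 0)//; apply/funext => x; exact: big_nil.
rewrite (funext (lincomb_cons X p l)).
by apply: measurable_funD => //; apply: measurable_funM.
Qed.

Lemma cosM (x y : R) : cos x * cos y = 2^-1 * (cos (x + y) + cos (y - x)).
Proof. by rewrite !(cosD, cosN, sinN); field. Qed.

Context d1 (T1 : measurableType d1) (P1 : probability T1 R) (X : I -> T1 -> R)
        d2 (T2 : measurableType d2) (P2 : probability T2 R) (Y : I -> T2 -> R).
Hypothesis mX : forall i, measurable_fun setT (X i).
Hypothesis mY : forall i, measurable_fun setT (Y i).

(** Equality of the Fourier transforms of the signed measures f P1 and g P2 carried over by X and Y.
    The weights are what makes an induction over coordinates possible: a treated coordinate is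
    absorbed into f and g. *)
Definition same_fourier (f : T1 -> R) (g : T2 -> R) := forall l b,
  Rintegral P1 setT (fun x => cos (lincomb X l x + b) * f x) =
  Rintegral P2 setT (fun x => cos (lincomb Y l x + b) * g x).

Section Step.
Variables (i : I) (f : T1 -> R) (g : T2 -> R).
Hypotheses (bf : bounded_measurable f) (bg : bounded_measurable g)
           (fg : same_fourier f g).

(** Functions of the [i]-th coordinate that may be absorbed into the weights. The class is enlarged
    from constants to trigonometric polynomials, signs and half-lines. *)
Let good (t : R -> R) := bounded_measurable t /\
  same_fourier (fun x => t (X i x) * f x) (fun x => t (Y i x) * g x).

Let bX t l b : bounded_measurable t ->
  bounded_measurable (fun x => cos (lincomb X l x + b) * (t (X i x) * f x)).
Proof.
move=> [mt [M tM]]; apply: bounded_measurableM.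
  apply: bounded_measurable_cos; apply: measurable_funD => //.
  exact: measurable_lincomb.
apply: bounded_measurableM => //; split; first exact: measurableT_comp.
by exists M.
Qed.

Let bY t l b : bounded_measurable t ->
  bounded_measurable (fun x => cos (lincomb Y l x + b) * (t (Y i x) * g x)).
Proof.
move=> [mt [M tM]]; apply: bounded_measurableM.
  apply: bounded_measurable_cos; apply: measurable_funD => //.
  exact: measurable_lincomb.
apply: bounded_measurableM => //; split; first exact: measurableT_comp.
by exists M.
Qed.

Let good_cst a : good (fun=> a).
Proof.
split => [|l b]; first exact: bounded_measurable_cst.
under eq_Rintegral do rewrite mulrCA.
under [RHS]eq_Rintegral do rewrite mulrCA.
rewrite !ExpZ ?fg//.
- apply: bounded_measurableM => //; apply: bounded_measurable_cos.
  by apply: measurable_funD => //; exact: measurable_lincomb.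
- apply: bounded_measurableM => //; apply: bounded_measurable_cos.
  by apply: measurable_funD => //; exact: measurable_lincomb.
Qed.

Let goodD t u : good t -> good u -> good (fun x => t x + u x).
Proof.
move=> [bt gt] [bu gu]; split=> [|l b]; first exact: bounded_measurableD.
under eq_Rintegral do rewrite mulrDl mulrDr.
under [RHS]eq_Rintegral do rewrite mulrDl mulrDr.
by rewrite !ExpD ?gt ?gu//; [exact: bY|exact: bY|exact: bX|exact: bX].
Qed.

Let goodZ a t : good t -> good (fun x => a * t x).
Proof.
move=> [bt gt]; split=> [|l b]; first exact: bounded_measurableZ.
under eq_Rintegral do rewrite -mulrA mulrCA.
under [RHS]eq_Rintegral do rewrite -mulrA mulrCA.
by rewrite !ExpZ ?gt//; [exact: bY|exact: bX].
Qed.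

(** The product-to-sum formula turns the new cosine and the test cosine into two test cosines with
    an extra frequency at [i] and shifted phases; this is where all lists [l] and all phases [b] are
    used. *)
Let good_cos t u v : good t -> good (fun x => t x * cos (u * x + v)).
Proof.
move=> [bt gt]; have mc : measurable_fun setT (fun x : R => u * x + v).
  by apply: measurable_funD => //; exact: measurable_funM.
have bc := bounded_measurable_cos mc.
split=> [|l b]; first exact: bounded_measurableM.
have e (s : R) (T : Type) (Z : I -> T -> R) x : s * u * Z i x + lincomb Z l x =
    lincomb Z ((i, s * u) :: l) x by rewrite lincomb_cons.
have E (T : Type) (Z : I -> T -> R) (h : T -> R) x :
  cos (lincomb Z l x + b) * (t (Z i x) * cos (u * Z i x + v) * h x) =
  2^-1 * (cos (lincomb Z ((i, 1 * u) :: l) x + (b + v)) * (t (Z i x) * h x) +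
          cos (lincomb Z ((i, (-1) * u) :: l) x + (b - v)) * (t (Z i x) * h x)).
  rewrite -2!e [LHS](_ : _ = (cos (u * Z i x + v) * cos (lincomb Z l x + b)) *
    (t (Z i x) * h x)); last by ring.
  rewrite cosM.
  rewrite (_ : u * Z i x + v + (lincomb Z l x + b) =
    1 * u * Z i x + lincomb Z l x + (b + v)); last by ring.
  rewrite (_ : lincomb Z l x + b - (u * Z i x + v) =
    - 1 * u * Z i x + lincomb Z l x + (b - v)); last by ring.
  by ring.
under eq_Rintegral do rewrite E.
under [RHS]eq_Rintegral do rewrite E.
rewrite !ExpZ ?ExpD ?gt//; try exact: bX; try exact: bY.
  by apply: bounded_measurableD; exact: bY.
by apply: bounded_measurableD; exact: bX.
Qed.

Let good_lim (t : nat -> R -> R) u M : (forall n, good (t n)) ->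
  (forall n x, `|t n x| <= M) -> (forall x, t n x @[n --> \oo] --> u x) -> good u.
Proof.
move=> gt tM tu; have mt n : measurable_fun setT (t n) by case: (gt n) => -[].
have bu : bounded_measurable u.
  split; first by apply: (measurable_fun_cvg mt) => x _; exact: tu.
  exists M => x; have h : `|t n x| @[n --> \oo] --> `|u x|.
    by apply: cvg_norm; exact: tu.
  by apply: (cvgr_to_le h); exact: nearW.
split => // l b.
have [_ [N fN]] := bf; have [_ [K gK]] := bg.
have [|||_ h1] := @cvg_Exp _ _ _ P1
  (fun n x => cos (lincomb X l x + b) * (t n (X i x) * f x))
  (fun x => cos (lincomb X l x + b) * (u (X i x) * f x)) (1 * (M * N)).
- by move=> n; have [bt _] := gt n; have [] := bX l b bt.
- move=> n x; rewrite normrM ler_pM//.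
    by rewrite ler_norml cos_geN1 cos_le1.
  by rewrite normrM ler_pM.
- move=> x; apply: cvgMr; apply: cvgMl; exact: tu.
have [|||_ h2] := @cvg_Exp _ _ _ P2
  (fun n x => cos (lincomb Y l x + b) * (t n (Y i x) * g x))
  (fun x => cos (lincomb Y l x + b) * (u (Y i x) * g x)) (1 * (M * K)).
- by move=> n; have [bt _] := gt n; have [] := bY l b bt.
- move=> n x; rewrite normrM ler_pM//.
    by rewrite ler_norml cos_geN1 cos_le1.
  by rewrite normrM ler_pM.
- move=> x; apply: cvgMr; apply: cvgMl; exact: tu.
apply: (cvg_unique _ h1) => //.
apply: cvg_trans h2; apply: near_eq_cvg; apply: nearW => n.
by have [_ ->] := gt n.
Qed.

Let good_poly (p : {poly R}) u v : good (fun x => p.[cos (u * x + v)]).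
Proof.
elim/poly_ind: p => [|p c IH].
  by under eq_fun do rewrite horner0; exact: good_cst.
by under eq_fun do rewrite hornerMXaddC; apply: goodD => //; exact: good_cos.
Qed.

Let good_sgr_cos u v : good (fun x => Num.sg (cos (u * x + v))).
Proof.
have c1 (x : R) : `|cos x| <= 1 by rewrite ler_norml cos_geN1 cos_le1.
apply: (@good_lim (fun k x => (sign_poly k).[cos (u * x + v)]) _ 1).
- by move=> k; exact: good_poly.
- by move=> k x; exact: sign_poly_le1.
- by move=> x; exact: cvg_sign_poly.
Qed.

(** Once |x - c| / (n + 1) < pi, the sine of (x - c) / (n + 1) has the sign of x - c. The sine is
    written as a cosine with phase -pi/2. *)
Let good_sgr c : good (fun x => Num.sg (x - c)).
Proof.
apply: (@good_lim (fun n x => Num.sg (cos (n.+1%:R^-1 * x +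
   (- (n.+1%:R^-1 * c) - pi / 2)))) _ 1).
- by move=> n; exact: good_sgr_cos.
- by move=> n x; rewrite normr_sg; case: (_ != _).
move=> x; apply: cvg_near_cst.
near=> n.
rewrite addrA -mulrBr.
have s (y : R) : cos (y - pi / 2) = sin y.
  by rewrite cosD cosN sinN cos_pihalf sin_pihalf; ring.
rewrite s.
have n0 : (0 : R) < n.+1%:R^-1 by rewrite invr_gt0 ltr0n.
have xn : `|n.+1%:R^-1 * (x - c)| < pi.
  rewrite normrM gtr0_norm// ltr_pdivrMl ?ltr0n//.
  rewrite -ltr_pdivrMr ?pi_gt0//.
  apply: (lt_trans (y := n%:R)); last by rewrite ltr_nat.
  near: n; exact: nbhs_infty_gtr.
have [xc|xc|xc] := ltgtP x c.
- rewrite [RHS]ltr0_sg ?subr_lt0// ltr0_sg// -(opprK (_ * _)) sinN oppr_lt0.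
  rewrite sin_gt0_pi// -mulrN opprB mulr_gt0 ?subr_gt0//=.
  by rewrite -(opprB x) mulrN (le_lt_trans _ xn)// -normrN ler_norm.
- rewrite [RHS]gtr0_sg ?subr_gt0// gtr0_sg//.
  rewrite sin_gt0_pi// mulr_gt0 ?subr_gt0//=.
  by rewrite (le_lt_trans _ xn)// ler_norm.
- by rewrite xc subrr mulr0 sin0.
Unshelve. all: by end_near. Qed.

Let good_gt (c : R) : good (fun x : R => (c < x)%R%:R).
Proof.
suff : good (fun x : R => 2 * (c < x)%R%:R - 1).
  move=> h; rewrite (_ : (fun x => _) =
    fun x : R => 2^-1 * (2 * (c < x)%R%:R - 1) + 2^-1).
    by apply: goodD; [exact: goodZ|exact: good_cst].
  by apply/funext => x; field.
(* Moving the threshold to the right settles the tie: at x = c the sign is -1 for every n, as the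
   strict half-line requires. *)
apply: (@good_lim (fun n x => Num.sg (x - (c + n.+1%:R^-1))) _ 1).
- by move=> n; exact: good_sgr.
- by move=> n x; rewrite normr_sg; case: (_ != _).
move=> x; apply: cvg_near_cst.
have [cx|xc] := ltP c x; last first.
  apply: nearW => n; rewrite mulr0 add0r ltr0_sg// subr_lt0.
  by rewrite (le_lt_trans xc)// ltrDl invr_gt0.
near=> n; rewrite mulr1 gtr0_sg; first by ring.
rewrite subr_gt0 -ltrBrDl invf_plt ?posrE ?subr_gt0//.
apply: (lt_trans (y := n%:R)); last by rewrite ltr_nat.
near: n; exact: nbhs_infty_gtr.
Unshelve. all: by end_near. Qed.

Lemma same_fourier_halfline (c : R) :
  same_fourier (fun x => (c < X i x)%R%:R * f x) (fun x => (c < Y i x)%R%:R * g x).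
Proof. by case: (good_gt c). Qed.

End Step.

Lemma bounded_measurable_halfline d (T : measurableType d) (Z : T -> R) (c : R) :
  measurable_fun setT Z -> bounded_measurable (fun x => (c < Z x)%R%:R : R).
Proof.
move=> mZ; rewrite (_ : (fun x => _) = \1_[set x | c < Z x]).
  apply: bounded_measurable_indic; rewrite -[X in measurable X]setTI.
  rewrite (_ : [set x | _] = Z @^-1` `]c, +oo[); first exact: mZ.
  by apply/seteqP; split => x; rewrite /= in_itv/= andbT.
apply/funext => x; rewrite indicE.
by have [h|/negP h] := boolP (c < Z x); [rewrite mem_set|rewrite memNset].
Qed.

(* A weighted Cramer-Wold theorem: each factor 1_{X_i > c} is a bounded
   pointwise limit of polynomials in cosines of X_i, and products of cosines
   are sums of cosines. *)
Lemma same_fourier_box f g (l : seq (I * R)) :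
  bounded_measurable f -> bounded_measurable g -> same_fourier f g ->
  Rintegral P1 setT (fun x => (\prod_(p <- l) (p.2 < X p.1 x)%R%:R) * f x) =
  Rintegral P2 setT (fun x => (\prod_(p <- l) (p.2 < Y p.1 x)%R%:R) * g x).
Proof.
elim: l f g => [|p l IH] f g bf bg fg.
  have := fg [::] 0; rewrite /lincomb.
  under eq_Rintegral do rewrite big_nil add0r cos0.
  under [RHS]eq_Rintegral do rewrite big_nil add0r cos0.
  under [in X in _ -> X]eq_Rintegral do rewrite big_nil.
  by under [in X in _ -> _ = X]eq_Rintegral do rewrite big_nil.
under eq_Rintegral do rewrite big_cons -mulrA mulrCA.
under [RHS]eq_Rintegral do rewrite big_cons -mulrA mulrCA.
apply: IH; last exact: same_fourier_halfline.
- by apply: bounded_measurableM => //; exact: bounded_measurable_halfline.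
- by apply: bounded_measurableM => //; exact: bounded_measurable_halfline.
Qed.

End CramerWold.

(** * From boxes to the generated sigma-algebra *)

Section PiLambda.
Context {R : realType} {I Z : Type} (c : I -> Z -> R).

(** [Z] needs no measurable structure: it will be a sample space mapped by the identity, the real
    line, or a space of tuples. *)
Definition coordinate_algebra : set (set Z) :=
  <<s \bigcup_i preimage_set_system [set: Z] (c i) measurable >>.

Definition box (l : seq (I * R)) : set Z := [set z | all (fun p => p.2 < c p.1 z) l].

Lemma setI_closed_box : setI_closed (range box).
Proof.
move=> _ _ [l _ <-] [m _ <-]; exists (l ++ m) => //.
apply/seteqP; split=> z; rewrite /box/= all_cat; first by move/andP.
by move=> [-> ->].
Qed.

Lemma coordinate_algebra_box : coordinate_algebra `<=` <<s range box >>.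
Proof.
have sB : sigma_algebra [set: Z] <<s range box >> by exact: smallest_sigma_algebra.
have [s0 sC sU] := sB.
apply: smallest_sub => // _ [i _ [A mA <-]]; rewrite setTI.
suff : measurable `<=` [set B : set R | <<s range box >> (c i @^-1` B)] by apply.
rewrite [X in X `<=` _](_ : _ = <<s @RGenOInfty.G R >>); last first.
  exact: RGenOInfty.measurableE.
apply: smallest_sub.
  split => [|B sGB|F sF]; first by rewrite /= preimage_set0.
    by rewrite /= setTD preimage_setC -setTD; exact: sC.
  by rewrite /= preimage_bigcup; exact: sU.
by move=> _ [x ->]; apply: sub_gen_smallest; exists [:: (i, x)].
Qed.

Context d1 (T1 : measurableType d1) (P1 : probability T1 R) (u1 : T1 -> Z)
        d2 (T2 : measurableType d2) (P2 : probability T2 R) (u2 : T2 -> Z).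
Let X i t := c i (u1 t).
Let Y i t := c i (u2 t).
Hypothesis mX : forall i, measurable_fun setT (X i).
Hypothesis mY : forall i, measurable_fun setT (Y i).
Variables (f : T1 -> R) (g : T2 -> R).
Hypotheses (bf : bounded_measurable f) (bg : bounded_measurable g)
           (fg : same_fourier P1 X P2 Y f g).

(** Dynkin's theorem: boxes are closed under intersection and the sets with the three properties
    form a lambda-system. Measurability of the two preimages is part of that system, since it is not
    known beforehand. *)
Lemma same_fourier_algebra C : coordinate_algebra C ->
  [/\ measurable (u1 @^-1` C), measurable (u2 @^-1` C) &
  Rintegral P1 setT (fun x => \1_(u1 @^-1` C) x * f x) =
  Rintegral P2 setT (fun x => \1_(u2 @^-1` C) x * g x)].
Proof.
move=> /coordinate_algebra_box.
pose L := [set C | [/\ measurable (u1 @^-1` C), measurable (u2 @^-1` C) &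
  Rintegral P1 setT (fun x => \1_(u1 @^-1` C) x * f x) =
  Rintegral P2 setT (fun x => \1_(u2 @^-1` C) x * g x)]].
have allE (T : Type) (V : I -> T -> R) (l : seq (I * R)) x :
    \prod_(p <- l) (p.2 < V p.1 x)%R%:R =
    (all (fun p => p.2 < V p.1 x) l)%:R :> R.
  by elim: l => [|p l IH]; rewrite ?big_nil ?big_cons//= IH -natrM mulnb.
have boxE (T : Type) (u : T -> Z) l (x : T) :
    \1_(u @^-1` box l) x = \prod_(p <- l) (p.2 < c p.1 (u x))%R%:R :> R.
  rewrite (allE T (fun i t => c i (u t))) indicE.
  by have [h|/negP h] := boolP (all _ _); [rewrite mem_set|rewrite memNset].
have mbox d (T : measurableType d) (u : T -> Z) l :
    (forall i, measurable_fun setT (c i \o u)) -> measurable (u @^-1` box l).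
  move=> mu; elim: l => [|p l IH].
    by rewrite (_ : _ @^-1` _ = setT)//; apply/seteqP; split.
  rewrite (_ : _ @^-1` _ = (c p.1 \o u) @^-1` `]p.2, +oo[ `&` u @^-1` box l).
    by apply: measurableI => //; rewrite -[X in measurable X]setTI; exact: mu.
  apply/seteqP; split=> x; rewrite /box/= in_itv/= andbT; first by move/andP.
  by move=> [-> ->].
have bind d (T : measurableType d) (u : T -> Z) (h : T -> R) D :
    bounded_measurable h -> measurable (u @^-1` D) ->
    bounded_measurable (fun x => \1_(u @^-1` D) x * h x).
  by move=> bh mD; apply: bounded_measurableM => //; exact: bounded_measurable_indic.
apply: (@lambda_system_subset _ _ setI_closed_box setT L) => //; last first.
  move=> _ [l _ <-]; split; [exact: mbox|exact: mbox|].
  under eq_Rintegral do rewrite boxE.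
  under [RHS]eq_Rintegral do rewrite boxE.
  exact: (same_fourier_box mX mY).
split => //.
- split; [exact: measurableT|exact: measurableT|].
  have := same_fourier_box mX mY [::] bf bg fg.
  under eq_Rintegral do rewrite big_nil.
  under [in X in _ = X -> _]eq_Rintegral do rewrite big_nil.
  move=> e; under eq_Rintegral do rewrite preimage_setT indicT.
  by rewrite e; under [RHS]eq_Rintegral do rewrite preimage_setT indicT.
- move=> A B BA [mA1 mA2 eA] [mB1 mB2 eB]; split.
  + by rewrite setDE preimage_setI preimage_setC; apply: measurableD.
  + by rewrite setDE preimage_setI preimage_setC; apply: measurableD.
  + have DE (T : Type) (u : T -> Z) (h : T -> R) x :
        \1_(u @^-1` (A `\` B)) x * h x =
        \1_(u @^-1` A) x * h x - \1_(u @^-1` B) x * h x.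
      rewrite -mulrBl; congr (_ * _); rewrite !indicE.
      have [Bx|nBx] := pselect (B (u x)).
        rewrite [in LHS]memNset; last by case.
        by rewrite !mem_set ?subrr//; exact: BA.
      rewrite [x \in u @^-1` B]memNset// subr0.
      have [Ax|nAx] := pselect (A (u x)); first by rewrite !mem_set.
      by rewrite !memNset// => -[].
    under eq_Rintegral do rewrite DE.
    under [RHS]eq_Rintegral do rewrite DE.
    by rewrite !ExpB ?eA ?eB//; exact: bind.
- move=> F ndF LF.
  have mF1 n : measurable (u1 @^-1` F n) by case: (LF n).
  have mF2 n : measurable (u2 @^-1` F n) by case: (LF n).
  split.
  + by rewrite preimage_bigcup; exact: bigcupT_measurable.
  + by rewrite preimage_bigcup; exact: bigcupT_measurable.
  have lim (T : Type) (u : T -> Z) (h : T -> R) x :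
      \1_(u @^-1` F n) x * h x @[n --> \oo] --> \1_(u @^-1` \bigcup_n F n) x * h x.
    apply: cvg_near_cst.
    have [[n _ Fn]|nF] := pselect ((\bigcup_n F n) (u x)).
      exists n => // m /= nm; rewrite !indicE mem_set; last first.
        by have /subsetPset := ndF _ _ nm; apply.
      by rewrite mem_set//; exists n.
    apply: nearW => n; rewrite !indicE !memNset//.
    by move=> Fn; apply: nF; exists n.
  have lE d (T : measurableType d) (P : probability T R) (u : T -> Z) (h : T -> R) :
      bounded_measurable h -> (forall n, measurable (u @^-1` F n)) ->
      Rintegral P setT (fun x => \1_(u @^-1` F n) x * h x) @[n --> \oo] -->
      Rintegral P setT (fun x => \1_(u @^-1` \bigcup_n F n) x * h x).
    move=> bh mF; have [_ [M hM]] := bh.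
    apply: (@cvg_Exp _ _ _ P _ _ M _ _ (lim T u h)).2.
    + by move=> n; have [] := bind _ _ u h _ bh (mF n).
    + move=> n x; rewrite normrM -[M]mul1r ler_pM// indicE.
      by case: (_ \in _); rewrite ?normr1 ?normr0.
  have h1 := lE _ _ P1 u1 f bf mF1; have h2 := lE _ _ P2 u2 g bg mF2.
  apply: (cvg_unique _ h1) => //.
  apply: cvg_trans h2; apply: near_eq_cvg; apply: nearW => n.
  by case: (LF n).
Qed.

End PiLambda.

(** * Independence from factorization of cosine transforms *)

Section Independence.
Context {R : realType} d {Omega : measurableType d} (P : probability Omega R).

Local Notation E f := (Rintegral P setT f).

Lemma prod_indicE (I : Type) (s : seq I) (A : I -> set Omega) x :
  \prod_(i <- s) \1_(A i) x = \1_(\big[setI/setT]_(i <- s) A i) x :> R.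
Proof.
elim: s => [|i s IH]; first by rewrite !big_nil indicT.
by rewrite !big_cons IH indicI.
Qed.

(* bigcap_seq needs a choiceType. *)
Lemma bigcap_seq_eqType (I : eqType) (s : seq I) (A : I -> set Omega) :
  \bigcap_(i in [set` s]) A i = \big[setI/setT]_(i <- s) A i.
Proof.
elim: s => [|j s IH]; first by rewrite big_nil; apply/seteqP; split.
rewrite big_cons -IH; apply/seteqP; split=> [x h|x [Ax h] i /=].
  split; first by apply: h; rewrite /= inE eqxx.
  by move=> i /= si; apply: h; rewrite /= inE si orbT.
by rewrite inE => /predU1P[->//|si]; exact: h.
Qed.

Lemma bigsetI_seq_measurable (I : eqType) (s : seq I) (A : I -> set Omega) :
  {in s, forall i, measurable (A i)} -> measurable (\big[setI/setT]_(i <- s) A i).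
Proof.
move=> mA; rewrite big_seq; apply: (big_ind measurable) => //.
exact: measurableI.
Qed.

Lemma bounded_measurable_lincomb_cos (T : Type) (X : T -> Omega -> R) l b :
  (forall t, measurable_fun setT (X t)) ->
  bounded_measurable (fun x => cos (lincomb X l x + b)).
Proof.
move=> mX; apply: bounded_measurable_cos; apply: measurable_funD => //.
exact: measurable_lincomb.
Qed.

Section OfFourier.
Context {I : eqType} {T : Type} (J : set I) (X : I -> T -> Omega -> R).
Hypothesis mX : forall k t, measurable_fun setT (X k t).
Hypothesis facX : forall s : seq I, uniq s -> {in s, forall i, J i} ->
  forall (a : I -> seq (T * R)) (b : R),
  E (fun x => cos (\sum_(k <- s) lincomb (X k) (a k) x + b)) =
  cos b * \prod_(k <- s) E (fun x => cos (lincomb (X k) (a k) x)).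

Let phi k l := E (fun x => cos (lincomb (X k) l x)).

Let opp_comb (l : seq (T * R)) := [seq (p.1, - p.2) | p <- l].

Let lincomb_opp k l x : lincomb (X k) (opp_comb l) x = - lincomb (X k) l x.
Proof.
rewrite /lincomb big_map -sumrN; apply: eq_bigr => p _ /=; exact: mulNr.
Qed.

Let phi_opp k l : phi k (opp_comb l) = phi k l.
Proof. by rewrite /phi; under eq_Rintegral do rewrite lincomb_opp cosN. Qed.

(** The one-index case of [facX]. No sine term appears, which amounts to symmetry of the law of
    every combination. *)
Let phi_shift k l b : J k ->
  E (fun x => cos (lincomb (X k) l x + b)) = cos b * phi k l.
Proof.
move=> Jk; have := @facX [:: k] isT _ (fun=> l) b.
rewrite big_seq1 => <-; first by under [RHS]eq_Rintegral do rewrite big_seq1.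
by move=> i; rewrite inE => /eqP ->.
Qed.

Let upd {A : Type} (a : I -> A) k v := fun j => if j == k then v else a j.

Let upd_id (A : Type) (a : I -> A) k v : upd a k v k = v.
Proof. by rewrite /upd eqxx. Qed.

Let upd_notin (A : Type) (a : I -> A) k v (s : seq I) j :
  k \notin s -> j \in s -> upd a k v j = a j.
Proof. by move=> ks js; rewrite /upd; case: eqP => // jk; rewrite -jk js in ks. Qed.

Let eq_upd (A B : Type) (op : B -> B -> B) (e : B) (F : I -> A -> B) (a : I -> A) k v s :
  k \notin s -> \big[op/e]_(j <- s) F j (upd a k v j) = \big[op/e]_(j <- s) F j (a j).
Proof. by move=> ks; apply: eq_big_seq => j js; rewrite (upd_notin _ _ ks js). Qed.

Let m_cos_sum s (a : I -> seq (T * R)) b :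
  bounded_measurable (fun x => cos (\sum_(k <- s) lincomb (X k) (a k) x + b)).
Proof.
apply: bounded_measurable_cos; apply: measurable_funD => //.
by apply: measurable_sum => k; exact: measurable_lincomb.
Qed.

(** Indices pass one at a time from the product to the sum. Each passage yields two cosines of sums,
    one with the coefficients at [k] negated; by [phi_opp] both have the same transform, and cos(b +
    beta) + cos(b - beta) = 2 cos b cos beta recombines them. *)
Let cos_mixed s1 s2 (a : I -> seq (T * R)) (beta : I -> R) b :
  uniq (s1 ++ s2) -> {in s1 ++ s2, forall i, J i} ->
  E (fun x => (\prod_(k <- s1) cos (lincomb (X k) (a k) x + beta k)) *
              cos (\sum_(k <- s2) lincomb (X k) (a k) x + b)) =
  (\prod_(k <- s1) (cos (beta k) * phi k (a k))) *
  (cos b * \prod_(k <- s2) phi k (a k)).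
Proof.
elim: s1 s2 a b => [|k s1 IH] s2 a b /= us Js.
  under eq_Rintegral do rewrite big_nil mul1r.
  by rewrite facX// big_nil mul1r.
have [ks us12] := andP us.
have [ks1 ks2] : k \notin s1 /\ k \notin s2.
  by move: ks; rewrite mem_cat negb_or => /andP.
have us' : uniq (s1 ++ k :: s2).
  by rewrite -cat1s uniq_catCA.
have Js' : {in s1 ++ k :: s2, forall i, J i}.
  move=> i; rewrite mem_cat inE orbCA => h; apply: Js.
  by rewrite inE mem_cat.
have e x : \prod_(j <- k :: s1) cos (lincomb (X j) (a j) x + beta j) *
     cos (\sum_(j <- s2) lincomb (X j) (a j) x + b) =
  2^-1 * ((\prod_(j <- s1) cos (lincomb (X j) (a j) x + beta j)) *
     cos (\sum_(j <- k :: s2) lincomb (X j) (a j) x + (b + beta k)) +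
   (\prod_(j <- s1) cos (lincomb (X j) (upd a k (opp_comb (a k)) j) x + beta j)) *
     cos (\sum_(j <- k :: s2) lincomb (X j) (upd a k (opp_comb (a k)) j) x +
       (b - beta k))).
  rewrite (eq_upd _ _ (fun j v => cos (lincomb (X j) v x + beta j)))//.
  rewrite !big_cons (eq_upd _ _ (fun j v => lincomb (X j) v x))//.
  rewrite upd_id lincomb_opp -mulrA [cos _ * _]mulrC -mulrA.
  rewrite [cos (_ + b) * _]mulrC cosM.
  set A := lincomb _ _ _; set B := \sum_(_ <- _) _.
  rewrite (_ : A + beta k + (B + b) = A + B + (b + beta k)); last by ring.
  rewrite (_ : B + b - (A + beta k) = - A + B + (b - beta k)); last by ring.
  by ring.
under eq_Rintegral do rewrite e.
rewrite ExpZ ?ExpD; last first.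
- by apply: bounded_measurableD; (apply: bounded_measurableM => //;
    apply: bounded_measurable_prod => j; exact: bounded_measurable_lincomb_cos).
- by apply: bounded_measurableM => //;
    apply: bounded_measurable_prod => j; exact: bounded_measurable_lincomb_cos.
- by apply: bounded_measurableM => //;
    apply: bounded_measurable_prod => j; exact: bounded_measurable_lincomb_cos.
rewrite !IH// !big_cons.
rewrite (eq_upd _ _ (fun j v => cos (beta j) * phi j v))// (eq_upd _ _ phi)//.
rewrite upd_id phi_opp !cosD !cosN !sinN.
set A := \prod_(_ <- _) _; set B := \prod_(_ <- _) _.
by field.
Qed.

(** Cosines are exchanged for indicators one index at a time. With [h] the product of the other
    factors and [kappa] its expected value in product form, the induction hypothesis says that the
    weights [h] and [kappa] have the same transform against [X k]; hence they give the same integral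
    over every event of [X k]. *)
Let indic_mixed (A : I -> set Omega) s1 s2 (a : I -> seq (T * R)) (beta : I -> R) :
  uniq (s1 ++ s2) -> {in s1 ++ s2, forall i, J i} ->
  {in s1, forall i, coordinate_algebra (X i) (A i)} ->
  E (fun x => (\prod_(k <- s1) \1_(A k) x) *
              \prod_(k <- s2) cos (lincomb (X k) (a k) x + beta k)) =
  (\prod_(k <- s1) fine (P (A k))) *
  \prod_(k <- s2) E (fun x => cos (lincomb (X k) (a k) x + beta k)).
Proof.
elim: s1 s2 a beta => [|k s1 IH] s2 a beta us Js As.
  under eq_Rintegral do rewrite big_nil mul1r.
  rewrite big_nil mul1r.
  have := @cos_mixed s2 [::] a beta 0; rewrite cats0 big_nil cos0 !mulr1.
  move=> /(_ us Js).
  under [in X in X = _ -> _]eq_Rintegral do rewrite big_nil add0r cos0 mulr1.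
  move=> ->.
  by apply: eq_big_seq => i si; rewrite phi_shift//; exact: Js.
have [ks us12] := andP us.
have [ks1 ks2] : k \notin s1 /\ k \notin s2.
  by move: ks; rewrite mem_cat negb_or => /andP.
have us' : uniq (s1 ++ k :: s2) by rewrite -cat1s uniq_catCA.
have Js' : {in s1 ++ k :: s2, forall i, J i}.
  move=> i; rewrite mem_cat inE orbCA => h; apply: Js.
  by rewrite inE mem_cat.
have As' : {in s1, forall i, coordinate_algebra (X i) (A i)}.
  by move=> i si; apply: As; rewrite inE si orbT.
(* With zero weights the transforms agree trivially, and only the measurability part of the
   conclusion is taken. *)
have mA i : i \in k :: s1 -> measurable (A i).
  move=> iks; have [] := @same_fourier_algebra _ _ _ (X i) _ _ P id _ _ P id
    (mX i) (mX i) (fun=> 0) (fun=> 0) (bounded_measurable_cst 0)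
    (bounded_measurable_cst 0) _ _ (As _ iks) => //.
pose h x := (\prod_(j <- s1) \1_(A j) x) *
  \prod_(j <- s2) cos (lincomb (X j) (a j) x + beta j).
have bh : bounded_measurable h.
  apply: bounded_measurableM; last first.
    by apply: bounded_measurable_prod => j; exact: bounded_measurable_lincomb_cos.
  rewrite (_ : (fun x => _) = \1_(\big[setI/setT]_(j <- s1) A j)).
    apply: bounded_measurable_indic; apply: bigsetI_seq_measurable => j js.
    by apply: mA; rewrite inE js orbT.
  by apply/funext => x; exact: prod_indicE.
pose kappa := (\prod_(j <- s1) fine (P (A j))) *
  \prod_(j <- s2) E (fun x => cos (lincomb (X j) (a j) x + beta j)).
have sf : same_fourier P (X k) P (X k) h (fun=> kappa).
  move=> l b.
  have := @IH (k :: s2) (upd a k l) (upd beta k b) us' Js' As'.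
  have e x : \prod_(j <- s1) \1_(A j) x *
      \prod_(j <- k :: s2) cos (lincomb (X j) (upd a k l j) x + upd beta k b j) =
    cos (lincomb (X k) l x + b) * h x.
    rewrite big_cons !upd_id mulrCA /h; congr (_ * _); congr (_ * _).
    by apply: eq_big_seq => j js; rewrite !(upd_notin _ _ ks2 js).
  under [in X in X = _ -> _]eq_Rintegral do rewrite e.
  move=> ->; rewrite big_cons !upd_id.
  under [RHS]eq_Rintegral do rewrite mulrC.
  rewrite ExpZ; last exact: bounded_measurable_lincomb_cos.
  rewrite mulrCA mulrC; congr (_ * _ * _).
  by apply: eq_big_seq => j js; rewrite !(upd_notin _ _ ks2 js).
have [_ _] := same_fourier_algebra (u1 := id) (u2 := id) (mX k) (mX k) bh
  (bounded_measurable_cst kappa) sf (As k (mem_head _ _)).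
move=> e; transitivity (E (fun x => \1_(A k) x * kappa)).
  by under eq_Rintegral do rewrite big_cons -mulrA; exact: e.
under eq_Rintegral do rewrite mulrC.
rewrite ExpZ; last by apply: bounded_measurable_indic; apply: mA; exact: mem_head.
rewrite Exp_indic; last by apply: mA; exact: mem_head.
by rewrite /kappa big_cons; ring.
Qed.

Lemma independent_of_fourier :
  independent_systems P J (fun k => coordinate_algebra (X k)).
Proof.
move=> s us Js A As.
have mA : {in s, forall i, measurable (A i)}.
  move=> i si; have [] := @same_fourier_algebra _ _ _ (X i) _ _ P id _ _ P id
    (mX i) (mX i) (fun=> 0) (fun=> 0) (bounded_measurable_cst 0)
    (bounded_measurable_cst 0) _ _ (As _ si) => //.
have := @indic_mixed A s [::] (fun=> [::]) (fun=> 0).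
rewrite cats0 big_nil mulr1 => <-//.
under eq_Rintegral do rewrite big_nil mulr1 prod_indicE.
rewrite Exp_indic ?fineK; last exact: bigsetI_seq_measurable.
- by rewrite bigcap_seq_eqType.
- by apply: fin_num_measure; exact: bigsetI_seq_measurable.
Qed.

End OfFourier.
End Independence.

(** * From independence to factorization of cosine transforms *)

Section Products.
Context {R : realType} d {Omega : measurableType d} (P : probability Omega R).

Local Notation E f := (Rintegral P setT f).

Lemma sum_ltn_minn (m N : nat) : (\sum_(k < N) (k < m : nat))%N = minn m N.
Proof.
elim: N => [|N IH]; first by rewrite big_ord0 minn0.
rewrite big_ord_recr/= IH; have [Nm|mN] := ltnP N m.
  by rewrite (minn_idPr Nm) addn1.
by rewrite (minn_idPl (leqW mN)) addn0.
Qed.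

(* f is a uniform limit of step functions of f. *)
Lemma Exp_mul_of_indic (f h : Omega -> R) (kappa : R) :
  bounded_measurable f -> bounded_measurable h ->
  (forall B : set R, measurable B ->
    E (fun x => \1_(f @^-1` B) x * h x) = kappa * fine (P (f @^-1` B))) ->
  E (fun x => f x * h x) = kappa * E f.
Proof.
move=> bf bh hB; have [mf [M fM]] := bf; have [mh [K hK]] := bh.
pose good (t : Omega -> R) := bounded_measurable t /\
  E (fun x => t x * h x) = kappa * E t.
have goodD t u : good t -> good u -> good (fun x => t x + u x).
  move=> [bt et] [bu eu]; split; first exact: bounded_measurableD.
  under eq_Rintegral do rewrite mulrDl.
  rewrite [LHS]ExpD; [|exact: bounded_measurableM|exact: bounded_measurableM].
  by rewrite ExpD// et eu mulrDr.
have goodZ a t : good t -> good (fun x => a * t x).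
  move=> [bt et]; split; first exact: bounded_measurableZ.
  under eq_Rintegral do rewrite -mulrA.
  rewrite [LHS]ExpZ; last exact: bounded_measurableM.
  by rewrite ExpZ// et mulrCA.
have mB B : measurable B -> measurable (f @^-1` B).
  by move=> ?; rewrite -[X in measurable X]setTI; exact: mf.
have goodI B : measurable B -> good (fun x => \1_B (f x)).
  move=> mB'; rewrite (_ : (fun x => _) = \1_(f @^-1` B)); last exact/funext.
  split; first by apply: bounded_measurable_indic; exact: mB.
  by rewrite hB// Exp_indic//; exact: mB.
have goodc a : good (fun=> a).
  rewrite (_ : (fun=> a) = fun x => a * \1_[set: R] (f x)).
    by apply: goodZ; exact: goodI.
  by apply/funext => x; rewrite indicT mulr1.
have goodS j (F : nat -> Omega -> R) : (forall k, good (F k)) ->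
    good (fun x => \sum_(k < j) F k x).
  move=> gF; elim: j => [|j IH].
    by rewrite (_ : (fun x => _) = fun=> 0)//; apply/funext => x; rewrite big_ord0.
  rewrite (_ : (fun x => _) = fun x => \sum_(k < j) F k x + F j x); first exact: goodD.
  by apply/funext => x; rewrite big_ord_recr.
pose B (n k : nat) : set R := [set y | k.+1%:R <= (y + M) * n.+1%:R].
have mBnk n k : measurable (B n k).
  rewrite (_ : B n k = `[k.+1%:R / n.+1%:R - M, +oo[%classic).
    exact: measurable_itv.
  apply/seteqP; split=> y; rewrite /B /= in_itv/= andbT lerBlDr.
    by rewrite ler_pdivrMr.
  by rewrite ler_pdivrMr.
pose N n := ((Num.truncn (M + M)).+1 * n.+1)%N.
(* The number of thresholds met by f x is the integer part of (f x + M)(n + 1), so [q n] rounds f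
   down to a grid of mesh 1 / (n + 1). Since 0 <= f + M <= 2 M, [N n] thresholds are enough. *)
pose q n x := n.+1%:R^-1 * (\sum_(k < N n) \1_(B n k) (f x)) - M.
have goodq n : good (q n).
  rewrite /q; apply: goodD; last exact: goodc.
  by apply: goodZ; apply: (goodS _ (fun k x => \1_(B n k) (f x))) => k; exact: goodI.
have qf n x : `|q n x - f x| <= n.+1%:R^-1.
  have n0 : (0 : R) < n.+1%:R by rewrite ltr0n.
  set z := (f x + M) * n.+1%:R.
  have fx := fM x; rewrite ler_norml in fx; have /andP[fx1 fx2] := fx.
  have z0 : 0 <= z by rewrite mulr_ge0//; lra.
  have /andP[zl zu] := truncn_itv z0.
  have M2 : 0 <= M + M by lra.
  have /andP[_ Mu] := truncn_itv M2.
  have zN : (Num.truncn z <= N n)%N.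
    rewrite -(ler_nat R) (le_trans zl)// /N natrM ler_pM2r//.
    by apply: le_trans (ltW Mu); lra.
  rewrite /q (_ : \sum_(k < N n) \1_(B n k) (f x) = (Num.truncn z)%:R); last first.
    rewrite -[in RHS](minn_idPl zN) -sum_ltn_minn natr_sum.
    apply: eq_bigr => k _; rewrite indicE; congr (_%:R).
    have [kz|zk] := ltnP k (Num.truncn z).
      by rewrite mem_set// /B /= (le_trans _ zl)// ler_nat.
    rewrite memNset// /B /= -/z => kz.
    by have := le_lt_trans kz zu; rewrite ltr_nat ltnS ltnNge zk.
  rewrite (_ : _ - M - f x = n.+1%:R^-1 * ((Num.truncn z)%:R - z)); last first.
    by rewrite /z; field; rewrite gt_eqF.
  rewrite normrM [X in X * _]gtr0_norm ?invr_gt0// -[leRHS]mulr1 ler_pM2l ?invr_gt0//.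
  by rewrite ler_norml; move: zu; rewrite -natr1; lra.
have qM n x : `|q n x| <= M + 1.
  rewrite -[q n x](subrK (f x)) (le_trans (ler_normD _ _))// addrC lerD//.
  by rewrite (le_trans (qf n x))// invf_le1 ?ler1n ?ltr0n.
have qcv x : q n x @[n --> \oo] --> f x.
  apply/cvgrPdist_le => /= e e0; near=> n.
  rewrite distrC (le_trans (qf n x))// -[leRHS]invrK lef_pV2 ?posrE ?invr_gt0 ?ltr0n//.
  rewrite (le_trans (y := n%:R)) ?ler_nat//.
  by near: n; exact: nbhs_infty_ger.
have mq n : measurable_fun setT (q n) by case: (goodq n) => -[].
have [_ l1] := cvg_Exp P mq qM qcv.
have [|||_ l2] := @cvg_Exp _ _ _ P (fun n x => q n x * h x)
  (fun x => f x * h x) ((M + 1) * K).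
- by move=> n; apply: measurable_funM.
- by move=> n x; rewrite normrM ler_pM.
- by move=> x; apply: cvgMl; exact: qcv.
apply: (cvg_unique _ l2) => //.
rewrite (_ : (fun n => _) = (fun n => kappa * E (q n))); last first.
  by apply/funext => n; case: (goodq n).
exact: cvgMr.
Unshelve. all: by end_near. Qed.

Section Independent.
Context {I : eqType} (J : set I) (G : I -> set (set Omega)).
Hypothesis indG : independent_systems P J G.

Definition adapted_to (k : I) (f : Omega -> R) :=
  forall B : set R, measurable B -> G k (f @^-1` B).

(** The base case is the product rule for events; [Exp_mul_of_indic] then exchanges one event for
    one bounded function at a time, the remaining factors serving as weight. *)
Let mixed s1 s2 (f : I -> Omega -> R) (A : I -> set Omega) :
  uniq (s1 ++ s2) -> {in s1 ++ s2, forall k, J k} ->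
  {in s1, forall k, bounded_measurable (f k) /\ adapted_to k (f k)} ->
  {in s2, forall k, measurable (A k) /\ G k (A k)} ->
  E (fun x => (\prod_(k <- s1) f k x) * \prod_(k <- s2) \1_(A k) x) =
  (\prod_(k <- s1) E (f k)) * \prod_(k <- s2) fine (P (A k)).
Proof.
elim: s1 s2 f A => [|k s1 IH] s2 f A us Js fs As.
  have mA : {in s2, forall k, measurable (A k)} by move=> k /As[].
  under eq_Rintegral do rewrite big_nil mul1r prod_indicE.
  rewrite big_nil mul1r Exp_indic; last exact: bigsetI_seq_measurable.
  by rewrite -bigcap_seq_eqType indG// => k /As[].
have [ks us12] := andP us.
have [ks1 ks2] : k \notin s1 /\ k \notin s2.
  by move: ks; rewrite mem_cat negb_or => /andP.
have us' : uniq (s1 ++ k :: s2) by rewrite -cat1s uniq_catCA.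
have Js' : {in s1 ++ k :: s2, forall i, J i}.
  by move=> i; rewrite mem_cat inE orbCA => h; apply: Js; rewrite inE mem_cat.
have fs' : {in s1, forall k, bounded_measurable (f k) /\ adapted_to k (f k)}.
  by move=> i si; apply: fs; rewrite inE si orbT.
have [bfk afk] := fs k (mem_head _ _).
pose h x := (\prod_(j <- s1) f j x) * \prod_(j <- s2) \1_(A j) x.
have bh : bounded_measurable h.
  apply: bounded_measurableM; last first.
    rewrite (_ : (fun x => _) = \1_(\big[setI/setT]_(j <- s2) A j)).
      by apply: bounded_measurable_indic; apply: bigsetI_seq_measurable => j /As[].
    by apply/funext => x; exact: prod_indicE.
  elim: (s1) fs' => [|i s IHs] fs1.
    by under eq_fun do rewrite big_nil; exact: bounded_measurable_cst.
  under eq_fun do rewrite big_cons; apply: bounded_measurableM.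
    by have [] := fs1 i (mem_head _ _).
  by apply: IHs => j js; apply: fs1; rewrite inE js orbT.
under eq_Rintegral do rewrite big_cons -mulrA.
rewrite (@Exp_mul_of_indic _ h ((\prod_(j <- s1) E (f j)) *
  \prod_(j <- s2) fine (P (A j))))//.
  by rewrite big_cons; ring.
move=> B mB; have := @IH (k :: s2) f (fun j => if j == k then f k @^-1` B else A j).
have As' : {in k :: s2, forall j, measurable (if j == k then f k @^-1` B else A j) /\
    G j (if j == k then f k @^-1` B else A j)}.
  move=> j; rewrite inE; case: eqP => [-> _|_ /= js]; last exact: As.
  by split; [rewrite -[X in measurable X]setTI; exact: (bfk.1)|exact: afk].
move=> /(_ us' Js' fs' As').
have eqA (V : Type) (op : V -> V -> V) e (F : set Omega -> V) :
    \big[op/e]_(j <- s2) F (if j == k then f k @^-1` B else A j) =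
    \big[op/e]_(j <- s2) F (A j).
  by apply: eq_big_seq => j js; case: eqP => // jk; rewrite -jk js in ks2.
rewrite big_cons eqxx (eqA _ _ _ (fun A => fine (P A))).
under [in X in X = _ -> _]eq_Rintegral do
  rewrite big_cons eqxx (eqA _ _ _ (fun A => \1_A _)) mulrCA.
by move=> ->; rewrite mulrCA mulrC.
Qed.

Lemma Exp_prod_independent s (f : I -> Omega -> R) :
  uniq s -> {in s, forall k, J k} ->
  {in s, forall k, bounded_measurable (f k) /\ adapted_to k (f k)} ->
  E (fun x => \prod_(k <- s) f k x) = \prod_(k <- s) E (f k).
Proof.
move=> us Js fs; have := @mixed s [::] f (fun=> setT).
rewrite cats0 big_nil mulr1 => <-//.
by apply: eq_Rintegral => x _; rewrite big_nil mulr1.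
Qed.

(** Splits off one summand by cos(X + S + c) = cos X cos(S + c) + sin X cos(S + c + pi/2). The
    factor sin X has expectation 0, by the hypothesis on [X k] at phase -pi/2, so only the first
    term survives. *)
Lemma Exp_cos_sum s (X : I -> Omega -> R) (phi : I -> R) b :
  uniq s -> {in s, forall k, J k} ->
  {in s, forall k, [/\ measurable_fun setT (X k), adapted_to k (X k) &
    forall b, E (fun x => cos (X k x + b)) = cos b * phi k]} ->
  E (fun x => cos (\sum_(k <- s) X k x + b)) = cos b * \prod_(k <- s) phi k.
Proof.
have gen s1 s2 (f : I -> Omega -> R) c :
  uniq (s1 ++ s2) -> {in s1 ++ s2, forall k, J k} ->
  {in s1, forall k, bounded_measurable (f k) /\ adapted_to k (f k)} ->
  {in s2, forall k, [/\ measurable_fun setT (X k), adapted_to k (X k) &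
    forall b, E (fun x => cos (X k x + b)) = cos b * phi k]} ->
  E (fun x => (\prod_(k <- s1) f k x) * cos (\sum_(k <- s2) X k x + c)) =
  (\prod_(k <- s1) E (f k)) * (cos c * \prod_(k <- s2) phi k).
  elim: s2 s1 f c => [|k s2 IH] s1 f c us Js fs Xs.
    rewrite big_nil mulr1 [in RHS]mulrC; rewrite cats0 in us Js.
    under eq_Rintegral do rewrite big_nil add0r mulrC.
    rewrite ExpZ ?Exp_prod_independent//.
    elim: (s1) fs => [|i s' IHs] fs1.
      by under eq_fun do rewrite big_nil; exact: bounded_measurable_cst.
    under eq_fun do rewrite big_cons; apply: bounded_measurableM.
      by have [] := fs1 i (mem_head _ _).
    by apply: IHs => j js; apply: fs1; rewrite inE js orbT.
  have us' : uniq ((k :: s1) ++ s2) by rewrite -(cat1s k s1) -catA uniq_catCA.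
  have ks1 : k \notin s1.
    by move: us'; rewrite /= mem_cat negb_or => /andP[/andP[]].
  have Js' : {in (k :: s1) ++ s2, forall i, J i}.
    by move=> i; rewrite mem_cat inE -orbA orbCA => h; apply: Js; rewrite mem_cat inE.
  have [mXk aXk eXk] := Xs k (mem_head _ _).
  have Xs' : {in s2, forall k, [/\ measurable_fun setT (X k), adapted_to k (X k) &
      forall b, E (fun x => cos (X k x + b)) = cos b * phi k]}.
    by move=> i si; apply: Xs; rewrite inE si orbT.
  have mS : measurable_fun setT (fun x => \sum_(j <- s2) X j x).
    elim: (s2) Xs' => [|i s' IHs] Xs2.
      by under eq_fun do rewrite big_nil; exact: measurable_cst.
    under eq_fun do rewrite big_cons; apply: measurable_funD.
      by have [] := Xs2 i (mem_head _ _).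
    by apply: IHs => j js; apply: Xs2; rewrite inE js orbT.
  have bP : bounded_measurable (fun x => \prod_(j <- s1) f j x).
    elim: (s1) fs => [|i s' IHs] fs1.
      by under eq_fun do rewrite big_nil; exact: bounded_measurable_cst.
    under eq_fun do rewrite big_cons; apply: bounded_measurableM.
      by have [] := fs1 i (mem_head _ _).
    by apply: IHs => j js; apply: fs1; rewrite inE js orbT.
  pose u g := fun j => if j == k then g else f j.
  have uE (V : Type) (op : V -> V -> V) e g (F : (Omega -> R) -> V) :
      \big[op/e]_(j <- s1) F (u g j) = \big[op/e]_(j <- s1) F (f j).
    apply: eq_big_seq => j js; rewrite /u; case: eqP => // jk.
    by rewrite -jk js in ks1.
  have us1 (g : R -> R) : measurable_fun setT g -> (exists M, forall x, `|g x| <= M) ->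
    {in k :: s1, forall j, bounded_measurable (u (g \o X k) j) /\
                           adapted_to j (u (g \o X k) j)}.
    move=> mg [M gM] j; rewrite inE /u; case: eqP => [-> _|_ /= js]; last exact: fs.
    split; first by split; [exact: measurableT_comp|exists M => x; exact: gM].
    move=> B mB; rewrite comp_preimage; apply: aXk.
    by rewrite -[X in measurable X]setTI; exact: mg.
  have c1 (x : R) : `|cos x| <= 1 by rewrite ler_norml cos_geN1 cos_le1.
  have s1' (x : R) : `|sin x| <= 1 by rewrite ler_norml sin_geN1 sin_le1.
  have mcos : measurable_fun setT (@cos R).
    by apply: continuous_measurable_fun; exact: continuous_cos.
  have msin : measurable_fun setT (@sin R).
    by apply: continuous_measurable_fun; exact: continuous_sin.
  have i1 := IH (k :: s1) _ c us' Js' (us1 _ mcos (ex_intro _ 1 c1)) Xs'.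
  have i2 := IH (k :: s1) _ (c + pi / 2) us' Js' (us1 _ msin (ex_intro _ 1 s1')) Xs'.
  have e x : (\prod_(j <- s1) f j x) * cos (\sum_(j <- k :: s2) X j x + c) =
    (\prod_(j <- k :: s1) u (cos \o X k) j x) * cos (\sum_(j <- s2) X j x + c) +
    (\prod_(j <- k :: s1) u (sin \o X k) j x) *
      cos (\sum_(j <- s2) X j x + (c + pi / 2)).
    rewrite !big_cons (uE _ _ _ _ (fun g => g x)) (uE _ _ _ _ (fun g => g x)).
    rewrite {1 2}/u eqxx /= (addrA _ c) [cos (_ + _ + pi / 2)]cosD.
    rewrite cos_pihalf sin_pihalf -(addrA (X k x)) cosD; ring.
  under eq_Rintegral do rewrite e.
  have bm (g : R -> R) c' : measurable_fun setT g ->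
      (exists M, forall x, `|g x| <= M) ->
      bounded_measurable (fun x => \prod_(j <- k :: s1) u (g \o X k) j x *
        cos (\sum_(j <- s2) X j x + c')).
    move=> mg [M gM]; apply: bounded_measurableM; last first.
      by apply: bounded_measurable_cos; exact: measurable_funD.
    under eq_fun do rewrite big_cons (uE _ _ _ _ (fun g => g _)).
    apply: bounded_measurableM => //; rewrite /u eqxx.
    by split; [exact: measurableT_comp|exists M => x; exact: gM].
  rewrite ExpD; [|by apply: bm; [exact: mcos|exists 1]|
    by apply: bm; [exact: msin|exists 1]].
  rewrite i1 i2 !big_cons (uE _ _ _ _ (fun g => E g)) (uE _ _ _ _ (fun g => E g)).
  rewrite {1 2}/u eqxx.
  have -> : E (cos \o X k) = phi k.
    have := eXk 0; rewrite cos0 mul1r => <-.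
    by apply: eq_Rintegral => x _; rewrite /= addr0.
  have -> : E (sin \o X k) = 0.
    have := eXk (- (pi / 2)); rewrite cosN cos_pihalf mul0r => <-.
    apply: eq_Rintegral => x _ /=.
    by rewrite cosD cosN sinN cos_pihalf sin_pihalf; ring.
  ring.
move=> us Js Xs; have fs0 : {in [::], forall k, @bounded_measurable R d Omega (fun=> 0) /\
    adapted_to k (fun=> 0)} by [].
have := @gen [::] s (fun _ _ => 0) b us Js fs0 Xs.
under [in X in X = _ -> _]eq_Rintegral do rewrite big_nil mul1r.
by move=> ->; rewrite big_nil mul1r.
Qed.

End Independent.
End Products.

(** * Normal laws *)

Section IntegralOfDerivative.
Context {R : realType}.
Local Notation mu := (@lebesgue_measure R).

(** Integration by parts on the line: over [-(n + 1), n + 1] the integral is F(n + 1) - F(-(n + 1)),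
    and both boundary values are at most K / (n + 1). *)
Lemma integral_derivative_decay (F f : R -> R) (K : R) :
  (forall x : R, is_derive x (1 : R) F (f x)) -> continuous f ->
  mu.-integrable setT (EFin \o f) -> (forall x, `|F x| * `|x| <= K) ->
  Rintegral mu setT f = 0.
Proof.
move=> dF cf intf FK.
pose A n : set R := `[- n.+1%:R, n.+1%:R]%classic.
have mf : measurable_fun setT f by apply: continuous_measurable_fun.
have FTC n : (\int[mu]_(x in A n) (f x)%:E = (F n.+1%:R - F (- n.+1%:R))%:E)%E.
  rewrite EFinB; apply: continuous_FTC2.
  - by rewrite gtrN.
  - exact: continuous_subspaceT.
  - have cF : continuous F.
      move=> x; apply: differentiable_continuous; apply/derivable1_diffP.
      by have [] := dF x.
    split => [x _||]; first by have [] := dF x.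
    + by apply: cvg_at_right_filter; exact: cF.
    + by apply: cvg_at_left_filter; exact: cF.
  - by move=> x _; rewrite derive1E; have [_ ->] := dF x.
have l1 : (\int[mu]_(x in A n) (f x)%:E @[n --> \oo] --> \int[mu]_x (f x)%:E)%E.
  have iaf : mu.-integrable setT (fun x => `|(f x)%:E|%E) by exact: integrable_abse.
  rewrite (_ : (fun n => _) = fun n => (\int[mu]_x ((EFin \o f) \_ (A n)) x)%E).
    have [|||||_ _ h] := @dominated_convergence _ _ _ mu setT measurableT
      (fun n => (EFin \o f) \_ (A n)) (EFin \o f) (fun x => `|(f x)%:E|%E).
    - move=> n; apply/(measurable_restrictT _ _).1; first exact: measurable_itv.
      by apply: measurable_funTS; exact/measurable_EFinP.
    - exact/measurable_EFinP.
    - apply/aeW => x _; apply: cvg_near_cst; near=> n.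
      rewrite patchE mem_set// /A /= in_itv/= -ler_norml.
      apply: (le_trans (y := n%:R)); last by rewrite ler_nat.
      by near: n; exact: nbhs_infty_ger.
    - exact: iaf.
    - apply/aeW => x n _; rewrite patchE; case: ifPn => // _.
      by rewrite abse0.
    - exact: h.
  by apply/funext => n; rewrite integral_mkcond.
have l2 : (\int[mu]_(x in A n) (f x)%:E @[n --> \oo] --> 0%:E)%E.
  rewrite (_ : (fun n => _) = fun n => (F n.+1%:R - F (- n.+1%:R))%:E); last first.
    by apply/funext.
  apply: cvg_EFin; first exact: nearW.
  have FN (e : bool) : F ((-1) ^+ e * n.+1%:R) @[n --> \oo] --> 0.
    apply: norm_cvg0.
    apply: (@squeeze_cvgr _ _ _ _ (fun=> 0) (fun n => K * n.+1%:R^-1)).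
    - apply: nearW => n; rewrite normr_ge0/= ler_pdivlMr ?ltr0n//.
      have := FK ((-1) ^+ e * n.+1%:R).
      by rewrite normrM normr_sign mul1r ger0_norm.
    - exact: cvg_cst.
    - rewrite -[X in _ --> X](mulr0 K); apply: cvgMr; exact: cvg_harmonic.
  rewrite -[X in _ --> X](subr0 0); apply: cvgB.
    by have := FN false; under eq_fun do rewrite expr0 mul1r.
  by have := FN true; under eq_fun do rewrite expr1 mulN1r.
rewrite /Rintegral; have -> : (\int[mu]_x (f x)%:E = 0)%E by exact: cvg_unique l1 l2.
by [].
Unshelve. all: by end_near. Qed.

End IntegralOfDerivative.

(** * Cosine transform of the normal density *)

Section NormalFourier.
Context {R : realType} (s : R).
Hypothesis s0 : s != 0.
Local Notation mu := (@lebesgue_measure R).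
Local Notation p := (normal_pdf 0 s).

Let ss : 0 < s ^+ 2. Proof. by rewrite exprn_even_gt0. Qed.

Lemma normal_pdf0E x : p x = normal_peak s * expR (- x ^+ 2 / (s ^+ 2 *+ 2)).
Proof. by rewrite normal_pdfE// /normal_fun subr0. Qed.

Lemma is_derive_normal_pdf x : is_derive (x : R) (1 : R) p (- (x / s ^+ 2) * p x).
Proof.
rewrite (_ : p = fun x => normal_peak s * expR (- x ^+ 2 / (s ^+ 2 *+ 2))); last first.
  by apply/funext => y; exact: normal_pdf0E.
apply: trigger_derive.
rewrite /GRing.scale /= !mulr0 !add0r.
by field.
Qed.

Let q := normal_pdf 0 (Num.sqrt 2 * s).
Let s2 : Num.sqrt 2 * s != 0. Proof. by rewrite mulf_neq0// gt_eqF// sqrtr_gt0. Qed.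
Let K := (1 + 4 * s ^+ 2) * normal_peak s / normal_peak (Num.sqrt 2 * s).

(** The density [q] has twice the variance. With y = x^2 / (4 s^2), [p] is its peak times exp(-2 y)
    and [q] its peak times exp(-y), while 1 + x^2 <= (1 + 4 s^2)(1 + y) <= (1 + 4 s^2) exp y.
    Integrability of all integrands below thus reduces to that of another normal density. *)
Lemma normal_pdf_moment_bound x : (1 + x ^+ 2) * p x <= K * q x.
Proof.
rewrite normal_pdf0E /q normal_pdfE// /normal_fun subr0.
have P0 : 0 < normal_peak s by rewrite normal_peak_gt0.
have Q0 : 0 < normal_peak (Num.sqrt 2 * s) by rewrite normal_peak_gt0.
set w := expR _; set w' := expR _.
rewrite (_ : K * _ = normal_peak s * ((1 + 4 * s ^+ 2) * w')); last first.
  by rewrite /K; field; rewrite gt_eqF.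
rewrite mulrCA ler_pM2l// /w /w'.
rewrite exprMn sqr_sqrtr//.
set y := x ^+ 2 / (4 * s ^+ 2).
have y0 : 0 <= y by rewrite divr_ge0 ?sqr_ge0// mulr_ge0// ltW.
rewrite (_ : - x ^+ 2 / (s ^+ 2 *+ 2) = - y + - y); last first.
  by rewrite /y; field.
rewrite (_ : - x ^+ 2 / (2 * s ^+ 2 *+ 2) = - y); last first.
  by rewrite /y; field.
rewrite expRD mulrA ler_pM2r ?expR_gt0// expRN ler_pdivrMr ?expR_gt0//.
have e1 : 1 + y <= expR y by exact: expR_ge1Dx.
have xy : x ^+ 2 = 4 * s ^+ 2 * y by rewrite /y mulrC divfK// gt_eqF// mulr_gt0.
apply: (@le_trans _ _ ((1 + 4 * s ^+ 2) * (1 + y))).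
  by rewrite xy; have := ltW ss; nra.
by rewrite ler_pM2l// addr_gt0// mulr_gt0.
Qed.

Let p0 x : 0 <= p x. Proof. exact: normal_pdf_ge0. Qed.

Let integrable_bound (f : R -> R) C : measurable_fun setT f ->
  (forall x, `|f x| <= C * ((1 + x ^+ 2) * p x)) -> mu.-integrable setT (EFin \o f).
Proof.
move=> mf fC; have C0 : 0 <= C.
  have := fC 0; rewrite expr0n addr0 mul1r => h.
  have := le_trans (normr_ge0 _) h.
  rewrite pmulr_lge0// normal_pdf0E mulr_gt0 ?expR_gt0// normal_peak_gt0//.
apply: (@le_integrable _ _ _ mu setT measurableT _ (EFin \o (fun x => C * K * q x))).
- exact/measurable_EFinP.
- move=> x _ /=; rewrite lee_fin (le_trans (fC x))//.
  rewrite (le_trans _ (ler_norm _))// -mulrA.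
  by apply: ler_wpM2l => //; exact: normal_pdf_moment_bound.
- have := integrableZl measurableT (C * K) (integrable_normal_pdf 0 (Num.sqrt 2 * s)).
  by apply: eq_integrable => // x _.
Qed.

Let cp : continuous p. Proof. exact: continuous_normal_pdf. Qed.

Let caff (a b : R) : continuous (fun x : R => a * x + b).
Proof.
by move=> x; apply: cvgD; [apply: cvgM; [exact: cvg_cst|exact: cvg_id]|exact: cvg_cst].
Qed.

Let ccos (a b : R) : continuous (fun x : R => cos (a * x + b)).
Proof. by move=> x; apply: (continuous_comp (@caff a b x)); exact: continuous_cos. Qed.

Let csin (a b : R) : continuous (fun x : R => sin (a * x + b)).
Proof. by move=> x; apply: (continuous_comp (@caff a b x)); exact: continuous_sin. Qed.

Let cos1 (x : R) : `|cos x| <= 1. Proof. by rewrite ler_norml cos_geN1 cos_le1. Qed.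
Let sin1 (x : R) : `|sin x| <= 1. Proof. by rewrite ler_norml sin_geN1 sin_le1. Qed.

Let absx (x : R) : `|x| <= 1 + x ^+ 2.
Proof.
rewrite -[x ^+ 2]real_normK ?num_real//; set u := `|x|.
by have := sqr_ge0 (u - 1); have := sqr_ge0 u; nra.
Qed.

Section AtPhase.
Variable b : R.

Let I (t : R) := Rintegral mu setT (fun y => cos (t * y + b) * p y).

Let int_cos t : mu.-integrable setT (EFin \o (fun y => cos (t * y + b) * p y)).
Proof.
apply: (@integrable_bound _ 1).
  by apply: continuous_measurable_fun => x; apply: cvgM; [exact: ccos|exact: cp].
move=> x; rewrite normrM (ger0_norm (p0 x)) mul1r ler_wpM2r//.
by rewrite (le_trans (cos1 _))// lerDl sqr_ge0.
Qed.

Let int_xsin t : mu.-integrable setT (EFin \o (fun y => y * sin (t * y + b) * p y)).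
Proof.
apply: (@integrable_bound _ 1).
  apply: continuous_measurable_fun => x; apply: cvgM; last exact: cp.
  by apply: cvgM; [exact: cvg_id|exact: csin].
move=> x; rewrite normrM (ger0_norm (p0 x)) mul1r ler_wpM2r// normrM.
by rewrite (le_trans _ (absx x))// ler_piMr.
Qed.

(** Stein's identity: since p' = -(y / s^2) p, the difference of the two integrands is the
    derivative of -s^2 sin(t y + b) p(y), which decays at infinity. *)
Let stein t : Rintegral mu setT (fun y => y * sin (t * y + b) * p y) =
  s ^+ 2 * t * I t.
Proof.
have := @integral_derivative_decay R (fun y => - s ^+ 2 * (sin (t * y + b) * p y))
  (fun y => y * sin (t * y + b) * p y - s ^+ 2 * t * (cos (t * y + b) * p y))
  (s ^+ 2 * (K * normal_peak (Num.sqrt 2 * s))).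
rewrite RintegralB//; last first.
  by have := integrableZl measurableT (s ^+ 2 * t) (int_cos t).
rewrite RintegralZl// => h; apply/eqP; rewrite -subr_eq0; apply/eqP; apply: h.
- move=> x; have dp := is_derive_normal_pdf x.
  apply: trigger_derive; rewrite /GRing.scale /=.
  by field.
- move=> x; apply: cvgB; last first.
    by apply: cvgM; [exact: cvg_cst|apply: cvgM; [exact: ccos|exact: cp]].
  apply: cvgM; last exact: cp.
  by apply: cvgM; [exact: cvg_id|exact: csin].
- have := integrableB measurableT (int_xsin t)
    (integrableZl measurableT (s ^+ 2 * t) (int_cos t)).
  by apply: eq_integrable => // x _.
- move=> x; rewrite normrM normrN (ger0_norm (ltW ss)) -mulrA ler_pM2l//.
  rewrite normrM (ger0_norm (p0 x)).
  apply: (@le_trans _ _ ((1 + x ^+ 2) * p x)).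
    by rewrite mulrAC ler_wpM2r// (le_trans _ (absx x))// ler_piMl.
  rewrite (le_trans (normal_pdf_moment_bound x))// ler_wpM2l//.
    by rewrite /K divr_ge0 ?normal_peak_ge0// mulr_ge0 ?normal_peak_ge0// addr_ge0// mulr_ge0// ltW.
  exact: normal_pdf_ub.
Qed.

Let derive_I t : is_derive t (1 : R) I (- (s ^+ 2 * t * I t)).
Proof.
pose f := fun t y : R => cos (t * y + b) * p y.
have df x y : is_derive x (1 : R) (f ^~ y) (- (y * sin (x * y + b) * p y)).
  by rewrite /f; apply: trigger_derive; rewrite /GRing.scale /=; ring.
have d1 x y : partial1of2 f x y = - (y * sin (x * y + b) * p y).
  by rewrite partial1of2E; have [_ ->] := df x y.
have ti : t \in `](t - 1), (t + 1)[ by rewrite in_itv/=; lra.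
have intG : mu.-integrable setT (EFin \o (fun y => `|y| * p y)).
  apply: (@integrable_bound _ 1).
    apply: continuous_measurable_fun => x; apply: cvgM; last exact: cp.
    by apply: cvg_norm; exact: cvg_id.
  by move=> x; rewrite normrM normr_id (ger0_norm (p0 x)) mul1r ler_wpM2r.
have h1 := @derivable_under_integral R _ _ mu f setT measurableT t (t - 1) (t + 1) ti.
have h2 := @differentiation_under_integral R _ _ mu f setT measurableT t (t - 1) (t + 1) ti.
have A1 : forall x : R, `](t - 1)%R, (t + 1)%R[%classic x ->
  mu.-integrable setT (EFin \o f x) by move=> x _; exact: int_cos.
have A2 : forall x y : R, `](t - 1)%R, (t + 1)%R[%classic x -> [set: R] y ->
   derivable (f ^~ y) x 1 by move=> x y _ _; have [] := df x y.
have A3 : forall y, 0 <= `|y| * p y by move=> y; rewrite mulr_ge0.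
have A4 : forall x y : R, `](t - 1)%R, (t + 1)%R[%classic x -> [set: R] y ->
    `|partial1of2 f x y| <= `|y| * p y.
  move=> x y _ _; rewrite d1 normrN normrM (ger0_norm (p0 y)) ler_wpM2r//.
  by rewrite normrM ler_piMr.
apply: DeriveDef; first exact: (h1 A1 A2 _ A3 intG A4).
rewrite -derive1E (h2 A1 A2 _ A3 intG A4).
under eq_Rintegral do rewrite d1 -mulN1r.
by rewrite RintegralZl// stein mulN1r.
Qed.

(** The equation I' = -s^2 t I makes I(t) exp(t^2 s^2 / 2) constant, and I(0) = cos b. *)
Lemma normal_pdf_fourier t : Rintegral mu setT (fun y => cos (t * y + b) * p y) =
  cos b * expR (- (t ^+ 2 * s ^+ 2 / 2)).
Proof.
have : I t * expR (t ^+ 2 * s ^+ 2 / 2) = I 0 * expR (0 ^+ 2 * s ^+ 2 / 2).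
  apply: (@is_derive_0_is_cst _ (fun t => I t * expR (t ^+ 2 * s ^+ 2 / 2))) => x.
  have dI := derive_I x.
  by apply: trigger_derive; rewrite /GRing.scale /=; field.
have -> : I 0 = cos b.
  rewrite /I; under eq_Rintegral do rewrite mul0r add0r.
  by rewrite RintegralZl ?(integrable_normal_pdf 0 s)// /Rintegral integral_normal_pdf mulr1.
rewrite expr0n !mul0r expR0 mulr1 => <-.
by rewrite expRN mulfK// gt_eqF// expR_gt0.
Qed.

End AtPhase.

Lemma normal_prob_fourier t b :
  Rintegral (normal_prob 0 s) setT (fun y => cos (t * y + b)) =
  cos b * expR (- (t ^+ 2 * s ^+ 2 / 2)).
Proof.
rewrite -normal_pdf_fourier; congr fine.
have dom := @normal_prob_dominates R 0 s.
have bc : bounded_measurable (fun y : R => cos (t * y + b)).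
  by apply: bounded_measurable_cos; apply: continuous_measurable_fun; exact: caff.
rewrite -(Radon_Nikodym_change_of_variables dom)//; last first.
  exact: bounded_measurable_integrable.
under [RHS]eq_integral do rewrite EFinM.
apply: ae_eq_integral => //.
- apply: emeasurable_funM; first by apply/measurable_EFinP; have [] := bc.
  by apply: (measurable_int mu); exact: Radon_Nikodym_integrable.
- apply: emeasurable_funM; first by apply/measurable_EFinP; have [] := bc.
  by apply/measurable_EFinP; exact: measurable_normal_pdf.
- apply: ae_eqe_mul2l.
  apply: integral_ae_eq => //=.
  + exact: Radon_Nikodym_integrable.
  + by apply/measurable_EFinP; exact: measurable_normal_pdf.
  + by move=> E _ mE; rewrite -Radon_Nikodym_integral.
Qed.

End NormalFourier.

(** * Uniqueness of laws, and second moments, from cosine transforms *)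

Section LawOfFourier.
Context {R : realType} {I Z : Type} (c : I -> Z -> R).
Context d1 (T1 : measurableType d1) (P1 : probability T1 R) (u1 : T1 -> Z)
        d2 (T2 : measurableType d2) (P2 : probability T2 R) (u2 : T2 -> Z).
Let X i t := c i (u1 t).
Let Y i t := c i (u2 t).
Hypothesis mX : forall i, measurable_fun setT (X i).
Hypothesis mY : forall i, measurable_fun setT (Y i).
Hypothesis XY : forall l b,
  Rintegral P1 setT (fun x => cos (lincomb X l x + b)) =
  Rintegral P2 setT (fun x => cos (lincomb Y l x + b)).

Lemma same_law_of_fourier C : coordinate_algebra c C ->
  P1 (u1 @^-1` C) = P2 (u2 @^-1` C).
Proof.
move=> cC.
have sf : same_fourier P1 X P2 Y (fun=> 1) (fun=> 1).
  move=> l b; under eq_Rintegral do rewrite mulr1.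
  by under [RHS]eq_Rintegral do rewrite mulr1.
have [m1 m2] := same_fourier_algebra mX mY (bounded_measurable_cst 1)
  (bounded_measurable_cst 1) sf cC.
under eq_Rintegral do rewrite mulr1.
under [in X in _ = X -> _]eq_Rintegral do rewrite mulr1.
rewrite !Exp_indic// => h.
rewrite -[LHS]fineK ?fin_num_measure// -[RHS]fineK ?fin_num_measure//.
by rewrite h.
Qed.

End LawOfFourier.

Section NormalLaw.
Context {R : realType} d {Omega : measurableType d} (P : probability Omega R).
Local Notation E f := (Rintegral P setT f).
Variables (X : Omega -> R) (v : R).
Hypotheses (mX : measurable_fun setT X) (v0 : 0 <= v).

Let lincomb_unit (T : Type) (Y : T -> R) (l : seq (unit * R)) x :
  lincomb (fun _ : unit => Y) l x = (\sum_(p <- l) p.2) * Y x.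
Proof. by rewrite /lincomb mulr_suml. Qed.

Let coordinate_id : measurable `<=` coordinate_algebra (fun (_ : unit) (x : R) => x).
Proof.
by move=> A mA; apply: sub_gen_smallest; exists tt => //; exists A => //; rewrite setTI.
Qed.

Let mcos t b : measurable_fun setT (fun y : R => cos (t * y + b)).
Proof.
have [] // := @bounded_measurable_cos R _ _ (fun y : R => t * y + b).
by apply: measurable_funD => //; exact: measurable_funM.
Qed.

Let dirac_fourier t b : Rintegral (\d_(0 : measurableTypeR R)) setT (fun y : R => cos (t * y + b)) = cos b.
Proof.
rewrite /Rintegral integral_dirac//; last by apply/measurable_EFinP; exact: mcos.
by rewrite diracT mul1e /= mulr0 add0r.
Qed.

Lemma normal_law_fourier t b :
  (forall A, measurable A -> pushforward P X A = normal_law 0 v A) ->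
  E (fun x => cos (t * X x + b)) = cos b * expR (- (t ^+ 2 * v / 2)).
Proof.
move=> law.
have e (m : {measure set (measurableTypeR R) -> \bar R}) :
    (forall A, measurable A -> pushforward P X A = m A) ->
    E (fun x => cos (t * X x + b)) = Rintegral m setT (fun y => cos (t * y + b)).
  move=> Pm; congr fine; symmetry.
  rewrite -(@integral_pushforward _ _ _ (measurableTypeR R) _ X mX P setT (fun y => (cos (t * y + b))%:E))//.
  - by apply: eq_measure_integral => A mA _; exact/esym/Pm.
  - by apply/measurable_EFinP; exact: mcos.
  - apply: bounded_measurable_integrable; split; last first.
      by exists 1 => x; rewrite ler_norml cos_geN1 cos_le1.
    exact: (measurableT_comp (mcos t b)).
have [v00|vn0] := eqVneq v 0.
  rewrite (e (\d_(0 : measurableTypeR R))) => [|A mA].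
    by rewrite dirac_fourier v00 mulr0 mul0r oppr0 expR0 mulr1.
  by rewrite law// /normal_law v00 eqxx.
rewrite (e (normal_prob 0 (Num.sqrt v))) => [|A mA].
  rewrite normal_prob_fourier ?sqr_sqrtr//.
  by rewrite sqrtr_eq0 -ltNge lt_def vn0.
by rewrite law// /normal_law (negbTE vn0).
Qed.

Lemma normal_law_of_fourier :
  (forall t b, E (fun x => cos (t * X x + b)) = cos b * expR (- (t ^+ 2 * v / 2))) ->
  forall A, measurable A -> pushforward P X A = normal_law 0 v A.
Proof.
move=> fX A mA; rewrite /pushforward /normal_law; case: ifPn => [/eqP v00|vn0].
  rewrite (@same_law_of_fourier _ unit _ (fun _ x => x) _ _ P X _ _ (\d_(0 : measurableTypeR R)) id)//.
    move=> l b; under eq_Rintegral do rewrite lincomb_unit.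
    rewrite fX v00 mulr0 mul0r oppr0 expR0 mulr1.
    by under eq_Rintegral do rewrite lincomb_unit; rewrite dirac_fourier.
  exact: coordinate_id.
rewrite (@same_law_of_fourier _ unit _ (fun _ x => x) _ _ P X _ _
  (normal_prob 0 (Num.sqrt v)) id)//.
  move=> l b; under eq_Rintegral do rewrite lincomb_unit.
  rewrite fX; under eq_Rintegral do rewrite lincomb_unit.
  rewrite normal_prob_fourier ?sqr_sqrtr//.
  by rewrite sqrtr_eq0 -ltNge lt_def vn0.
exact: coordinate_id.
Qed.

Let norm_sin_le (y : R) : `|sin y| <= `|y|.
Proof.
have pos (z : R) : (0 : R) < z -> `|sin z| <= `|z|.
  move=> z0; have [|c _] := @MVT R (@sin R) (@cos R) 0 z z0.
    exact/continuous_subspaceT/continuous_sin.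
  rewrite sin0 !subr0 => ->; rewrite normrM ler_piMl//.
  by rewrite ler_norml cos_geN1 cos_le1.
have [y0|y0|->] := ltgtP y 0; last by rewrite sin0.
  by have := pos (- y); rewrite sinN !normrN oppr_gt0; exact.
exact: pos.
Qed.

(* X^2 is the limit of (2 - 2 cos (t X)) / t^2 as t tends to 0. *)
Lemma fourier_second_moment :
  (forall t, E (fun x => cos (t * X x)) = expR (- (t ^+ 2 * v / 2))) ->
  P.-integrable setT (EFin \o (fun x => X x ^+ 2)) /\ E (fun x => X x ^+ 2) = v.
Proof.
move=> fX.
(* For this t the half-angle formula writes (2 - 2 cos(t X)) / t^2 as the square of (n + 1) sin(X /
   (n + 1)), which is nonnegative and at most X^2. *)
pose t n : R := 2 * n.+1%:R^-1.
pose f n x := (sin (n.+1%:R^-1 * X x) / n.+1%:R^-1) ^+ 2.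
have n0 n : (0 : R) < n.+1%:R^-1 by rewrite invr_gt0 ltr0n.
have fE n x : f n x = 2^-1 * n.+1%:R ^+ 2 - 2^-1 * n.+1%:R ^+ 2 * cos (t n * X x).
  rewrite /f invrK; set a := n.+1%:R^-1 * X x.
  have -> : t n * X x = a + a by rewrite /t /a; ring.
  by rewrite exprMn cosD -!expr2 (cos2sin2 a); field.
have bf n : bounded_measurable (f n).
  rewrite (funext (fE n)); apply: bounded_measurableB.
    exact: bounded_measurable_cst.
  apply: bounded_measurableZ; apply: bounded_measurable_cos.
  exact: measurable_funM.
have Ef n : E (f n) = 2^-1 * n.+1%:R ^+ 2 * (1 - expR (- (t n ^+ 2 * v / 2))).
  rewrite (funext (fE n)) ExpB.
  - rewrite Exp_cst ExpZ; first by rewrite fX; ring.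
    by apply: bounded_measurable_cos; exact: measurable_funM.
  - exact: bounded_measurable_cst.
  - by apply: bounded_measurableZ; apply: bounded_measurable_cos; exact: measurable_funM.
have Efv n : E (f n) <= v.
  rewrite Ef; have e1 := expR_ge1Dx (- (t n ^+ 2 * v / 2)).
  apply: (@le_trans _ _ (2^-1 * n.+1%:R ^+ 2 * (t n ^+ 2 * v / 2))).
    by rewrite ler_wpM2l ?mulr_ge0 ?sqr_ge0//; lra.
  by rewrite /t le_eqVlt; apply/orP; left; apply/eqP; field.
have f0 n x : 0 <= f n x by exact: sqr_ge0.
have fle n x : f n x <= X x ^+ 2.
  rewrite /f -[leLHS]real_normK ?num_real// -[leRHS]real_normK ?num_real//.
  rewrite lerXn2r ?nnegrE// normrM normfV (gtr0_norm (n0 n)) ler_pdivrMr//.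
  by rewrite (le_trans (norm_sin_le _))// normrM (gtr0_norm (n0 n)) mulrC.
have cf x : f n x @[n --> \oo] --> X x ^+ 2.
  rewrite /f expr2; under eq_fun do rewrite expr2.
  suff h : sin (n.+1%:R^-1 * X x) / n.+1%:R^-1 @[n --> \oo] --> X x by exact: cvgM.
  have ds : is_derive (0 : R) (1 : R) (fun h => sin (h * X x)) (X x).
    apply: is_derive_eq; rewrite /GRing.scale /= mul0r cos0; ring.
  have [dg eg] := ds.
  have cg : h^-1 *: (sin ((h *: 1 + 0) * X x) - sin (0 * X x)) @[h --> 0^'] --> X x.
    by rewrite -[X in _ --> X]eg; exact: dg.
  have ninv : (forall n, n.+1%:R^-1 != 0 :> R) /\ n.+1%:R^-1 @[n --> \oo] --> (0 : R).
    by split; [move=> n; rewrite gt_eqF|exact: cvg_harmonic].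
  have /cvgr_dnbhsP /(_ _ ninv) := cg.
  apply: cvg_trans; apply: near_eq_cvg; apply: nearW => n /=.
  by rewrite mul0r sin0 subr0 addr0 /GRing.scale /= mulr1 mulrC.
have mX2 : measurable_fun setT (fun x => X x ^+ 2) by exact: measurable_funX.
(* Fatou's lemma gives one inequality together with integrability, without which the reverse
   inequality could not be stated for real integrals. *)
have le_int : (\int[P]_x `|(X x ^+ 2)%:E| <= v%:E)%E.
  have := @fatou _ _ _ P setT measurableT (fun n => EFin \o f n)
    (fun n => (measurable_EFinP setT (f n)).2 (bf n).1) (fun n x _ => f0 n x).
  have -> : (\int[P]_x limn_einf (fun n => (EFin \o f n) x) =
            \int[P]_x `|(X x ^+ 2)%:E|)%E.
    apply: eq_integral => x _; rewrite /= ger0_norm ?sqr_ge0//.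
    have h : (f n x)%:E @[n --> \oo] --> (X x ^+ 2)%:E.
      by apply: cvg_EFin; [exact: nearW|exact: cf].
    by rewrite is_cvg_limn_einfE; [exact/cvg_lim|apply/cvg_ex; exists (X x ^+ 2)%:E].
  move=> /le_trans; apply.
  rewrite limn_einf_lim; apply: lime_le; first exact: is_cvg_einfs.
  apply: nearW => n; apply: (@le_trans _ _ (\int[P]_x (f n x)%:E)%E).
    by apply: ereal_inf_lbound; exists n => //=.
  rewrite -[leLHS]fineK ?lee_fin; first exact: Efv.
  by apply: integrable_fin_num => //; exact: bounded_measurable_integrable.
have intX : P.-integrable setT (EFin \o (fun x => X x ^+ 2)).
  apply/integrableP; split; first exact/measurable_EFinP.
  by rewrite (le_lt_trans le_int)// ltry.
split => //; apply/eqP; rewrite eq_le; apply/andP; split.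
  rewrite -lee_fin /Rintegral fineK; last exact: integrable_fin_num.
  have -> : (\int[P]_x (X x ^+ 2)%:E =
             \int[P]_x `|(X x ^+ 2)%:E|)%E.
    by apply: eq_integral => x _; rewrite /= ger0_norm ?sqr_ge0.
  exact: le_int.
have Efle n : E (f n) <= E (fun x => X x ^+ 2).
  apply: le_Rintegral; [exact: measurableT| |exact: intX|].
    exact: bounded_measurable_integrable (bf n).
  by move=> x _; exact: fle.
set M := E (fun x => X x ^+ 2) in Efle *.
rewrite leNgt; apply/negP => Mv.
(* With N = n + 1 and N^2 y = 2 v, the bound E (f n) <= M reads N^2 (1 - exp(-y)) / 2 <= M. As
   exp(-y) <= 1 / (1 + y), this gives v <= M (1 + y), hence (v - M) N^2 <= 2 v M, which fails for
   large N when M < v. *)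
have key n : (v - M) * n.+1%:R <= 2 * v * M.
  set N : R := n.+1%:R; have N1 : 1 <= N by rewrite ler1n.
  have N2 : 0 < N ^+ 2 by rewrite exprn_gt0// (lt_le_trans _ N1).
  have := Efle n; rewrite Ef -/N.
  set y := t n ^+ 2 * v / 2.
  have yE : N ^+ 2 * y = 2 * v by rewrite /y /t -/N; field; rewrite gt_eqF ?(lt_le_trans _ N1).
  have y0 : 0 <= y by rewrite /y mulr_ge0// mulr_ge0// sqr_ge0.
  have e1 : 1 + y <= expR y by exact: expR_ge1Dx.
  have e2 : (1 + y) * expR (- y) <= 1.
    by rewrite expRN ler_pdivrMr ?expR_gt0// mul1r.
  set z := expR (- y) in e2 *; move=> h.
  have h2 : v <= M * (1 + y).
    have : 2^-1 * N ^+ 2 * (1 - z) * (1 + y) <= M * (1 + y) by rewrite ler_wpM2r// addr_ge0.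
    apply: le_trans.
    have -> : v = 2^-1 * N ^+ 2 * y by rewrite -mulrA yE mulKf.
    rewrite -[leRHS]mulrA ler_pM2l; last by rewrite mulr_gt0.
    by rewrite mulrBl mul1r [z * _]mulrC; lra.
  have h3 : (v - M) * N ^+ 2 <= 2 * v * M.
    rewrite -yE; have : v * N ^+ 2 <= M * (1 + y) * N ^+ 2 by rewrite ler_pM2r.
    by rewrite (_ : M * (1 + y) * N ^+ 2 = M * N ^+ 2 + N ^+ 2 * y * M); [lra|ring].
  by apply: le_trans h3; rewrite ler_pM2l ?subr_gt0// expr2 ler_pMl.
have := key (Num.truncn (2 * v * M / (v - M))).
rewrite leNgt => /negP; apply.
by rewrite [ltRHS]mulrC -ltr_pdivrMr ?subr_gt0// truncnS_gt.
Qed.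

End NormalLaw.

(** * Gaussian increments of Wiener processes *)

Section Wiener.
Context {R : realType} d {Omega : measurableType d} (P : probability Omega R).
Local Notation E f := (Rintegral P setT f).
Local Notation L0 := {mfun_ P, Omega >-> R}.

Lemma measurable_L0 (X : L0) : measurable_fun setT (X : Omega -> R).
Proof. exact: measurable_funPT. Qed.

Lemma ae_eq_Exp (f g : Omega -> R) : measurable_fun setT f -> measurable_fun setT g ->
  f = g %[ae P] -> E f = E g.
Proof.
move=> mf mg fg; congr fine; apply: ae_eq_integral => //.
- exact/measurable_EFinP.
- exact/measurable_EFinP.
- by apply: filterS fg => x h /h /= ->.
Qed.

Lemma ae_eq_Exp_cos (f g : Omega -> R) b : measurable_fun setT f ->
  measurable_fun setT g -> f = g %[ae P] ->
  E (fun x => cos (f x + b)) = E (fun x => cos (g x + b)).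
Proof.
move=> mf mg fg; apply: ae_eq_Exp.
- by have [] := bounded_measurable_cos (measurable_funD mf (measurable_cst b)).
- by have [] := bounded_measurable_cos (measurable_funD mg (measurable_cst b)).
- by apply: filterS fg => x h /h ->.
Qed.

Lemma measurable_tuple_coordinate n : @measurable _ (n.-tuple R) `<=`
  coordinate_algebra (fun (i : 'I_n) (x : n.-tuple R) => tnth x i).
Proof.
rewrite (_ : measurable =
  g_sigma_preimage (fun (i : 'I_n) (x : n.-tuple R) => tnth x i))//.
rewrite /g_sigma_preimage -bigcup_seq.
apply: sub_smallest2r; first exact: smallest_sigma_algebra.
by move=> A [i _ [B mB <-]]; exists i => //; exists B.
Qed.

Lemma coordinate_algebra_comp (I Z Z' : Type) (c : I -> Z -> R) (u : Z' -> Z) C :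
  coordinate_algebra c C -> coordinate_algebra (fun i z => c i (u z)) (u @^-1` C).
Proof.
have [s0 sC sU] : sigma_algebra [set: Z'] (coordinate_algebra (fun i z => c i (u z))).
  exact: smallest_sigma_algebra.
suff : coordinate_algebra c `<=`
  [set C | coordinate_algebra (fun i z => c i (u z)) (u @^-1` C)] by apply.
apply: smallest_sub.
  split => [|B sB|G sG]; first by rewrite /= preimage_set0.
    by rewrite /= setTD preimage_setC -setTD; exact: sC.
  by rewrite /= preimage_bigcup; exact: sU.
move=> _ [i _ [B mB <-]]; apply: sub_gen_smallest; exists i => //.
by exists B.
Qed.

Lemma measurable_increment n (B : R -> 'I_n -> L0) s t :
  measurable_fun setT (increment B s t).
Proof.
apply/measurable_fun_tnthP => i.
rewrite (_ : _ \o _ = (fun w => B t i w - B s i w)).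
  by apply: measurable_funB; exact: measurable_L0.
by apply/funext => w; rewrite /= tnth_mktuple.
Qed.

Lemma wiener_fourier F n (C : 'M[R]_n) (B : R -> 'I_n -> L0) m (t : nat -> R)
    (a : 'I_m -> 'rV[R]_n) (s : seq 'I_m) b :
  wiener_with_covariance F C B -> (forall k, 0 <= (a k *m C *m (a k)^T) 0 0) ->
  0 <= t 0%N -> (forall k, t k <= t k.+1) -> uniq s ->
  E (fun x => cos (\sum_(k <- s) \sum_i a k 0 i * (B (t k.+1) i x - B (t k) i x) + b)) =
  cos b * \prod_(k <- s)
    expR (- ((t k.+1 - t k) * (a k *m C *m (a k)^T) 0 0 / 2)).
Proof.
move=> wB a0 t0 tS us.
have tk0 k : 0 <= t k by elim: k => // k IH; exact: le_trans (tS k).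
have tkS k : 0 <= t k.+1 - t k by rewrite subr_ge0.
have incE k x : \sum_i a k 0 i * (B (t k.+1) i x - B (t k) i x) =
    \sum_i a k 0 i * tnth (increment B (t k) (t k.+1) x) i.
  by apply: eq_bigr => i _; rewrite tnth_mktuple.
have mlin k : measurable_fun setT (fun y : n.-tuple R => \sum_i a k 0 i * tnth y i).
  by apply: measurable_sum => i; apply: measurable_funM => //; exact: measurable_tnth.
have H := (@Exp_cos_sum _ _ _ P _ setT _ (wiener_independent wB (m := m) t0 tS) s
  (fun k x => \sum_i a k 0 i * (B (t k.+1) i x - B (t k) i x))
  (fun k => expR (- ((t k.+1 - t k) * (a k *m C *m (a k)^T) 0 0 / 2))) b us).
apply: H => //.
move=> k _; rewrite (funext (incE k)); split.
- exact: (measurableT_comp (mlin k) (measurable_increment _ _ _)).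
- move=> A mA; exists ((fun y : n.-tuple R => \sum_i a k 0 i * tnth y i) @^-1` A).
    by rewrite -[X in measurable X]setTI; exact: mlin.
  by rewrite setTI.
- move=> c; pose v := (t k.+1 - t k) * (a k *m C *m (a k)^T) 0 0.
  have mX := measurableT_comp (mlin k) (measurable_increment B (t k) (t k.+1)).
  have v0 : 0 <= v by rewrite mulr_ge0.
  have := @normal_law_fourier _ _ _ P _ _ mX v0 1 c.
  rewrite expr1n mul1r => <-.
    by apply: eq_Rintegral => x _; rewrite mul1r /= -incE.
  move=> A mA; have := wiener_normal wB (tk0 k) (tk0 k.+1) (a k) mA.
  by rewrite trmx0 mulmx0 mxE ger0_norm// -scalemxAr -scalemxAl mxE.
Qed.

End Wiener.

(** * Cylindrical processes and their increments *)

Section Cylindrical.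
Context {R : realType} d {Omega : measurableType d} (P : probability Omega R).
Local Notation E f := (Rintegral P setT f).
Local Notation L0 := {mfun_ P, Omega >-> R}.

Lemma wiener_second_moment F n (C : 'M[R]_n) (B : R -> 'I_n -> L0) (a : 'rV[R]_n) :
  wiener_with_covariance F C B -> 0 <= (a *m C *m a^T) 0 0 ->
  (\int[P]_x ((\sum_i a 0 i * B 1 i x) ^+ 2)%:E = ((a *m C *m a^T) 0 0)%:E)%E.
Proof.
move=> wB a0.
pose X x := \sum_i a 0 i * (B 1 i x - B 0 i x).
have mX : measurable_fun setT X.
  apply: measurable_sum => i; apply: measurable_funM => //.
  by apply: measurable_funB; exact: measurable_L0.
(* The grid 0, 1, 1, ...; only the increment from 0 to 1 is tested. *)
pose t (k : nat) : R := (0 < k)%N%:R.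
have tS k : t k <= t k.+1 by rewrite ler_nat; case: k.
have fX r : E (fun x => cos (r * X x)) = expR (- (r ^+ 2 * (a *m C *m a^T) 0 0 / 2)).
  have := @wiener_fourier _ _ _ P F n C B 1 t (fun=> r *: a) [:: ord0] 0 wB.
  rewrite cos0 mul1r big_seq1 /t subr0 mul1r.
  have -> : (r *: a *m C *m (r *: a)^T) 0 0 = r ^+ 2 * (a *m C *m a^T) 0 0.
    by rewrite linearZ/= -!scalemxAl -scalemxAr !mxE mulrA.
  move=> <-//; first last.
    by move=> _; rewrite mulr_ge0 ?sqr_ge0.
  apply: eq_Rintegral => x _; rewrite big_seq1 addr0 /X mulr_sumr; congr cos.
  by apply: eq_bigr => i _; rewrite !mxE mulrA.
have [iX eX] := fourier_second_moment mX a0 fX.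
rewrite -eX /Rintegral fineK; last exact: integrable_fin_num.
have ms (f : Omega -> R) : measurable_fun setT f -> measurable_fun setT (EFin \o (fun x => f x ^+ 2)).
  by move=> mf; apply/measurable_EFinP; exact: measurable_funX.
apply: ae_eq_integral => //.
- apply: ms; apply: measurable_sum => i; exact: measurable_funM.
- exact: ms.
have B0 : \forall x \ae P, forall i, B 0 i x = 0.
  apply: filter_forall => i; have := wiener_start wB i.
  by apply: filterS => x; apply.
apply: filterS B0 => x B0 _; congr (_ ^+ 2)%:E.
by apply: eq_bigr => i _; rewrite B0 subr0.
Qed.

Context {U : completeNormedModType R} (F : R -> set (set Omega))
        (W : R -> dual U -> L0).

(* The common content of both sides of the equivalence: W has independent
   centred Gaussian increments with variance rate q. *)
Definition gaussian_increments (q : dual U -> R) := forall m (t : nat -> R)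
    (v : 'I_m -> dual U) (s : seq 'I_m) b,
  0 <= t 0%N -> (forall k, t k <= t k.+1) -> uniq s ->
  E (fun x => cos (\sum_(k <- s) (W (t k.+1) (v k) x - W (t k) (v k) x) + b)) =
  cos b * \prod_(k <- s) expR (- ((t k.+1 - t k) * q (v k) / 2)).

(** The covariance matrix of a Wiener process is only asserted to exist. The second moment at time 1
    along the [i]-th unit vector identifies its diagonal. *)
Lemma weakly_cylindrical_variance (q : dual U -> R) : weakly_cylindrical_wiener F W ->
  (forall u, covariance_operator (W 1) u u = (q u)%:E) ->
  forall n (u : 'I_n -> dual U) C, wiener_with_covariance F C (fun t i => W t (u i)) ->
  (forall a : 'rV[R]_n, 0 <= (a *m C *m a^T) 0 0) -> forall i, C i i = q (u i).
Proof.
move=> wW qW n u C wC C0 i; apply: EFin_inj; rewrite -qW.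
have := wiener_second_moment wC (C0 (delta_mx 0 i)).
rewrite -rowE trmx_delta -colE !mxE => <-.
rewrite /covariance_operator expectation.unlock; apply: eq_integral => x _.
rewrite -expr2; congr (_ ^+ 2)%:E.
rewrite (bigD1 i)//= mxE !eqxx mul1r big1 ?addr0// => j ji.
by rewrite mxE eqxx (negbTE ji) mul0r.
Qed.

(** All functionals [v k] are put into one m-dimensional Wiener process, and the [k]-th increment is
    tested with the [k]-th unit vector; so only diagonal covariances occur, although the functional
    varies with the increment. *)
Lemma weakly_gaussian_increments (q : dual U -> R) : weakly_cylindrical_wiener F W ->
  (forall u, covariance_operator (W 1) u u = (q u)%:E) -> gaussian_increments q.
Proof.
move=> wW qW m t v s b t0 tS us.
have [_ _ /(_ m v)[C [_ C0 wC]]] := wW.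
have dE (M : 'M[R]_m) (i : 'I_m) :
    (delta_mx 0 i *m M *m (delta_mx 0 i)^T) (0 : 'I_1) (0 : 'I_1) = M i i.
  by rewrite -rowE trmx_delta -colE !mxE.
have := @wiener_fourier _ _ _ P F m C _ m t (fun k => delta_mx 0 k) s b wC
  (fun k => C0 _) t0 tS us.
under [in X in _ = _ * X -> _]eq_bigr do rewrite dE
  (weakly_cylindrical_variance wW qW wC C0).
move=> <-; apply: eq_Rintegral => x _; congr (cos (_ + _)).
apply: eq_bigr => k _; rewrite (bigD1 k)//= mxE !eqxx mul1r big1 ?addr0// => j jk.
by rewrite mxE eqxx (negbTE jk) mul0r.
Qed.

Hypothesis cylW : cylindrical_process W.

Lemma cylindrical0 t : 0 <= t -> W t 0 = cst 0 %[ae P].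
Proof.
move=> t0; have := cylW t0 1 0 0; rewrite scale1r addr0.
apply: filterS => x /(_ Logic.I); rewrite mul1r => h _ /=; lra.
Qed.

Lemma cylindrical_sum (I : Type) (s : seq I) (a : I -> R) (u : I -> dual U) t : 0 <= t ->
  W t (\sum_(i <- s) a i *: u i) = (fun x => \sum_(i <- s) a i * W t (u i) x) %[ae P].
Proof.
move=> t0; elim: s => [|i s IH].
  rewrite big_nil; have := cylindrical0 t0.
  by apply: filterS => x h /h ->; rewrite big_nil.
rewrite big_cons; have := cylW t0 (a i) (u i) (\sum_(j <- s) a j *: u j).
by move: IH; apply: filterS2 => x h1 h2 _; rewrite h2// h1// big_cons.
Qed.

Lemma cylindrical_incr_sum (I : Type) (l : seq I) (a : I -> R) (u : I -> dual U) s t :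
  0 <= s -> 0 <= t -> \forall x \ae P,
  \sum_(i <- l) a i * (W t (u i) x - W s (u i) x) =
  W t (\sum_(i <- l) a i *: u i) x - W s (\sum_(i <- l) a i *: u i) x.
Proof.
move=> s0 t0; move: (cylindrical_sum l a u s0) (cylindrical_sum l a u t0).
apply: filterS2 => x /(_ Logic.I) -> /(_ Logic.I) ->.
by rewrite -sumrB; apply: eq_bigr => i _; rewrite mulrBr.
Qed.

Section OfIncrements.
Variable q : dual U -> R.
Hypothesis qW : gaussian_increments q.

Lemma one_increment s t u b : 0 <= s -> 0 <= t ->
  E (fun x => cos ((W t u x - W s u x) + b)) = cos b * expR (- (`|t - s| * q u / 2)).
Proof.
have key s' t' c : 0 <= s' -> s' <= t' -> E (fun x => cos ((W t' u x - W s' u x) + c)) =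
    cos c * expR (- ((t' - s') * q u / 2)).
  move=> s0 st; have := @qW 1 (fun k => if (k == 0)%N then s' else t') (fun=> u)
    [:: ord0] c s0.
  rewrite big_seq1 /= => <-//; last by case.
  by apply: eq_Rintegral => x _; rewrite big_seq1.
move=> s0 t0; have [st|ts] := leP s t; first by rewrite ger0_norm ?subr_ge0// key.
rewrite ltr0_norm ?subr_lt0// opprB; have := key t s (- b) t0 (ltW ts).
rewrite cosN => <-.
by apply: eq_Rintegral => x _; rewrite -cosN; congr cos; ring.
Qed.

Hypotheses (adW : adapted F W) (W0 : forall u, W 0 u = cst 0 %[ae P]).

(** By linearity of [W], a combination of coordinates of an increment is almost surely the increment
    of a single functional. Independence, stationarity and normality are then all read off from
    [gaussian_increments]. *)
Lemma gaussian_increments_weakly n (u : 'I_n -> dual U) (C : 'M[R]_n) :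
  (forall a : 'rV[R]_n, q (\sum_i a 0 i *: u i) = (a *m C *m a^T) 0 0) ->
  (forall v, 0 <= q v) ->
  wiener_with_covariance F C (fun t i => W t (u i)).
Proof.
move=> qC q0.
have mI s t i : measurable_fun setT (fun x => W t (u i) x - W s (u i) x).
  by apply: measurable_funB; exact: measurable_L0.
pose X s t (i : 'I_n) x := W t (u i) x - W s (u i) x.
have FX s t l b : 0 <= s -> 0 <= t -> E (fun x => cos (lincomb (X s t) l x + b)) =
    cos b * expR (- (`|t - s| * q (\sum_(p <- l) p.2 *: u p.1) / 2)).
  move=> s0 t0; rewrite -one_increment//; apply: ae_eq_Exp_cos.
  - by apply: measurable_lincomb => i; exact: mI.
  - by apply: measurable_funB; exact: measurable_L0.
  - have := cylindrical_incr_sum l (fun p => p.2) (fun p => u p.1) s0 t0.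
    by apply: filterS => x h _; exact: h.
have XE s t i x : tnth (increment (fun t i => W t (u i)) s t x) i = X s t i x.
  by rewrite tnth_mktuple.
have coordE s t : (fun i x => tnth (increment (fun t i => W t (u i)) s t x) i) = X s t.
  by apply/funext => i; apply/funext => x; exact: XE.
split.
- by move=> t i t0; exact: adW.
- by move=> i; exact: W0.
- move=> m t t0 tS.
  have tk0 k : 0 <= t k by elim: k => // k IH; exact: le_trans (tS k).
  have ind : independent_systems P setT
      (fun k : 'I_m => coordinate_algebra (X (t k) (t k.+1))).
    apply: independent_of_fourier; first by move=> k i; exact: mI.
    move=> s us _ a b.
    pose v k := \sum_(p <- a k) p.2 *: u p.1.
    transitivity (E (fun x => cos (\sum_(k <- s)
        (W (t k.+1) (v k) x - W (t k) (v k) x) + b))).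
      apply: ae_eq_Exp_cos.
      + by apply: measurable_sum => k; apply: measurable_lincomb => i; exact: mI.
      + by apply: measurable_sum => k; apply: measurable_funB; exact: measurable_L0.
      + have : \forall x \ae P, forall k : 'I_m, lincomb (X (t k) (t k.+1)) (a k) x =
            W (t k.+1) (v k) x - W (t k) (v k) x.
          by apply: filter_forall => k; exact: cylindrical_incr_sum.
        by apply: filterS => x h _; apply: eq_bigr => k _; rewrite h.
    rewrite qW//; congr (_ * _); apply: eq_bigr => k _.
    have := FX (t k) (t k.+1) (a k) 0 (tk0 _) (tk0 _).
    rewrite cos0 mul1r ger0_norm ?subr_ge0// -/(v k) => <-.
    by apply: eq_Rintegral => x _; rewrite addr0.
  move=> s us Js A As; apply: ind => // k ks.
  have [D mD <-] := As k ks; rewrite setTI -coordE.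
  exact: (coordinate_algebra_comp (u := increment (fun t i => W t (u i)) (t k) (t k.+1))
    (measurable_tuple_coordinate mD)).
- move=> s t h s0 st h0 A mA; rewrite /pushforward.
  have t0 : 0 <= t by exact: le_trans st.
  apply: (@same_law_of_fourier _ _ _ (fun (i : 'I_n) (x : n.-tuple R) => tnth x i)).
  + move=> i; exact: (eq_ind_r (measurable_fun setT) (mI (s + h) (t + h) i)
      (funext (XE (s + h) (t + h) i))).
  + move=> i; exact: (eq_ind_r (measurable_fun setT) (mI s t i) (funext (XE s t i))).
  + by move=> l b; rewrite !coordE !FX ?addr_ge0// opprD addrACA subrr addr0.
  + exact: measurable_tuple_coordinate.
- move=> s t s0 t0 a A mA; rewrite trmx0 mulmx0 mxE.
  have aE x : \sum_i a 0 i * tnth (increment (fun t i => W t (u i)) s t x) i =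
      lincomb (X s t) [seq (i, a 0 i) | i <- index_enum 'I_n] x.
    by rewrite /lincomb big_map; apply: eq_bigr => i _; rewrite XE.
  rewrite (funext aE) -scalemxAr -scalemxAl mxE.
  apply: normal_law_of_fourier => //.
  + by apply: measurable_lincomb => i; exact: mI.
  + by rewrite mulr_ge0// -qC.
  + move=> r b.
    have rE x : r * lincomb (X s t) [seq (i, a 0 i) | i <- index_enum 'I_n] x =
        lincomb (X s t) [seq (i, r * a 0 i) | i <- index_enum 'I_n] x.
      rewrite /lincomb !big_map mulr_sumr; apply: eq_bigr => i _ /=.
      by rewrite mulrA.
    under eq_Rintegral do rewrite rE.
    rewrite FX// big_map/=.
    have := qC (r *: a); rewrite linearZ/= -!scalemxAl -scalemxAr !mxE.
    under eq_bigr do rewrite mxE.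
    by move=> ->; congr (_ * expR (- _)); ring.
Qed.

End OfIncrements.
End Cylindrical.

(** * Mean-square limits *)

Section MeanSquare.
Context {R : realType} d {Omega : measurableType d} (P : probability Omega R).
Local Notation E f := (Rintegral P setT f).
Implicit Types f g : nat -> Omega -> R.

Lemma ge0_cvge0P (u : nat -> \bar R) : (forall n, (0 <= u n)%E) ->
  (u n @[n --> \oo] --> 0%E) <-> (forall e : R, 0 < e -> \forall n \near \oo, (u n <= e%:E)%E).
Proof.
move=> u0; split=> [/fine_cvgP[uf /cvgr0_norm_le uc] e e0|h].
  near=> n; rewrite -[u n]fineK; last by near: n.
  by rewrite lee_fin (le_trans (ler_norm _))//; near: n; exact: uc.
apply/fine_cvgP; split.
  near=> n; rewrite ge0_fin_numE// (@le_lt_trans _ _ 1%E) ?ltry//.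
  by near: n; exact: h.
apply/cvgr0Pnorm_le => e e0; near=> n.
have un : (u n <= e%:E)%E by near: n; exact: h.
rewrite ger0_norm; last exact: fine_ge0.
by rewrite -lee_fin fineK// ge0_fin_numE// (le_lt_trans un)// ltry.
Unshelve. all: by end_near. Qed.

(** Convergence to 0 in L^2 through squared norms, as extended reals: no square roots, and the
    integrals may be infinite for small n. *)
Definition mean_square_null f :=
  (\int[P]_x (f n x ^+ 2)%:E)%E @[n --> \oo] --> 0%E.

Let int_sqr_ge0 (f : Omega -> R) : (0 <= \int[P]_x (f x ^+ 2)%:E)%E.
Proof. by apply: integral_ge0 => x _; rewrite lee_fin sqr_ge0. Qed.

Lemma mean_square_nullP f : mean_square_null f <-> forall e : R, 0 < e ->
  \forall n \near \oo, (\int[P]_x (f n x ^+ 2)%:E <= e%:E)%E.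
Proof. by apply: ge0_cvge0P. Qed.

Let norm2E (f : Omega -> R) :
  ('N[P]_2%:E [EFin \o f] `^ 2 = \int[P]_x (f x ^+ 2)%:E)%E.
Proof.
rewrite powR_Lnorm//; apply: eq_integral => x _.
by rewrite -[abse _]/(`|f x|%:E)%E poweR_EFin powR_mulrn// real_normK// num_real.
Qed.

Lemma L2_cvgP f (g : Omega -> R) :
  L2_cvg P f g <-> mean_square_null (fun n x => g x - f n x).
Proof.
rewrite mean_square_nullP /L2_cvg ge0_cvge0P; last by move=> n; exact: Lnorm_ge0.
have e2 e : 0 < e -> (e%:E `^ 2)%E = (e ^+ 2)%:E :> \bar R.
  by move=> e0; rewrite poweR_EFin powR_mulrn// ltW.
split=> h e e0.
  have s0 : 0 < Num.sqrt e by rewrite sqrtr_gt0.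
  move: (h _ s0); apply: filterS => n hn.
  rewrite -(norm2E (fun x => g x - f n x)) -[e](sqr_sqrtr (ltW e0)) -e2//.
  apply: gt0_ler_poweR => //; rewrite in_itv/= leey andbT.
    exact: Lnorm_ge0.
  by rewrite lee_fin ltW.
have s0 : 0 < e ^+ 2 by rewrite exprn_gt0.
move: (h _ s0); apply: filterS => n.
rewrite -(norm2E (fun x => g x - f n x)) -e2// => hn.
have half (z : \bar R) : (0 <= z -> (z `^ 2) `^ 2^-1 = z)%E.
  by move=> z0; rewrite -poweRrM divff// poweRe1.
rewrite -[leLHS]half ?Lnorm_ge0// -[leRHS]half; last by rewrite lee_fin ltW.
by apply: gt0_ler_poweR hn; rewrite ?invr_ge0// in_itv/= leey andbT ?lee_fin
  ?powR_ge0 ?poweR_ge0.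
Qed.

Lemma mean_square_nullD f g :
  (forall n, measurable_fun setT (f n)) -> (forall n, measurable_fun setT (g n)) ->
  mean_square_null f -> mean_square_null g ->
  mean_square_null (fun n x => f n x + g n x).
Proof.
move=> mf mg /mean_square_nullP f0 /mean_square_nullP g0.
apply/mean_square_nullP => e e0.
have e4 : 0 < e / 4 by rewrite divr_gt0.
near=> n.
have fe : (\int[P]_x (f n x ^+ 2)%:E <= (e / 4)%:E)%E by near: n; exact: f0.
have ge : (\int[P]_x (g n x ^+ 2)%:E <= (e / 4)%:E)%E by near: n; exact: g0.
have m2 (h : Omega -> R) : measurable_fun setT h ->
    measurable_fun setT (fun x => (h x ^+ 2)%:E).
  by move=> mh; apply/measurable_EFinP; exact: measurable_funX.
apply: (@le_trans _ _ (\int[P]_x (2%:E * ((f n x ^+ 2)%:E + (g n x ^+ 2)%:E)))%E).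
  apply: ge0_le_integral => //.
  - by move=> x _; rewrite lee_fin sqr_ge0.
  - by apply: m2; exact: measurable_funD.
  - apply: emeasurable_funM; first exact: measurable_cst.
    by apply: emeasurable_funD; exact: m2.
  - move=> x _; rewrite -EFinD -EFinM lee_fin.
    by have := sqr_ge0 (f n x - g n x); nra.
rewrite ge0_integralZl//; first last.
- by move=> x _; rewrite adde_ge0// lee_fin sqr_ge0.
- by apply: emeasurable_funD; exact: m2.
rewrite ge0_integralD//; first last.
- exact: m2.
- by move=> x _; rewrite lee_fin sqr_ge0.
- exact: m2.
- by move=> x _; rewrite lee_fin sqr_ge0.
apply: (@le_trans _ _ (2%:E * ((e / 4)%:E + (e / 4)%:E))%E).
  by rewrite lee_pmul2l//; exact: leeD.
by rewrite -EFinD -EFinM lee_fin; lra.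
Unshelve. all: by end_near. Qed.

Lemma mean_square_nullZ f (a : R) : (forall n, measurable_fun setT (f n)) ->
  mean_square_null f -> mean_square_null (fun n x => a * f n x).
Proof.
move=> mf f0; rewrite /mean_square_null.
rewrite (_ : (fun n => _) = fun n => ((a ^+ 2)%:E * \int[P]_x (f n x ^+ 2)%:E)%E).
  by rewrite -[X in _ --> X](mule0 (a ^+ 2)%:E); exact: cvgeZl.
apply/funext => n; rewrite -ge0_integralZl//; first last.
- by rewrite lee_fin sqr_ge0.
- by move=> x _; rewrite lee_fin sqr_ge0.
- by apply/measurable_EFinP; exact: measurable_funX.
by apply: eq_integral => x _; rewrite exprMn EFinM.
Qed.

Lemma mean_square_null_sum (I : Type) (s : seq I) (F : I -> nat -> Omega -> R) :
  (forall i n, measurable_fun setT (F i n)) -> (forall i, mean_square_null (F i)) ->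
  mean_square_null (fun n x => \sum_(i <- s) F i n x).
Proof.
move=> mF F0; elim: s => [|i s IH].
  rewrite /mean_square_null (_ : (fun n => _) = fun=> 0%E); first exact: cvg_cst.
  by apply/funext => n; apply: integral0_eq => x _; rewrite big_nil expr0n.
under [X in mean_square_null X]eq_fun do under eq_fun do rewrite big_cons.
by apply: mean_square_nullD => // n; exact: measurable_sum.
Qed.

(** The cosine is 1-Lipschitz, so mean-square closeness passes to the difference [y] of the cosines,
    which is bounded and therefore integrable. *)
Lemma mean_square_cvg_cos (X : nat -> Omega -> R) (Y : Omega -> R) b :
  (forall n, measurable_fun setT (X n)) -> measurable_fun setT Y ->
  mean_square_null (fun n x => Y x - X n x) ->
  E (fun x => cos (X n x + b)) @[n --> \oo] --> E (fun x => cos (Y x + b)).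
Proof.
move=> mX mY /mean_square_nullP XY; apply/cvgrPdist_le => e e0.
have e2 : 0 < e / 2 by rewrite divr_gt0.
have e4 : 0 < (e / 2) ^+ 2 by rewrite exprn_gt0.
near=> n.
have h : (\int[P]_x ((Y x - X n x) ^+ 2)%:E <= ((e / 2) ^+ 2)%:E)%E.
  by near: n; exact: XY.
pose y x := cos (Y x + b) - cos (X n x + b).
have bc (Z : Omega -> R) : measurable_fun setT Z ->
    bounded_measurable (fun x => cos (Z x + b)).
  by move=> mZ; apply: bounded_measurable_cos; exact: measurable_funD.
have by_ : bounded_measurable y by apply: bounded_measurableB; exact: bc.
have yle x : `|y x| <= `|Y x - X n x|.
  have pos (u v : R) : u < v -> `|cos v - cos u| <= `|v - u|.
    move=> uv; have [|c _ ->] := @MVT R (@cos R) (fun x => - sin x) u v uv.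
      exact/continuous_subspaceT/continuous_cos.
    rewrite normrM normrN ler_piMl//.
    by rewrite ler_norml sin_geN1 sin_le1.
  rewrite /y (_ : Y x - X n x = (Y x + b) - (X n x + b)); last by ring.
  have [uv|uv|->] := ltgtP (Y x + b) (X n x + b); last by rewrite !subrr.
    by rewrite distrC [leRHS]distrC; exact: pos.
  exact: pos.
have Ey2 : E (fun x => y x * y x) <= (e / 2) ^+ 2.
  have by2 := bounded_measurableM by_ by_.
  rewrite -lee_fin (le_trans _ h)// /Rintegral fineK; last first.
    by apply: integrable_fin_num => //; exact: bounded_measurable_integrable by2.
  apply: ge0_le_integral => //.
  - by move=> x _; rewrite lee_fin -expr2 sqr_ge0.
  - by apply/measurable_EFinP; have [] := by2.
  - by apply/measurable_EFinP; apply: measurable_funX; exact: measurable_funB.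
  - move=> x _; rewrite lee_fin -expr2 -[leLHS]real_normK ?num_real//.
    by rewrite -[leRHS]real_normK ?num_real// lerXn2r ?nnegrE.
rewrite -ExpB; [|exact: bc|exact: bc].
rewrite (le_trans (le_normr_Rintegral _ (bounded_measurable_integrable P by_)))//.
(* |y| <= e/2 + y^2/(2(e/2)) *)
have bny : bounded_measurable (fun x => `|y x|).
  have [my [M yM]] := by_; split; first exact: measurableT_comp.
  by exists M => x; rewrite normr_id.
apply: (@le_trans _ _ (E (fun x => e / 2 + (e / 2)^-1 * (y x * y x)))).
  apply: ler_Exp => //.
    apply: bounded_measurableD; first exact: bounded_measurable_cst.
    by apply: bounded_measurableZ; exact: bounded_measurableM.
  move=> x; rewrite -expr2 -[y x ^+ 2]real_normK ?num_real//.
  rewrite -(ler_pM2l e2) [leRHS]mulrDr (mulVKf (lt0r_neq0 e2)).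
  set z := `|y x|; set r := e / 2; rewrite -expr2.
  by have := sqr_ge0 (z - r); have := normr_ge0 (y x); rewrite -/z; nra.
rewrite ExpD; [|exact: bounded_measurable_cst|]; last first.
  by apply: bounded_measurableZ; exact: bounded_measurableM.
rewrite Exp_cst ExpZ; last exact: bounded_measurableM.
rewrite {3}[e]splitr lerD2l -[leRHS](mulKf (x := e / 2)) ?gt_eqF//.
by rewrite ler_pM2l ?invr_gt0// -expr2.
Unshelve. all: by end_near. Qed.

End MeanSquare.

(** * Processes given by a series expansion *)

Section Expansion.
Context {R : realType} d {Omega : measurableType d} (P : probability Omega R).
Local Notation E f := (Rintegral P setT f).
Local Notation L0 := {mfun_ P, Omega >-> R}.
Context {U : completeNormedModType R} (F : R -> set (set Omega))
        (W : R -> dual U -> L0) (J : set nat) (B : nat -> R -> L0)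
        (c : dual U -> nat -> R) (q : dual U -> R).
Hypotheses (wB : forall k, J k -> standard_real_wiener F (B k))
  (iB : independent_processes J B)
  (WB : forall t u, 0 <= t -> L2_cvg P
     (fun n w => \sum_(k < n | (k : nat) \in J) c u k * B k t w) (W t u))
  (cq : forall u, \sum_(k < n | (k : nat) \in J) c u k ^+ 2 @[n --> \oo] --> q u).

Let scalar_form (u : 'rV[R]_1) : (u *m 1%:M *m u^T) 0 0 = u 0 0 ^+ 2.
Proof. by rewrite mulmx1 mxE big_ord1 mxE. Qed.

Lemma process_sigma_algebra_incr_sum (X : R -> L0) (I : Type) (s : seq I)
    (a t0 t1 : I -> R) (A : set R) :
  (forall i, 0 <= t0 i) -> (forall i, 0 <= t1 i) -> measurable A ->
  process_sigma_algebra X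
    ((fun w => \sum_(i <- s) a i * (X (t1 i) w - X (t0 i) w)) @^-1` A).
Proof.
move=> t00 t10 mA.
pose S := \bigcup_(t in [set t : R | 0 <= t])
  preimage_set_system [set: Omega] (X t : Omega -> R) measurable.
have mX t : 0 <= t -> measurable_fun [set: g_sigma_algebraType S] (X t : Omega -> R).
  move=> tpos _ D mD; apply: sub_gen_smallest; exists t => //.
  by exists D.
have : measurable_fun [set: g_sigma_algebraType S]
    (fun w => \sum_(i <- s) a i * (X (t1 i) w - X (t0 i) w)).
  apply: measurable_sum => i; apply: measurable_funM; first exact: measurable_cst.
  by apply: measurable_funB; exact: mX.
by move=> /(_ measurableT _ mA); rewrite setTI.
Qed.

Let measurable_partial n r u :
  measurable_fun setT (fun x => \sum_(l < n | (l : nat) \in J) c u l * B l r x).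
Proof.
rewrite (_ : (fun x => _) = fun x => \sum_(l < n)
    (if (l : nat) \in J then c u l * B l r x else 0)); last first.
  by apply/funext => x; exact: big_mkcond.
apply: measurable_sum => l; case: ((l : nat) \in J); last exact: measurable_cst.
by apply: measurable_funM => //; exact: measurable_L0.
Qed.

Let incr_cos l m (t : nat -> R) (a : 'I_m -> R) (s : seq 'I_m) b :
  J l -> 0 <= t 0%N -> (forall k, t k <= t k.+1) -> uniq s ->
  E (fun x => cos (\sum_(k <- s) a k * (B l (t k.+1) x - B l (t k) x) + b)) =
  cos b * \prod_(k <- s) expR (- ((t k.+1 - t k) * a k ^+ 2 / 2)).
Proof.
move=> Jl t0 tS us.
pose u k : 'rV[R]_1 := const_mx (a k).
have pos k : 0 <= (u k *m 1%:M *m (u k)^T) 0 0 by rewrite scalar_form sqr_ge0.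
have := @wiener_fourier _ _ _ P F 1 1%:M (fun t _ => B l t) m t
  u s b (wB Jl) pos t0 tS us.
under [in X in _ = _ * X -> _]eq_bigr do rewrite scalar_form mxE.
move=> <-; apply: eq_Rintegral => x _; congr (cos (_ + _)).
by apply: eq_bigr => k _; rewrite big_ord1 mxE.
Qed.

(** For a partial sum, exchanging the sums over increments and over [l] leaves variables [Y l], each
    built from one [B l] and hence independent. Their transforms multiply to the desired one with
    the partial sum of squares in place of [q]; both sides then pass to the limit. *)
Lemma expansion_gaussian_increments : gaussian_increments W q.
Proof.
move=> m t v s b t0 tS us.
have tk0 k : 0 <= t k by elim: k => // k IH; exact: le_trans (tS k).
have mB l r : measurable_fun setT (B l r : Omega -> R) by exact: measurable_L0.
pose S n r u x := \sum_(l < n | (l : nat) \in J) c u l * B l r x.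
have mS n r u : measurable_fun setT (S n r u) by exact: measurable_partial.
pose D n x := \sum_(k <- s) (S n (t k.+1) (v k) x - S n (t k) (v k) x).
have mD n : measurable_fun setT (D n).
  by apply: measurable_sum => k; exact: measurable_funB.
have l1 : E (fun x => cos (D n x + b)) @[n --> \oo] -->
    E (fun x => cos (\sum_(k <- s) (W (t k.+1) (v k) x - W (t k) (v k) x) + b)).
  apply: mean_square_cvg_cos => //.
    by apply: measurable_sum => k; apply: measurable_funB; exact: measurable_L0.
  have mdif r u n : measurable_fun setT (fun x => W r u x - S n r u x).
    by apply: measurable_funB => //; exact: measurable_L0.
  have nul r u : 0 <= r -> mean_square_null P (fun n x => W r u x - S n r u x).
    by move=> r0; apply/L2_cvgP; exact: WB.
  rewrite (_ : (fun n x => _) = fun n x => \sum_(k <- s)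
      ((W (t k.+1) (v k) x - S n (t k.+1) (v k) x) +
       (-1) * (W (t k) (v k) x - S n (t k) (v k) x))); last first.
    apply/funext => n; apply/funext => x; rewrite -sumrB; apply: eq_bigr => k _.
    by ring.
  apply: mean_square_null_sum => [k n|k].
    by apply: measurable_funD => //; exact: measurable_funM.
  apply: mean_square_nullD => //; [by move=> n; exact: measurable_funM|exact: nul|].
  by apply: mean_square_nullZ => //; exact: nul.
pose Y l x := \sum_(k <- s) c (v k) l * (B l (t k.+1) x - B l (t k) x).
pose r n := [seq l <- index_iota 0 n | l \in J].
have rE (V : Type) (op : V -> V -> V) e n (G : nat -> V) :
    \big[op/e]_(l < n | (l : nat) \in J) G l = \big[op/e]_(l <- r n) G l.
  by rewrite big_filter big_mkord.
have DE n x : D n x = \sum_(l <- r n) Y l x.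
  rewrite /D /Y exchange_big /=; apply: eq_bigr => k _.
  rewrite /S (rE _ _ _ n (fun l => c (v k) l * B l (t k.+1) x)).
  rewrite (rE _ _ _ n (fun l => c (v k) l * B l (t k) x)) -sumrB.
  by apply: eq_bigr => l _; ring.
have phiE n : E (fun x => cos (D n x + b)) = cos b *
    \prod_(k <- s) expR (- ((t k.+1 - t k) *
      (\sum_(l < n | (l : nat) \in J) c (v k) l ^+ 2) / 2)).
  under eq_Rintegral do rewrite DE.
  rewrite (Exp_cos_sum (phi := fun l => \prod_(k <- s)
    expR (- ((t k.+1 - t k) * c (v k) l ^+ 2 / 2))) iB b).
  - congr (_ * _); rewrite exchange_big; apply: eq_bigr => k _.
    rewrite (rE _ _ _ n (fun l => c (v k) l ^+ 2)) -(big_morph expR (@expRD R) (@expR0 R)) sumrN; congr expR.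
    by rewrite mulr_sumr mulr_suml.
  - by rewrite filter_uniq// iota_uniq.
  - by move=> l; rewrite mem_filter => /andP[/set_mem].
  - move=> l; rewrite mem_filter => /andP[/set_mem Jl _]; split.
    + apply: measurable_sum => k; apply: measurable_funM => //.
      exact: measurable_funB.
    + by move=> A mA; exact: process_sigma_algebra_incr_sum.
    + by move=> b'; rewrite incr_cos.
have l2 : E (fun x => cos (D n x + b)) @[n --> \oo] -->
    cos b * \prod_(k <- s) expR (- ((t k.+1 - t k) * q (v k) / 2)).
  under eq_fun do rewrite phiE.
  apply: cvgMr; elim: (s) => [|k s' IH].
    by rewrite big_nil; under eq_fun do rewrite big_nil; exact: cvg_cst.
  rewrite big_cons; under eq_fun do rewrite big_cons.
  apply: cvgM => //.
  have h : - ((t k.+1 - t k) * (\sum_(l < n | (l : nat) \in J) c (v k) l ^+ 2) / 2)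
      @[n --> \oo] --> - ((t k.+1 - t k) * q (v k) / 2).
    by apply: cvgN; apply: cvgMl; apply: cvgMr; exact: cq.
  exact: (continuous_cvg _ (@continuous_expR R _) h).
exact: cvg_unique l1 l2.
Qed.

(** At time 0 every partial sum vanishes almost surely, so the mean-square error is the second
    moment of W 0 u itself, and it tends to 0. *)
Lemma expansion_start (u : dual U) : (forall k, J k -> B k 0 = cst 0 %[ae P]) ->
  W 0 u = cst 0 %[ae P].
Proof.
move=> B0; pose S n x := \sum_(l < n | (l : nat) \in J) c u l * B l 0 x.
have mS n : measurable_fun setT (S n) by exact: measurable_partial.
have mW := measurable_L0 (W 0 u).
have S0 n : \forall x \ae P, S n x = 0.
  have : \forall x \ae P, forall l : 'I_n, (l : nat) \in J -> B l 0 x = 0.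
    apply: filter_forall => l; have [Jl|Jl] := boolP ((l : nat) \in J); last first.
      by apply: nearW.
    by have := B0 _ (set_mem Jl); apply: filterS => x h _; exact: h.
  by apply: filterS => x h; rewrite /S big1// => l Jl; rewrite h// mulr0.
have /L2_cvgP/mean_square_nullP h := WB u (lexx 0).
have I0 : (\int[P]_x (W 0 u x ^+ 2)%:E = 0)%E.
  apply/eqP; rewrite eq_le integral_ge0 ?andbT; last first.
    by move=> x _; rewrite lee_fin sqr_ge0.
  apply/lee_addgt0Pr => e e0; rewrite add0e.
  have [n _ /(_ n (leqnn _))/=] := h e e0.
  apply: le_trans; rewrite le_eqVlt; apply/orP; left; apply/eqP.
  apply: ae_eq_integral => //.
  - by apply/measurable_EFinP; exact: measurable_funX.
  - apply/measurable_EFinP; apply: measurable_funX.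
    exact: measurable_funB mW (mS n).
  - by have := S0 n; apply: filterS => x Sx _; rewrite -/(S n x) Sx subr0.
have /(ae_eq_integral_abs P measurableT) : (\int[P]_x `|(W 0 u x ^+ 2)%:E| = 0)%E.
  by rewrite -[RHS]I0; apply: eq_integral => x _; rewrite gee0_abs// lee_fin sqr_ge0.
move=> /(_ _); have mW2 : measurable_fun setT (fun x => (W 0 u x ^+ 2)%:E).
  by apply/measurable_EFinP; exact: measurable_funX.
move=> /(_ mW2); apply: filterS => x h' _.
by have /eqP := h' Logic.I; rewrite eqe sqrf_eq0 => /eqP.
Qed.

End Expansion.

(** * Norming functionals *)

Section NormingFunctional.
Context {R : realType} {U : normedModType R}.
Implicit Types (p : U -> R) (x y : U).

(** Homogeneity is an inequality because infima inherit it in that form; equality follows by using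
    t^-1 as well. The bound by the norm is what later makes the linear functional continuous. *)
Definition sublinear p := [/\ forall x y, p (x + y) <= p x + p y,
  forall t x, 0 < t -> p (t *: x) <= t * p x & forall x, p x <= `|x|].

Lemma sublinear0 p : sublinear p -> p 0 = 0.
Proof.
move=> [_ pZ pn]; apply/eqP; rewrite eq_le; apply/andP; split.
  by have := pn 0; rewrite normr0.
by have := pZ 2 0 (ltr0n _ 2); rewrite scaler0; lra.
Qed.

Lemma sublinearZ p t x : sublinear p -> 0 < t -> p (t *: x) = t * p x.
Proof.
move=> [_ pZ _] t0; apply/eqP; rewrite eq_le pZ//=.
have ti : 0 < t^-1 by rewrite invr_gt0.
by have := pZ _ (t *: x) ti; rewrite scalerA mulVf ?gt_eqF// scale1r ler_pdivlMl.
Qed.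

Lemma sublinear_ge p x : sublinear p -> - p (- x) <= p x.
Proof.
move=> sp; have [pD _ _] := sp; have := pD x (- x).
by rewrite subrr sublinear0// => h; lra.
Qed.

(** Covers both infima that occur, over the parameter of a tangent and over a chain. The index on
    the left of each inequality may differ from those on the right: a sum of parameters in the first
    case, the smaller functional in the second. *)
Lemma sublinear_inf (K : Type) (D : set K) (Phi : K -> U -> R) (L : U -> R) :
  D !=set0 -> (forall k x, D k -> L x <= Phi k x) ->
  (forall k1 k2 x y, D k1 -> D k2 ->
     exists2 k, D k & Phi k (x + y) <= Phi k1 x + Phi k2 y) ->
  (forall k t x, D k -> 0 < t -> exists2 k', D k' & Phi k' (t *: x) <= t * Phi k x) ->
  (exists2 k, D k & forall x, Phi k x <= `|x|) ->
  exists2 p, sublinear p & forall k x, D k -> p x <= Phi k x.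
Proof.
move=> [k0 Dk0] lb PD PZ [k1 Dk1 Pn].
pose p x := inf [set Phi k x | k in D].
have ple k x : D k -> p x <= Phi k x.
  move=> Dk; apply: ge_inf; last by exists k.
  by exists (L x) => _ [k' Dk' <-]; exact: lb.
have pge x r : (forall k, D k -> r <= Phi k x) -> r <= p x.
  move=> h; apply: lb_le_inf; first by exists (Phi k0 x), k0.
  by move=> _ [k Dk <-]; exact: h.
exists p => //; split=> [x y|t x t0|x].
- rewrite -lerBlDl; apply: (pge) => k Dk; rewrite lerBlDl -lerBlDr.
  apply: (pge) => k' Dk'; rewrite lerBlDr.
  have [k'' Dk'' h] := PD _ _ x y Dk' Dk.
  exact: le_trans (ple _ _ Dk'') h.
- rewrite -ler_pdivrMl//; apply: (pge) => k Dk; rewrite ler_pdivrMl//.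
  have [k' Dk' h] := PZ k t x Dk t0.
  exact: le_trans (ple _ _ Dk') h.
- exact: le_trans (ple _ _ Dk1) (Pn x).
Qed.

(* x |-> inf over t >= 0 of p (x + t y) - t p y. *)
Lemma sublinear_tangent p y : sublinear p ->
  exists q, [/\ sublinear q, forall x, q x <= p x & forall x, q x <= p (x + y) - p y].
Proof.
move=> sp; have [pD pZ pn] := sp.
have [|||||] := @sublinear_inf R [set t | 0 <= t]
  (fun t x => p (x + t *: y) - t * p y) (fun x => - p (- x)).
- by exists 0; rewrite /=.
- move=> t x /= t0; have [->|tn0] := eqVneq t 0.
    by rewrite scale0r addr0 mul0r subr0 sublinear_ge.
  have tp : 0 < t by rewrite lt_def tn0.
  rewrite -(sublinearZ y sp tp); have := pD (x + t *: y) (- x).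
  by rewrite addrAC subrr add0r => h; lra.
- move=> s t x z /= s0 t0; exists (s + t); first by rewrite /= addr_ge0.
  rewrite scalerDl mulrDl addrACA.
  by have := pD (x + s *: y) (z + t *: y); lra.
- move=> s t x /= s0 t0; exists (t * s); first by rewrite /= mulr_ge0// ltW.
  rewrite -scalerA -scalerDr sublinearZ// mulrBr mulrA//.
- exists 0; first by rewrite /=.
  by move=> x; rewrite scale0r addr0 mul0r subr0.
- move=> q sq qle; exists q; split => // x.
    by have := qle 0 x (lexx 0); rewrite scale0r addr0 mul0r subr0.
by have := qle 1 x ler01; rewrite scale1r mul1r.
Qed.

(* A minimal sublinear functional is linear, as it agrees with all its tangents. *)
Lemma minimal_sublinear p : sublinear p ->
  exists2 g, sublinear g & (forall x, g x <= p x) /\ forall x y, g (x + y) = g x + g y.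
Proof.
move=> sp.
pose T := {q : U -> R | sublinear q /\ forall x, q x <= p x}.
(* The order is reversed: maximal for [le] means minimal pointwise. *)
pose le (q r : T) := `[< forall x, sval r x <= sval q x >].
pose p0 : T := exist _ p (conj sp (fun x => lexx (p x))).
have [|||g] := @ZL_preorder T p0 le.
- by move=> q; apply/asboolP.
- by move=> r q s /asboolP rq /asboolP qs; apply/asboolP => x; exact: le_trans (qs x) (rq x).
- move=> A Atot; have [->|/set0P[q0 Aq0]] := eqVneq A set0; first by exists p0.
  have [|||||] := @sublinear_inf T A (fun q => sval q) (fun x => - `|x|).
  + by exists q0.
  + move=> q x _; have [sq _] := svalP q; rewrite (le_trans _ (sublinear_ge x sq))//.
    by rewrite lerN2; have [_ _ /(_ (- x))] := sq; rewrite normrN.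
  + move=> q r x y Aq Ar; have [/asboolP qr|/asboolP rq] := Atot q r Aq Ar.
      exists r => //; have [[rD _ _] _] := svalP r.
      by rewrite (le_trans (rD x y))// lerD2r.
    exists q => //; have [[qD _ _] _] := svalP q.
    by rewrite (le_trans (qD x y))// lerD2l.
  + by move=> q t x Aq t0; exists q => //; have [[_ qZ _] _] := svalP q; exact: qZ.
  + by exists q0 => //; have [[_ _ qn] _] := svalP q0.
  + move=> r sr rle.
    have rp x : r x <= p x.
      by have [_ q0p] := svalP q0; exact: le_trans (rle q0 x Aq0) (q0p x).
    exists (exist _ r (conj sr rp)) => q Aq; apply/asboolP => x /=; exact: rle.
move=> gmax; have [sg gp] := svalP g.
exists (sval g) => //; split => // x y.
apply/eqP; rewrite eq_le; have [gD _ _] := sg; rewrite gD /=.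
have [q [sq qg qt]] := sublinear_tangent y sg.
have qp z : q z <= p z by exact: le_trans (qg z) (gp z).
have := gmax (exist _ q (conj sq qp)).
have -> : le g (exist _ q (conj sq qp)) by apply/asboolP.
move=> /(_ isT)/asboolP/(_ x) /= h.
by have := qt x; lra.
Qed.

(** A minimal functional is taken below the tangent of the norm at x, not just below the norm: this
    forces g(-x) <= |-x + x| - |x| = -|x|, so g x = |x|. It takes the place of a Hahn-Banach
    extension from the line through x. *)
Lemma norming_functional x : exists2 g : dual U,
  (forall y, `|g y| <= `|y|) & g x = `|x|.
Proof.
have sn : sublinear (fun y : U => `|y|).
  by split => // [y z|t y t0]; [exact: ler_normD|rewrite normrZ gtr0_norm].
have [q [sq _ qt]] := sublinear_tangent x sn.
have [g sg [gq gD]] := minimal_sublinear sq.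
have gN y : g (- y) = - g y.
  by have := gD y (- y); rewrite subrr sublinear0// => h; lra.
have gle y : `|g y| <= `|y|.
  have [_ _ gn] := sg; rewrite ler_norml gn andbT.
  by have := gn (- y); rewrite gN normrN; lra.
have gx : g x = `|x|.
  apply/eqP; rewrite eq_le (le_trans (ler_norm _) (gle x))/=.
  by have := le_trans (gq (- x)) (qt (- x)); rewrite addNr normr0 gN; lra.
have glin : linear (g : U -> R^o).
  move=> a y z; rewrite gD; congr (_ + _).
  have [a0|a0|->] := ltgtP a 0; last by rewrite !scale0r sublinear0.
    have -> : a *: y = - ((- a) *: y) by rewrite scaleNr opprK.
    by rewrite gN (sublinearZ _ sg) ?oppr_gt0// mulNr opprK.
  by rewrite sublinearZ.
have gcont : continuous (g : U -> R^o).
  move=> y; apply/cvgrPdist_le => e e0.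
  have /cvgrPdist_le/(_ e e0) := @cvg_id _ (nbhs y).
  by apply: filterS => z yz; rewrite -gN -gD (le_trans (gle _)).
have gd : (g : U -> R^o) \in @dual_pred R U by rewrite inE.
by exists (Dual gd : dual U). Qed.

End NormingFunctional.

(** * Positive forms and square-summable sequences *)

Section PositiveForm.
Context {R : realType} {V : lmodType R}.

(** Only semidefinite: a covariance may vanish on nonzero functionals. *)
Definition positive_form (Q : V -> V -> R) :=
  [/\ forall a u v w, Q (a *: u + v) w = a * Q u w + Q v w,
      forall u v, Q u v = Q v u & forall u, 0 <= Q u u].

Variable Q : V -> V -> R.
Hypothesis posQ : positive_form Q.

Lemma positive_formC u v : Q u v = Q v u.
Proof. by have [_ ->] := posQ. Qed.

Lemma positive_form_ge0 u : 0 <= Q u u.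
Proof. by have [_ _ ->] := posQ. Qed.

Lemma positive_form0l w : Q 0 w = 0.
Proof.
have [QD _ _] := posQ; have := QD 1 0 0 w.
by rewrite scale1r addr0 mul1r => h; lra.
Qed.

Lemma positive_formDl u v w : Q (u + v) w = Q u w + Q v w.
Proof. by have [QD _ _] := posQ; rewrite -[u]scale1r QD mul1r scale1r. Qed.

Lemma positive_formZl a u w : Q (a *: u) w = a * Q u w.
Proof. by have [QD _ _] := posQ; rewrite -[a *: u]addr0 QD positive_form0l addr0. Qed.

Lemma positive_formBl u v w : Q (u - v) w = Q u w - Q v w.
Proof. by rewrite positive_formDl -scaleN1r positive_formZl mulN1r. Qed.

Lemma positive_formDr u v w : Q w (u + v) = Q w u + Q w v.
Proof. by rewrite !(positive_formC w) positive_formDl. Qed.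

Lemma positive_formZr a u w : Q w (a *: u) = a * Q w u.
Proof. by rewrite !(positive_formC w) positive_formZl. Qed.

Lemma positive_formBr u v w : Q w (u - v) = Q w u - Q w v.
Proof. by rewrite !(positive_formC w) positive_formBl. Qed.

Lemma positive_form_suml (I : Type) (r : seq I) (p : pred I) (u : I -> V) w :
  Q (\sum_(i <- r | p i) u i) w = \sum_(i <- r | p i) Q (u i) w.
Proof.
by apply: (big_morph (fun u => Q u w)) => [x y|];
  rewrite ?positive_formDl ?positive_form0l.
Qed.

Lemma positive_form_sumr (I : Type) (r : seq I) (p : pred I) (u : I -> V) w :
  Q w (\sum_(i <- r | p i) u i) = \sum_(i <- r | p i) Q w (u i).
Proof.
rewrite positive_formC positive_form_suml.
by apply: eq_bigr => i _; rewrite positive_formC.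
Qed.

Lemma positive_form_sqD u v : Q (u + v) (u + v) = Q u u + 2 * Q u v + Q v v.
Proof.
by rewrite !(positive_formDl, positive_formDr) (positive_formC v u); lra.
Qed.

Lemma positive_formZ a u : Q (a *: u) (a *: u) = a ^+ 2 * Q u u.
Proof. by rewrite positive_formZl positive_formZr mulrA expr2. Qed.

Lemma positive_form_Cauchy u v : Q u v ^+ 2 <= Q u u * Q v v.
Proof.
have h a : 0 <= a ^+ 2 * Q u u + 2 * a * Q u v + Q v v.
  have := positive_form_ge0 (a *: u + v).
  by rewrite positive_form_sqD positive_formZ positive_formZl mulrA.
have [u0|u0] := eqVneq (Q u u) 0.
  rewrite u0 mul0r; have [->|uv0] := eqVneq (Q u v) 0; first by rewrite expr0n.
  (* When Q u u = 0 the quadratic is affine in a, and this coefficient would give it the value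
     -1. *)
  have := h (- (Q v v + 1) / (2 * Q u v)).
  have -> : 2 * (- (Q v v + 1) / (2 * Q u v)) * Q u v = - (Q v v + 1) by field.
  by rewrite u0 mulr0 => ?; lra.
have up : 0 < Q u u by rewrite lt_def u0 positive_form_ge0.
have := h (- Q u v / Q u u).
have -> : (- Q u v / Q u u) ^+ 2 * Q u u + 2 * (- Q u v / Q u u) * Q u v + Q v v
  = Q v v - Q u v ^+ 2 / Q u u by field.
by rewrite subr_ge0 ler_pdivrMr// mulrC.
Qed.

Lemma positive_form_triangle u v :
  Num.sqrt (Q (u + v) (u + v)) <= Num.sqrt (Q u u) + Num.sqrt (Q v v).
Proof.
have s0 : 0 <= Num.sqrt (Q u u) + Num.sqrt (Q v v) by rewrite addr_ge0 ?sqrtr_ge0.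
rewrite -(ler_pXn2r (n := 2)) ?nnegrE ?sqrtr_ge0//.
rewrite sqr_sqrtr ?positive_form_ge0// sqrrD !sqr_sqrtr ?positive_form_ge0//.
rewrite positive_form_sqD lerD2r lerD2l mulr_natl lerMn2r /=.
rewrite -sqrtrM ?positive_form_ge0// (le_trans (ler_norm _))//.
by rewrite -sqrtr_sqr ler_sqrt ?positive_form_Cauchy// mulr_ge0 ?positive_form_ge0.
Qed.

Section Orthonormal.
Variables (J : set nat) (e : nat -> V).
Hypothesis oe : forall i j, J i -> J j -> Q (e i) (e j) = (i == j)%:R.

Lemma orthonormal_dot (c : nat -> R) n j : J j ->
  Q (\sum_(k < n | (k : nat) \in J) c k *: e k) (e j) = if (j < n)%N then c j else 0.
Proof.
move=> Jj; rewrite positive_form_suml.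
transitivity (\sum_(k < n) (if k == j :> nat then c k else 0)).
  rewrite big_mkcond; apply: eq_bigr => k _.
  have [->|kj] := eqVneq (k : nat) j.
    by rewrite mem_set// positive_formZl oe// eqxx mulr1.
  case: ifPn => // /set_mem Jk.
  by rewrite positive_formZl oe// (negbTE kj) mulr0.
rewrite -big_mkcond; case: ifPn => jn; last first.
  rewrite big_pred0// => k; apply/negbTE; apply: contra jn => /eqP <-.
  exact: ltn_ord.
by rewrite (big_pred1 (Ordinal jn)).
Qed.

Lemma orthonormal_dot_sum (c b : nat -> R) n :
  Q (\sum_(k < n | (k : nat) \in J) c k *: e k)
    (\sum_(k < n | (k : nat) \in J) b k *: e k) =
  \sum_(k < n | (k : nat) \in J) c k * b k.
Proof.
rewrite positive_form_sumr; apply: eq_bigr => k /set_mem Jk.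
by rewrite positive_formZr orthonormal_dot// ltn_ord mulrC.
Qed.

Lemma orthonormal_residual v n :
  let w := v - \sum_(k < n | (k : nat) \in J) Q v (e k) *: e k in
  Q w w = Q v v - \sum_(k < n | (k : nat) \in J) Q v (e k) ^+ 2.
Proof.
move=> w; pose c k := Q v (e k).
pose s := \sum_(k < n | (k : nat) \in J) c k *: e k.
have ss : Q s s = \sum_(k < n | (k : nat) \in J) c k ^+ 2.
  by rewrite orthonormal_dot_sum; apply: eq_bigr => k _; rewrite expr2.
have vs : Q v s = \sum_(k < n | (k : nat) \in J) c k ^+ 2.
  by rewrite positive_form_sumr; apply: eq_bigr => k _; rewrite positive_formZr expr2.
have -> : w = v - s by [].
by rewrite positive_formBl !positive_formBr (positive_formC s v) ss vs subrr subr0.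
Qed.

(** An inequality, since coefficients off [J] count on the right but meet e k = 0 on the left.
    Arbitrary intervals are allowed because the bound feeds a Cauchy criterion in
    [ell2_operator]. *)
Lemma orthonormal_interval m n (c : nat -> R) : (forall k, ~ J k -> e k = 0) ->
  let s := \sum_(m <= k < n) c k *: e k in Q s s <= \sum_(m <= k < n) c k ^+ 2.
Proof.
move=> eoff; pose c' k := if (m <= k)%N then c k else 0.
have /= -> : \sum_(m <= k < n) c k *: e k = \sum_(k < n | (k : nat) \in J) c' k *: e k.
  rewrite big_geq_mkord [LHS]big_mkcond [RHS]big_mkcond; apply: eq_bigr => k _ /=.
  rewrite /c'; case: ifPn => mk; case: ((k : nat) \in J) / boolP => kJ//.
    by rewrite eoff ?scaler0// => Jk; rewrite mem_set in kJ.
  by rewrite scale0r.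
rewrite (orthonormal_dot_sum c' c') big_geq_mkord.
rewrite big_mkcond [leRHS]big_mkcond; apply: ler_sum => k _ /=.
by rewrite /c'; case: ifP => _; case: ifP => _; rewrite ?mulr0// ?sqr_ge0// expr2.
Qed.

End Orthonormal.

End PositiveForm.

(** * The Hilbert space of square-summable sequences *)

Section SquareSummable.
Context {R : realType} (J : set nat).

(** Sequences on all of [nat] that vanish off [J], so that one construction yields l^2 and the
    finite dimensional spaces. *)
Definition ell2_pred : {pred nat -> R^o} := mem [set a : nat -> R^o |
  (forall k, ~ J k -> a k = 0) /\ exists M : R, forall n, \sum_(k < n) a k ^+ 2 <= M].

Fact ell2_submod_closed : submod_closed ell2_pred.
Proof.
split=> [|c a b].
  rewrite inE/=; split => //; exists 0 => n.
  by rewrite big1// => k _; rewrite expr0n.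
rewrite !inE/= => -[aJ [M aM]] [bJ [N bN]]; split => [k Jk|].
  by rewrite -[LHS]/(c *: a k + b k) aJ// bJ// scaler0 addr0.
exists (2 * (c ^+ 2 * M) + 2 * N) => n.
have h : \sum_(k < n) (c *: a + b) k ^+ 2 <=
    2 * (c ^+ 2 * \sum_(k < n) a k ^+ 2) + 2 * \sum_(k < n) b k ^+ 2.
  rewrite !mulr_sumr -big_split/=; apply: ler_sum => k _.
  rewrite -[(c *: a + b) k]/(c * a k + b k).
  by have := sqr_ge0 (c * a k - b k); nra.
have := aM n; have := bN n; have := sqr_ge0 c.
have := @ler_wpM2l R (c ^+ 2) (sqr_ge0 c) _ _ (aM n).
by lra.
Qed.

HB.instance Definition _ :=
  GRing.isSubmodClosed.Build R (nat -> R^o) ell2_pred ell2_submod_closed.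

Record ell2 := Ell2 { ell2_fun :> nat -> R^o; ell2_funP : ell2_fun \in ell2_pred }.

HB.instance Definition _ := [isSub for ell2_fun].
HB.instance Definition _ := [Choice of ell2 by <:].
HB.instance Definition _ := [SubChoice_isSubLmodule of ell2 by <:].

Implicit Types a b c : ell2.

Lemma ell2_linE t a b k : (t *: a + b : ell2) k = t * a k + b k.
Proof. by []. Qed.

Lemma ell2_off a k : ~ J k -> a k = 0.
Proof. by have := ell2_funP a; rewrite inE => -[h _]; exact: h. Qed.

Lemma ell2_sq_is_cvg a : cvgn (fun n => \sum_(k < n) a k ^+ 2 : R).
Proof.
have := ell2_funP a; rewrite inE => -[_ [M aM]].
apply: nondecreasing_is_cvgn.
  apply/nondecreasing_seqP => n.
  by rewrite big_ord_recr/= lerDl sqr_ge0.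
by exists M => _ [n _ <-]; exact: aM.
Qed.

Definition ell2_dot a b : R := limn (fun n => \sum_(k < n) a k * b k : R).

(** Polarization reduces convergence to that of the monotone bounded sums of squares of b + a and b
    - a. *)
Lemma ell2_dot_cvg a b : \sum_(k < n) a k * b k @[n --> \oo] --> ell2_dot a b.
Proof.
suff : cvgn (fun n => \sum_(k < n) a k * b k : R) by [].
have -> : (fun n => \sum_(k < n) a k * b k : R) =
  (fun n => 4^-1 * (\sum_(k < n) (1 *: a + b : ell2) k ^+ 2 -
                    \sum_(k < n) ((-1) *: a + b : ell2) k ^+ 2)).
  apply/funext => n; rewrite -sumrB mulr_sumr; apply: eq_bigr => k _.
  by rewrite !ell2_linE; field.
by apply: is_cvgMr; apply: is_cvgB; exact: ell2_sq_is_cvg.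
Qed.

Lemma ell2_dot_positive : positive_form (V := ell2) ell2_dot.
Proof.
split => [t a b c|a b|a].
- apply/cvg_lim => //.
  rewrite (_ : (fun n => _) = (fun n => t * \sum_(k < n) a k * c k +
      \sum_(k < n) b k * c k)).
    apply: cvgD; last exact: ell2_dot_cvg.
    by apply: cvgMr; exact: ell2_dot_cvg.
  apply/funext => n; rewrite mulr_sumr -big_split; apply: eq_bigr => k _.
  by rewrite ell2_linE mulrDl mulrA.
- by rewrite /ell2_dot; under eq_fun do under eq_bigr do rewrite mulrC.
- apply: limr_ge; first exact: ell2_dot_cvg.
  by apply: nearW => n; apply: sumr_ge0 => k _; rewrite -expr2 sqr_ge0.
Qed.

Lemma ell2_partial_dot a n : \sum_(k < n) a k ^+ 2 <= ell2_dot a a.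
Proof.
have -> : ell2_dot a a = limn (fun n => \sum_(k < n) a k ^+ 2 : R).
  by congr lim; congr (_ @ _); apply/funext => m; apply: eq_bigr => k _; rewrite expr2.
apply: (@nondecreasing_cvgn_le R (fun n => \sum_(k < n) a k ^+ 2)).
  apply/nondecreasing_seqP => m.
  by rewrite big_ord_recr/= lerDl sqr_ge0.
exact: ell2_sq_is_cvg.
Qed.

Lemma ell2_coord_dot a k : a k ^+ 2 <= ell2_dot a a.
Proof.
apply: le_trans (ell2_partial_dot a k.+1).
by rewrite big_ord_recr/= lerDr sumr_ge0// => i _; rewrite sqr_ge0.
Qed.

Lemma ell2_ext a b : (forall k, a k = b k) -> a = b.
Proof. by move=> h; apply: val_inj; apply/funext. Qed.

Lemma ell2_dot_eq0 a : ell2_dot a a = 0 -> a = 0.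
Proof.
move=> a0; apply: ell2_ext => k; apply/eqP.
by rewrite -sqrf_eq0 eq_le sqr_ge0 andbT -a0 ell2_coord_dot.
Qed.

Definition ell2_norm a := Num.sqrt (ell2_dot a a).

Fact ell2_normD a b : ell2_norm (a + b) <= ell2_norm a + ell2_norm b.
Proof. exact: (positive_form_triangle ell2_dot_positive). Qed.

Fact ell2_normZ (t : R) a : ell2_norm (t *: a) = `|t| * ell2_norm a.
Proof.
rewrite /ell2_norm (positive_formZ ell2_dot_positive) sqrtrM ?sqr_ge0//.
by rewrite sqrtr_sqr.
Qed.

Fact ell2_norm_eq0 a : ell2_norm a = 0 -> a = 0.
Proof.
move=> /eqP; rewrite sqrtr_eq0 => a0; apply: ell2_dot_eq0; apply/eqP.
by rewrite eq_le a0 (positive_form_ge0 ell2_dot_positive).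
Qed.

HB.instance Definition _ :=
  Lmodule_isNormed.Build R ell2 ell2_normD ell2_normZ ell2_norm_eq0.

Lemma ell2_normE a : `|a| = Num.sqrt (ell2_dot a a).
Proof. by []. Qed.

Lemma ell2_norm_partial a n : \sum_(k < n) a k ^+ 2 <= `|a| ^+ 2.
Proof.
rewrite ell2_normE sqr_sqrtr ?ell2_partial_dot//.
exact: (positive_form_ge0 ell2_dot_positive).
Qed.

Lemma ell2_norm_coord a k : `|a k| <= `|a|.
Proof. by rewrite -sqrtr_sqr ler_wsqrtr// ell2_coord_dot. Qed.

Lemma ell2_norm_le a (M : R) : 0 <= M ->
  (forall n, \sum_(k < n) a k ^+ 2 <= M ^+ 2) -> `|a| <= M.
Proof.
move=> M0 h; rewrite ell2_normE -[leRHS]ger0_norm// -sqrtr_sqr ler_wsqrtr//.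
apply: limr_le; first exact: ell2_dot_cvg.
by apply: nearW => n; under eq_bigr do rewrite -expr2.
Qed.

(** The limit is taken coordinatewise. The Cauchy estimate restricted to the first n coordinates
    survives the limit for each n, and yields both membership of the limit and convergence in
    norm. *)
Fact ell2_complete (F : set_system ell2) : ProperFilter F -> cauchy F -> cvg F.
Proof.
move=> FF /cauchyP Fc.
have FcP (e : R) : 0 < e -> exists x : ell2, F [set y | `|x - y| < e].
  by move=> /Fc[x]; rewrite -ball_normE => Fx; exists x.
have coordB (x y : ell2) k : x k - y k = (x - y : ell2) k by [].
have Fk k : cvg ((fun y : ell2 => y k : R^o) @ F).
  apply: cauchy_cvg; apply: cauchy_exP => e e0.
  have [x Fx] := FcP e e0; exists (x k).
  change (F [set y : ell2 | ball (x k : R^o) e (y k)]).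
  apply: filterS Fx => y /= xy; rewrite -ball_normE/=.
  by rewrite -[_ - _]/((x - y : ell2) k) (le_lt_trans (ell2_norm_coord _ _)).
pose l k : R^o := lim ((fun y : ell2 => y k : R^o) @ F).
have near_l (x : ell2) (e : R) : 0 < e -> F [set y | `|x - y| < e] ->
    forall n, \sum_(k < n) (x k - l k) ^+ 2 <= e ^+ 2 :> R.
  move=> e0 Fx n.
  apply: (@ler_cvg_to _ F _ _ (fun y : ell2 => \sum_(k < n) (x k - y k) ^+ 2 : R)
    (fun=> e ^+ 2)).
  - apply: cvg_big => [|k _]; first by move=> z; apply: cvgD; [exact: cvg_fst|exact: cvg_snd].
    under eq_fun do rewrite expr2.
    have xyl : (fun y : ell2 => x k - y k : R) @ F --> (x k - l k : R).
      by apply: cvgB; [exact: cvg_cst|exact: Fk].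
    by rewrite [_ ^+ 2]expr2; exact: (cvgM xyl xyl).
  - exact: cvg_cst.
  - apply: filterS Fx => y /= xy.
    under eq_bigr do rewrite coordB.
    apply: le_trans (ell2_norm_partial _ _) _.
    by rewrite ler_pXn2r ?nnegrE//; exact: ltW.
have lE : l \in ell2_pred.
  rewrite inE; split => [k Jk|].
    apply/cvg_lim => //; under eq_cvg do rewrite ell2_off//.
    exact: cvg_cst.
  have [x Fx] := FcP 1 ltr01; exists (2 * `|x| ^+ 2 + 2) => n.
  have := near_l x 1 ltr01 Fx n; have := ell2_norm_partial x n.
  have : \sum_(k < n) l k ^+ 2 <= 2 * \sum_(k < n) x k ^+ 2 +
      2 * \sum_(k < n) (x k - l k) ^+ 2 :> R.
    rewrite !mulr_sumr -big_split; apply: ler_sum => k _ /=.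
    by have := sqr_ge0 (2 * x k - l k); nra.
  by rewrite expr1n; lra.
apply/cvg_ex; exists (Ell2 lE); apply/cvgrPdist_le => e e0.
have e2 : 0 < e / 2 by rewrite divr_gt0.
have [x Fx] := FcP _ e2; apply: filterS (Fx) => y /= xy.
rewrite -[Ell2 lE](subrK x) -addrA (le_trans (ler_normD _ _))// [leRHS]splitr.
apply: lerD; last exact: ltW.
rewrite distrC; apply: ell2_norm_le; first exact: ltW.
by move=> n; exact: near_l.
Qed.

HB.instance Definition _ := Uniform_isComplete.Build ell2 ell2_complete.

Fact ell2_dot_bilinear :
  bilinear_for (GRing.Scale.Law.clone _ _ ( *%R ) _)
    (GRing.Scale.Law.clone _ _ (@idfun R \; *%R ) _) (ell2_dot : ell2 -> ell2 -> R).
Proof.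
have [DD DC _] := ell2_dot_positive.
split => [c t a b|c t a b]; first exact: DD.
by rewrite DC DD !(DC c).
Qed.

HB.instance Definition _ := bilinear_isBilinear.Build R ell2 ell2 R
  (GRing.Scale.Law.clone _ _ ( *%R ) _)
  (GRing.Scale.Law.clone _ _ (@idfun R \; *%R ) _) ell2_dot ell2_dot_bilinear.

Fact ell2_dot_hermitian a b : ell2_dot a b = (-1) ^+ false * idfun (ell2_dot b a).
Proof. by rewrite mul1r; exact: (positive_formC ell2_dot_positive). Qed.

HB.instance Definition _ := isHermitianSesquilinear.Build R ell2 false idfun
  ell2_dot ell2_dot_hermitian.

Fact ell2_dot_gt0 a : a != 0 -> 0 < ell2_dot a a.
Proof.
rewrite lt_def (positive_form_ge0 ell2_dot_positive) andbT.
by apply: contra_neq; exact: ell2_dot_eq0.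
Qed.

HB.instance Definition _ := isDotProduct.Build R ell2 ell2_dot ell2_dot_gt0.

Lemma ell2_hilbert_norm : hilbert_norm (H := ell2) ell2_dot.
Proof.
move=> a; rewrite ell2_normE sqr_sqrtr//.
exact: (positive_form_ge0 ell2_dot_positive).
Qed.

(** Off [J] the vector is 0, so that it lies in the space for every k. *)
Definition ell2_unit_fun k : nat -> R^o := fun i => ((i == k) && (k \in J))%:R.

Fact ell2_unit_subproof k : ell2_unit_fun k \in ell2_pred.
Proof.
rewrite inE; split => [i Ji|].
  rewrite /ell2_unit_fun; have [<-|//] := eqVneq i k.
  by rewrite memNset.
exists 1 => n; apply: (@le_trans _ _ (\sum_(i < n | i == k :> nat) 1)).
  rewrite [leRHS]big_mkcond/=; apply: ler_sum => i _.
  rewrite /ell2_unit_fun; case: eqP => _; last by rewrite expr0n.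
  by case: (_ \in _); rewrite ?expr1n ?expr0n ?ler01.
have [kn|kn] := ltnP k n; first by rewrite (big_pred1 (Ordinal kn)).
rewrite big_pred0// => i; apply/negbTE/eqP => ik.
by have := ltn_ord i; rewrite ik ltnNge kn.
Qed.

Definition ell2_unit k : ell2 := Ell2 (ell2_unit_subproof k).

Lemma ell2_unitE k i : ell2_unit k i = ((i == k) && (k \in J))%:R.
Proof. by []. Qed.

Lemma ell2_sum_unit (V : lmodType R) (y : nat -> V) k n : J k -> (k < n)%N ->
  \sum_(i < n) ell2_unit k i *: y i = y k.
Proof.
move=> Jk kn; rewrite (bigD1 (Ordinal kn))// ell2_unitE eqxx mem_set// scale1r.
rewrite big1 => [|i]; first exact: addr0.
rewrite -val_eqE ell2_unitE => /negbTE /= ->.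
by rewrite scale0r.
Qed.

Lemma ell2_dot_unit a k : J k -> ell2_dot a (ell2_unit k) = a k.
Proof.
move=> Jk; apply/cvg_lim => //; apply: cvg_near_cst; exists k.+1 => // n /= kn.
rewrite -[RHS](ell2_sum_unit (V := R^o) a Jk kn).
by apply: eq_bigr => i _; rewrite [RHS]mulrC.
Qed.

Lemma ell2_unit_orthonormal i j : J i -> J j ->
  ell2_dot (ell2_unit i) (ell2_unit j) = (i == j)%:R.
Proof.
by move=> Ji Jj; rewrite ell2_dot_unit// ell2_unitE mem_set// andbT eq_sym.
Qed.

Lemma ell2_expansion a :
  \sum_(k < n | (k : nat) \in J) a k *: ell2_unit k @[n --> \oo] --> a.
Proof.
have aE n : `|a - \sum_(k < n | (k : nat) \in J) a k *: ell2_unit k| =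
    Num.sqrt (ell2_dot a a - \sum_(k < n) a k ^+ 2).
  rewrite ell2_normE; congr Num.sqrt.
  have /= := orthonormal_residual ell2_dot_positive ell2_unit_orthonormal a n.
  have -> : \sum_(k < n | (k : nat) \in J) ell2_dot a (ell2_unit k) *: ell2_unit k =
      \sum_(k < n | (k : nat) \in J) a k *: ell2_unit k.
    by apply: eq_bigr => k /set_mem Jk; rewrite ell2_dot_unit.
  move=> ->; congr (_ - _); rewrite big_mkcond; apply: eq_bigr => k _ /=.
  case: ifPn => [/set_mem Jk|kJ]; first by rewrite ell2_dot_unit.
  by rewrite ell2_off ?expr0n// => Jk; rewrite mem_set in kJ.
apply/cvgrPdist_le => r r0.
have /cvgrPdist_le/(_ (r ^+ 2) (exprn_gt0 2 r0)) := @ell2_dot_cvg a a.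
apply: filterS => n h; rewrite aE -[leRHS](ger0_norm (ltW r0)) -sqrtr_sqr ler_wsqrtr//.
by apply: le_trans h; under eq_bigr do rewrite expr2; exact: ler_norm.
Qed.

Hypothesis Jinit : J = [set: nat] \/ exists n, J = `I_n.

Lemma ell2_orthonormal_basis : orthonormal_basis (H := ell2) ell2_dot J ell2_unit.
Proof.
split => //; first exact: ell2_unit_orthonormal.
move=> O [a Oa] oO.
have : \forall n \near \oo, O (\sum_(k < n | (k : nat) \in J) a k *: ell2_unit k).
  by apply: (@ell2_expansion a); exact: open_nbhs_nbhs.
move=> [n _ /(_ n (leqnn n)) On].
exists (\sum_(k < n | (k : nat) \in J) a k *: ell2_unit k).
by split; [exact: On|exists n, a].
Qed.

(** The hypothesis on intervals [m, n[ makes the series of a k *: y k Cauchy; with m = 0 it bounds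
    the resulting operator by the square root of C. *)
Lemma ell2_operator (U : completeNormedModType R) (y : nat -> U) (C : R) :
  (forall m n (c : nat -> R),
    `|\sum_(m <= k < n) c k *: y k| ^+ 2 <= C * \sum_(m <= k < n) c k ^+ 2) ->
  exists f : {linear ell2 -> U}, continuous f /\ forall k, J k -> f (ell2_unit k) = y k.
Proof.
move=> hC.
have C0 : 0 <= C.
  by have := hC 0%N 1%N (fun=> 1); rewrite !big_nat1 expr1n mulr1; apply: le_trans; rewrite sqr_ge0.
pose K := Num.sqrt C.
have hK m n (c : nat -> R) (r : R) : 0 <= r ->
    \sum_(m <= k < n) c k ^+ 2 <= r ^+ 2 -> `|\sum_(m <= k < n) c k *: y k| <= K * r.
  move=> r0 cr; rewrite -(ler_pXn2r (n := 2)) ?nnegrE ?mulr_ge0 ?sqrtr_ge0//.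
  by rewrite exprMn sqr_sqrtr// (le_trans (hC _ _ _))// ler_wpM2l.
pose u a (n : nat) : U := \sum_(0 <= k < n) (a k : R) *: y k.
have ucvg a : cvgn (u a).
  apply: cauchy_cvg; apply/cauchy_seriesP => e e0.
  (* [K] may be 0, so the tolerance is divided by K + 1. *)
  have K1 : 0 < K + 1 by rewrite ltr_pwDr ?sqrtr_ge0.
  have e1 : 0 < e / (K + 1) by rewrite divr_gt0.
  have /cvg_cauchy/cauchy_seriesP/(_ _ (exprn_gt0 2 e1)) :
      cvgn (series (fun k => a k ^+ 2 : R)).
    have -> : series (fun k => a k ^+ 2 : R) = (fun n => \sum_(k < n) a k ^+ 2).
      by apply/funext => n; rewrite /series/= big_mkord.
    exact: ell2_sq_is_cvg.
  apply: filterS => -[m n] /= h.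
  have := hK m n a _ (ltW e1) (le_trans (ler_norm _) (ltW h)).
  move/le_lt_trans; apply; rewrite mulrA ltr_pdivrMr// mulrC ltr_pM2l//.
  by rewrite ltrDl.
pose T a : U := limn (u a).
have Tlin : linear T.
  move=> t a b; apply/cvg_lim => //.
  rewrite (_ : u _ = (fun n => t *: u a n + u b n)).
    by apply: cvgD; [apply: cvgZr; exact: ucvg|exact: ucvg].
  apply/funext => n; rewrite /u scaler_sumr -big_split; apply: eq_bigr => k _.
  by rewrite ell2_linE scalerDl scalerA.
have Tle a : `|T a| <= K * `|a|.
  apply: (@ler_cvg_to _ (nbhs \oo) _ _ (fun n => `|u a n|) (fun=> K * `|a|)).
  - by apply: cvg_norm; exact: ucvg.
  - exact: cvg_cst.
  - by apply: nearW => n; apply: hK => //; rewrite big_mkord ell2_norm_partial.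
pose f : {linear ell2 -> U} :=
  HB.pack_for {linear ell2 -> U} T (GRing.isLinear.Build R ell2 U *:%R T Tlin).
exists f; split => [|k Jk]; last first.
  apply/cvg_lim => //; apply: cvg_near_cst; exists k.+1 => // n /= kn.
  by rewrite /u big_mkord ell2_sum_unit.
apply: bounded_linear_continuous; apply/linear_boundedP.
near=> r => a; apply: le_trans (Tle a) _.
by apply: ler_wpM2r => //; near: r; exact: nbhs_pinfty_ge.
Unshelve. all: by end_near. Qed.

End SquareSummable.

(** * Factorization of the covariance operator *)

Section DualSeparation.
Context {R : realType} {U : completeNormedModType R}.
Implicit Types (u v w : dual U) (x y : U).

Lemma dual_linear v : linear v.
Proof. by have := dual_funP v; rewrite inE => -[]. Qed.

Lemma dual_continuous v : continuous v.
Proof. by have := dual_funP v; rewrite inE => -[]. Qed.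

Lemma dualD v x y : v (x + y) = v x + v y.
Proof. by have := dual_linear v 1 x y; rewrite !scale1r. Qed.

Lemma dual0 v : v 0 = 0.
Proof. by have := dualD v 0 0; rewrite addr0 => h; lra. Qed.

Lemma dualZ v (a : R) x : v (a *: x) = a * v x.
Proof. by have := dual_linear v a x 0; rewrite !addr0 dual0 addr0. Qed.

Lemma dualB v x y : v (x - y) = v x - v y.
Proof. by rewrite dualD -scaleN1r dualZ mulN1r. Qed.

Lemma dual_combE (a : R) u v x : (a *: u + v : dual U) x = a * u x + v x.
Proof. by []. Qed.

Lemma dual_separates x : (forall v, v x = 0) -> x = 0.
Proof.
move=> h; have [g _ gx] := norming_functional x.
by apply/eqP; rewrite -normr_eq0 -gx h.
Qed.

(** One norming functional for each point of a dense sequence. If all of them vanish at x, a point d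
    of the sequence near x has |d| = g d = g (d - x) <= |d - x|, so x is arbitrarily small. *)
Lemma countable_separating_functionals : separable U ->
  exists g : nat -> dual U, forall x, (forall m, g m x = 0) -> x = 0.
Proof.
move=> [D /countable_injP[phi phi_inj] Ddense].
have /choice[g gP] : forall m, exists g : dual U,
    forall x, D x -> phi x = m -> (forall y, `|g y| <= `|y|) /\ g x = `|x|.
  move=> m; have [[x [Dx xm]]|h] := pselect (exists x, D x /\ phi x = m).
    have [g gle gx] := norming_functional x; exists g => y Dy ym; split => //.
    by rewrite (phi_inj y x) ?inE// ym.
  by exists 0 => x Dx xm; exfalso; apply: h; exists x.
exists g => x gx; apply/eqP; rewrite -normr_le0; apply/ler_addgt0Pl => e e0.
have e2 : 0 < e / 2 by rewrite divr_gt0.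
have [d [xd Dd]] : ball x (e / 2) `&` D !=set0.
  by apply: Ddense; [exists x; exact: ballxx|exact: ball_open].
rewrite -ball_normE /= in xd.
have [gle gd] := gP (phi d) d Dd erefl.
have dle : `|d| <= e / 2.
  rewrite -gd -[g _ d]subr0 -(gx (phi d)) -dualB (le_trans (ler_norm _))//.
  by rewrite (le_trans (gle _))// distrC ltW.
rewrite -[x](subrK d) (le_trans (ler_normD _ _))// addr0 [leRHS]splitr lerD//.
exact: ltW.
Qed.

(** The one instance of completeness of the dual that the gliding hump calls for, stated with
    pointwise bounds. The factor 2 is generous: the geometric tail with ratio 1/5 is 5/4 of its
    first term. *)
Lemma dual_geometric_limit (v : nat -> dual U) :
  (forall n x, `|v n.+1 x - v n x| <= 5^-1 ^+ n * `|x|) ->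
  exists g : dual U, forall n x, `|g x - v n x| <= 2 * 5^-1 ^+ n * `|x|.
Proof.
move=> hv; set z : R := 5^-1.
have z0 k : 0 <= z ^+ k by rewrite exprn_ge0// invr_ge0.
have tele n k x : `|v (n + k)%N x - v n x| <= 2 * (z ^+ n - z ^+ (n + k)) * `|x|.
  elim: k => [|k ih]; first by rewrite addn0 !subrr normr0 mulr0 mul0r.
  rewrite addnS -[v _ x](subrK (v (n + k)%N x)) -addrA.
  rewrite (le_trans (ler_normD _ _))// (le_trans (lerD (hv _ _) ih))//.
  rewrite -mulrDl ler_wpM2r// exprS.
  have := z0 (n + k)%N; set a := z ^+ (n + k).
  by rewrite (_ : z * a = a / 5) 1?mulrC//; lra.
have tail n k x : `|v (n + k)%N x - v n x| <= 2 * z ^+ n * `|x|.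
  apply: le_trans (tele n k x) _; rewrite ler_wpM2r//.
  by have := z0 (n + k)%N; lra.
have zcvg : z ^+ n @[n --> \oo] --> (0 : R).
  by apply: cvg_expr; rewrite ger0_norm ?invr_ge0// /z invf_lt1// ltr1n.
have vc x : cvgn (fun n => v n x : R).
  apply: cauchy_cvg; apply: cauchy_exP => e e0.
  have x1 : 0 < `|x| + 1 by rewrite ltr_wpDl.
  have e1 : 0 < e / (2 * (`|x| + 1)) by rewrite divr_gt0// mulr_gt0.
  have /cvgr0_norm_lt/(_ _ e1)[n _ /(_ n (leqnn n))] := zcvg.
  rewrite /= ger0_norm// ltr_pdivlMr ?mulr_gt0// => zn.
  exists (v n x); exists n => // m /= nm; rewrite -ball_normE /= distrC -(subnKC nm).
  apply: le_lt_trans (tail _ _ _) (le_lt_trans _ zn).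
  by rewrite mulrCA mulrA ler_wpM2l ?mulr_ge0// lerDl.
pose g x : R^o := limn (fun n => v n x : R).
have gv n x : `|g x - v n x| <= 2 * z ^+ n * `|x|.
  apply: (@ler_cvg_to _ (nbhs \oo) _ _ (fun m => `|v m x - v n x|)
    (fun=> 2 * z ^+ n * `|x|)).
  - by apply: cvg_norm; apply: cvgB; [exact: vc|exact: cvg_cst].
  - exact: cvg_cst.
  - by exists n => // m /= nm; rewrite -(subnKC nm).
have glin : linear (g : U -> R^o).
  move=> a x y; apply/cvg_lim => //.
  rewrite (_ : (fun n => _) = (fun n => a * v n x + v n y)).
    by apply: cvgD; [apply: cvgMr; exact: vc|exact: vc].
  by apply/funext => n; rewrite dualD dualZ.
have gcont : continuous (g : U -> R^o).
  move=> x; apply/cvgrPdist_le => e e0.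
  have e2 : 0 < e / 2 by rewrite divr_gt0.
  have e4 : 0 < e / 4 by rewrite divr_gt0.
  have /cvgrPdist_le/(_ _ e2) : v 0%N y @[y --> x] --> (v 0%N x : R^o).
    exact: dual_continuous.
  have /cvgrPdist_lt/(_ _ e4) := @cvg_id _ (nbhs x).
  apply: filterS2 => y xy; rewrite -dualB => vxy.
  have -> : g x - g y = g (x - y).
    by have := glin (-1) y x; rewrite !scaleN1r => h; rewrite [LHS]addrC [x - y]addrC h.
  rewrite -[g _](subrK (v 0%N (x - y))) (le_trans (ler_normD _ _))//.
  by have := gv 0%N (x - y); rewrite expr0; lra.
have gd : (g : U -> R^o) \in @dual_pred R U by rewrite inE.
by exists (Dual gd : dual U).
Qed.

(* Gliding hump: the functional v is built from norming functionals of T w_n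
   with weights decreasing so fast that v (T w_n) stays comparable to the n-th
   term. *)
Lemma positive_covariance_bounded (T : dual U -> U) :
  positive_form (fun u v => v (T u)) ->
  exists C : R, forall w, `|T w| ^+ 2 <= C * w (T w).
Proof.
move=> posT; apply: contrapT => /forallNP h.
(* The factor 5^n will cancel the weight 5^-n of the n-th hump; the factor n remains and produces
   the contradiction. *)
have /choice[w wP] : forall n, exists w, (n%:R * 5 ^+ n) ^+ 2 * w (T w) < `|T w| ^+ 2.
  move=> n; have /existsNP[w /negP] := h ((n%:R * 5 ^+ n) ^+ 2).
  by rewrite -ltNge => hw; exists w.
have /choice[g gP] : forall n, exists g : dual U,
    (forall y, `|g y| <= `|y|) /\ g (T (w n)) = `|T (w n)|.
  by move=> n; have [g ? ?] := norming_functional (T (w n)); exists g.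
set z : R := 5^-1.
have z0 k : 0 < z ^+ k by rewrite exprn_gt0// invr_gt0.
(* The hump at [m] is added only if the functional built so far takes a value below half the weight
   at T (w m). In either case the new value is at least half the weight times |T (w m)|. *)
pose v := fix v n : dual U := if n is m.+1 then
  (if `|v m (T (w m))| < z ^+ m / 2 * `|T (w m)| then z ^+ m *: g m + v m else v m)
  else 0.
have vS n x : `|v n.+1 x - v n x| <= z ^+ n * `|x|.
  rewrite /=; case: ifP => _.
    rewrite dual_combE addrK normrM (ger0_norm (ltW (z0 n))).
    by have [gle _] := gP n; rewrite ler_wpM2l//; exact: ltW.
  by rewrite subrr normr0 mulr_ge0//; exact: ltW.
have vn n : z ^+ n / 2 * `|T (w n)| <= `|v n.+1 (T (w n))|.
  rewrite /=; case: ifPn => [hn|]; last by rewrite -leNgt.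
  have [_ gn] := gP n; rewrite dual_combE gn.
  have zn : 0 <= z ^+ n * `|T (w n)| by rewrite mulr_ge0// ltW.
  have := ler_normB (z ^+ n * `|T (w n)| + v n (T (w n))) (v n (T (w n))).
  by rewrite addrK (ger0_norm zn); lra.
have [f fP] := dual_geometric_limit vS.
(* All later humps together change the value by at most 2 z^(n+1) |T (w n)|, and z^n / 2 - 2 z^(n+1)
   = z^n / 10. The ratio 1/5 is chosen to leave this positive. *)
have fn n : z ^+ n / 10 * `|T (w n)| <= `|f (T (w n))|.
  have := fP n.+1 (T (w n)); rewrite -/z exprS {1}/z => h1.
  have := vn n; have := ler_normB (v n.+1 (T (w n))) (f (T (w n))).
  have := ler_normD (f (T (w n))) (v n.+1 (T (w n)) - f (T (w n))).
  rewrite addrC subrK [`|v n.+1 (T (w n)) - _|]distrC.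
  by lra.
(* Cauchy-Schwarz bounds f (T (w n))^2 by w n (T (w n)) times f (T f). Inserting the lower bound for
   the left side and the choice of w n leaves n^2 below a number independent of n. *)
have key n : n%:R ^+ 2 <= 100 * f (T f) :> R.
  have := positive_form_Cauchy posT (w n) f => /=; have := wP n.
  set t := `|T (w n)|; set a := w n (T (w n)) => at2 cs.
  have a0 : 0 <= a by exact: (positive_form_ge0 posT).
  have t0 : 0 < t ^+ 2 by apply: le_lt_trans at2; rewrite mulr_ge0// sqr_ge0.
  have f0 : 0 <= f (T f) by exact: (positive_form_ge0 posT).
  have zt : (z ^+ n * t) ^+ 2 <= 100 * (a * f (T f)).
    have : (z ^+ n / 10 * t) ^+ 2 <= f (T (w n)) ^+ 2.
      rewrite -[leRHS]real_normK ?num_real// ler_pXn2r ?nnegrE//.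
      by apply: mulr_ge0; [apply: divr_ge0 => //; exact: ltW|exact: normr_ge0].
    rewrite (_ : _ ^+ 2 = (z ^+ n * t) ^+ 2 / 100); last by field.
    by lra.
  have nt : n%:R ^+ 2 * t ^+ 2 = (n%:R * 5 ^+ n) ^+ 2 * (z ^+ n * t) ^+ 2.
    have : 5 ^+ n * z ^+ n = 1 by rewrite -exprMn mulfV ?expr1n// pnatr_eq0.
    set p := 5 ^+ n; set y := z ^+ n => py.
    rewrite (_ : _ * (y * t) ^+ 2 = n%:R ^+ 2 * t ^+ 2 * (p * y) ^+ 2); last by ring.
    by rewrite py expr1n mulr1.
  rewrite -(ler_pM2r t0) nt.
  apply: le_trans (_ : (n%:R * 5 ^+ n) ^+ 2 * (100 * (a * f (T f))) <= _).
    by rewrite ler_wpM2l ?sqr_ge0.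
  rewrite (_ : _ * (100 * _) = 100 * f (T f) * ((n%:R * 5 ^+ n) ^+ 2 * a)); last by ring.
  by rewrite ler_wpM2l ?mulr_ge0// ltW.
(* For an integer m > f (T f), the choice n = 100 m would give 10000 m^2 < 100 m. *)
have := archi_boundP (positive_form_ge0 posT f : 0 <= f (T f)).
set m := Num.bound _ => fm; have := key (m * 100)%N; rewrite natrM.
have : 1 <= (m%:R : R).
  rewrite ler1n -(ltr0n R); apply: le_lt_trans fm.
  exact: (positive_form_ge0 posT).
by nra.
Qed.

End DualSeparation.

Lemma initial_segment (J : set nat) : (forall i j, (i <= j)%N -> J j -> J i) ->
  J = [set: nat] \/ exists n, J = `I_n.
Proof.
move=> Jle; have [JT|] := pselect (forall k, J k).
  by left; rewrite -subTset => k _.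
move=> /existsNP h.
have h' : exists n, ~~ `[< J n >] by have [n Jn] := h; exists n; apply/asboolPn.
right; exists (ex_minn h'); case: ex_minnP => n /asboolPn Jn nmin.
apply/seteqP; split => k /=.
  by move=> Jk; rewrite ltnNge; apply/negP => /Jle/(_ Jk).
move=> kn; apply: contrapT => Jk.
by have /nmin := introT (asboolPn _) Jk; rewrite leqNgt kn.
Qed.

(** * Gram-Schmidt for a semidefinite form *)

Section GramSchmidt.
Context {R : realType} {V : lmodType R}.
Variables (Q : V -> V -> R) (posQ : positive_form Q) (g : nat -> V).

Definition residual (s : seq V) v := v - \sum_(u <- s) Q v u *: u.

(** A vector is discarded when its residual is null for Q, even if the residual is not the zero
    vector. *)
Definition gram_schmidt_step (s : seq V) v := let r := residual s v in
  if Q r r == 0 then s else rcons s ((Num.sqrt (Q r r))^-1 *: r).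

Fixpoint gram_schmidt_seq n :=
  if n is m.+1 then gram_schmidt_step (gram_schmidt_seq m) (g m) else [::].

Local Notation gs := gram_schmidt_seq.

Definition orthonormal_seq (s : seq V) := forall i j, (i < size s)%N -> (j < size s)%N ->
  Q (nth 0 s i) (nth 0 s j) = (i == j)%:R.

Lemma residual_dot s v j : orthonormal_seq s -> (j < size s)%N ->
  Q (residual s v) (nth 0 s j) = 0.
Proof.
move=> os js; rewrite positive_formBl// (big_nth 0) big_mkord.
rewrite (eq_bigl (fun k : 'I_(size s) => (k : nat) \in `I_(size s))); last first.
  by move=> k; rewrite mem_set//=.
rewrite (orthonormal_dot posQ (J := `I_(size s)) os (fun k => Q v (nth 0 s k)))//.
by rewrite js subrr.
Qed.

Lemma gram_schmidt_step_orthonormal s v :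
  orthonormal_seq s -> orthonormal_seq (gram_schmidt_step s v).
Proof.
move=> os; rewrite /gram_schmidt_step; set r := residual s v.
case: eqVneq => // r0.
have rp : 0 < Q r r by rewrite lt_def r0 positive_form_ge0.
have rr : Q ((Num.sqrt (Q r r))^-1 *: r) ((Num.sqrt (Q r r))^-1 *: r) = 1.
  by rewrite positive_formZ// exprVn sqr_sqrtr ?ltW// mulVf.
have rs j : (j < size s)%N -> Q ((Num.sqrt (Q r r))^-1 *: r) (nth 0 s j) = 0.
  by move=> js; rewrite positive_formZl// residual_dot// mulr0.
move=> i j; rewrite size_rcons !ltnS !nth_rcons => si sj.
case: (ltnP i (size s)) => is_; case: (ltnP j (size s)) => js.
- exact: os.
- have -> : j = size s by apply/eqP; rewrite eqn_leq sj.
  by rewrite eqxx positive_formC// rs// ltn_eqF.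
- have -> : i = size s by apply/eqP; rewrite eqn_leq si.
  by rewrite eqxx rs// gtn_eqF.
- have -> : i = size s by apply/eqP; rewrite eqn_leq si.
  have -> : j = size s by apply/eqP; rewrite eqn_leq sj.
  by rewrite !eqxx.
Qed.

Lemma gram_schmidt_seq_orthonormal n : orthonormal_seq (gs n).
Proof. by elim: n => [//|n ih]; exact: gram_schmidt_step_orthonormal. Qed.

Lemma gram_schmidt_seq_prefix m n : (m <= n)%N -> prefix (gs m) (gs n).
Proof.
move=> /subnKC <-; elim: (n - m)%N => [|k ih]; first by rewrite addn0 prefix_refl.
rewrite addnS /= /gram_schmidt_step; case: ifP => // _.
by apply: prefix_trans ih _; exact: prefix_rcons.
Qed.

Lemma gram_schmidt_seq_nth m n k : (k < size (gs m))%N -> (k < size (gs n))%N ->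
  nth 0 (gs m) k = nth 0 (gs n) k.
Proof.
wlog mn : m n / (m <= n)%N => [hw|] km kn.
  by have [/hw|/ltnW/hw h] := leqP m n; [exact|apply/esym/h].
by have /prefixP[s ->] := gram_schmidt_seq_prefix mn; rewrite nth_cat km.
Qed.

(** The lists produced at successive stages are prefixes of one another, so their entries define a
    single family indexed by an initial segment [J]. Each g m lies in the span only modulo a vector
    z with Q z z = 0. *)
Lemma gram_schmidt : exists (J : set nat) (e : nat -> V),
  [/\ J = [set: nat] \/ (exists n, J = `I_n),
      forall i j, J i -> J j -> Q (e i) (e j) = (i == j)%:R,
      forall k, ~ J k -> e k = 0 &
      forall m, exists n (c : nat -> R),
        let z := g m - \sum_(k < n | (k : nat) \in J) c k *: e k in Q z z = 0].
Proof.
pose J := [set k | exists m, (k < size (gs m))%N].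
have /choice[e eP] : forall k, exists ek,
    (forall m, (k < size (gs m))%N -> ek = nth 0 (gs m) k) /\ (~ J k -> ek = 0).
  move=> k; have [[m km]|Jk] := pselect (J k).
    exists (nth 0 (gs m) k); split; last by case; exists m.
    by move=> n kn; exact: gram_schmidt_seq_nth.
  by exists 0; split => // m km; exfalso; apply: Jk; exists m.
have sumJ m (c : nat -> R) :
    \sum_(k < size (gs m) | (k : nat) \in J) c k *: e k =
    \sum_(k < size (gs m)) c k *: nth 0 (gs m) k.
  apply: eq_big => [k|k _]; first by rewrite mem_set//; exists m.
  by have [ek _] := eP k; rewrite (ek m).
exists J, e; split => [|i j [m im] [n jn]|k Jk|m].
- apply: initial_segment => i j ij [m jm]; exists m; exact: leq_ltn_trans jm.
- have iN : (i < size (gs (maxn m n)))%N.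
    exact: leq_trans im (size_prefix (gram_schmidt_seq_prefix (leq_maxl m n))).
  have jN : (j < size (gs (maxn m n)))%N.
    exact: leq_trans jn (size_prefix (gram_schmidt_seq_prefix (leq_maxr m n))).
  have [/(_ _ iN) -> _] := eP i; have [/(_ _ jN) -> _] := eP j.
  exact: gram_schmidt_seq_orthonormal.
- by have [_ ->] := eP k.
- pose r := residual (gs m) (g m).
  have [r0|r0] := eqVneq (Q r r) 0.
    pose c k := Q (g m) (nth 0 (gs m) k).
    exists (size (gs m)), c; rewrite sumJ /c -(big_mkord predT (fun k => Q (g m) (nth 0 (gs m) k) *: nth 0 (gs m) k)).
    by rewrite -(big_nth 0 predT (fun u => Q (g m) u *: u)).
  have gsS : gs m.+1 = rcons (gs m) ((Num.sqrt (Q r r))^-1 *: r).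
    by rewrite /= /gram_schmidt_step -/r (negbTE r0).
  have s0 : Num.sqrt (Q r r) != 0.
    by rewrite gt_eqF// sqrtr_gt0 lt_def r0 positive_form_ge0.
  pose c k := if (k < size (gs m))%N then Q (g m) (nth 0 (gs m) k)
    else Num.sqrt (Q r r).
  exists (size (gs m.+1)), c; rewrite sumJ gsS /c size_rcons big_ord_recr/= ltnn nth_rcons ltnn eqxx.
  rewrite scalerA mulfV// scale1r.
  rewrite (_ : \sum_(i < _) _ = \sum_(u <- gs m) Q (g m) u *: u).
    by rewrite opprD addrA -/(residual _ _) -/r subrr positive_form0l.
  rewrite (big_nth 0) big_mkord; apply: eq_bigr => k _.
  by rewrite nth_rcons ltn_ord.
Qed.

End GramSchmidt.

(** * Factorization through l^2 and Parseval's identity *)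

Section CovarianceFactorization.
Context {R : realType} {U : completeNormedModType R}.
Implicit Types (u v w : dual U).

(* Parseval's identity holds because the limit of T applied to the residuals is
   annihilated by the separating family g. *)
Lemma covariance_factorization (T : dual U -> U) : separable U ->
  positive_form (fun u v => v (T u)) ->
  exists (J : set nat) (e : nat -> dual U) (f : {linear @ell2 R J -> U}),
  [/\ J = [set: nat] \/ (exists n, J = `I_n),
      forall i j, J i -> J j -> e j (T (e i)) = (i == j)%:R,
      continuous f, forall k, J k -> f (@ell2_unit R J k) = T (e k) &
      forall v, \sum_(k < n | (k : nat) \in J) v (T (e k)) ^+ 2 @[n --> \oo] --> v (T v)].
Proof.
move=> sepU posT; pose Q u v := v (T u).
have {}posT : positive_form Q by [].
have [g gsep] := countable_separating_functionals sepU.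
have [J [e [Jinit eo eoff gJ]]] := gram_schmidt posT g.
have [C TC] := positive_covariance_bounded posT.
(* [T] is given as a mere function. Linearity of the form in its first argument, tested against all
   functionals, makes it linear. *)
have TD u v a : T (a *: u + v) = a *: T u + T v.
  apply/eqP; rewrite -subr_eq0; apply/eqP/dual_separates => w.
  rewrite dualB dualD dualZ -![w (T _)]/(Q _ w).
  by rewrite positive_formDl// positive_formZl// subrr.
have TB u v : T (u - v) = T u - T v.
  by rewrite [u - v]addrC -scaleN1r TD scaleN1r addrC.
have T0 : T 0 = 0.
  by apply: dual_separates => w; rewrite -[LHS]/(Q 0 w) positive_form0l.
have Tsum (I : Type) (r : seq I) (p : pred I) (c : I -> R) (w : I -> dual U) :
    T (\sum_(k <- r | p k) c k *: w k) = \sum_(k <- r | p k) c k *: T (w k).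
  apply: (big_rec2 (fun x y => T x = y)) => // k y x _ <-.
  by rewrite TD.
(* [C] comes without a sign; its absolute value allows the bound on the form to be multiplied
   through. *)
have TC' m n (c : nat -> R) : `|\sum_(m <= k < n) c k *: T (e k)| ^+ 2 <=
    `|C| * \sum_(m <= k < n) c k ^+ 2.
  rewrite -Tsum (le_trans (TC _))//; set s := \sum_(m <= k < n) c k *: e k.
  apply: (@le_trans _ _ (`|C| * Q s s)).
    by rewrite ler_wpM2r ?ler_norm// (positive_form_ge0 posT).
  by rewrite ler_wpM2l//; exact: (orthonormal_interval posT eo m n c eoff).
have [f [fcont fe]] := ell2_operator J TC'.
exists J, e, f; split => // v.
pose c k : R^o := if k \in J then Q v (e k) else 0.
have cJ k : J k -> c k = Q v (e k) by move=> Jk; rewrite /c mem_set.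
have Bessel n : \sum_(k < n | (k : nat) \in J) Q v (e k) ^+ 2 <= Q v v.
  rewrite -subr_ge0; move: (orthonormal_residual posT eo v n) => /= <-.
  exact: (positive_form_ge0 posT (_ - _)).
have cE : c \in @ell2_pred R J.
  rewrite inE; split => [k Jk|]; first by rewrite /c memNset.
  exists (Q v v) => n; apply: le_trans (Bessel n).
  rewrite [leRHS]big_mkcond; apply: ler_sum => k _.
  by rewrite /c; case: ((k : nat) \in J); rewrite // expr0n.
pose w n := v - \sum_(k < n | (k : nat) \in J) Q v (e k) *: e k.
pose y := T v - f (Ell2 cE).
(* The coefficients Q v (e k) are square-summable by Bessel's inequality, so T of the partial sums
   is [f] of a convergent sequence in l^2. This gives convergence of T (w n) in norm before anything
   is known about Q (w n) (w n). *)
have Tw : T (w n) @[n --> \oo] --> y.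
  have -> : (fun n => T (w n)) = (fun n => T v -
      f (\sum_(k < n | (k : nat) \in J) c k *: @ell2_unit R J k)).
    apply/funext => n; rewrite /w TB Tsum [f _]linear_sum.
    congr (_ - _); apply: eq_bigr => k kJ.
    by rewrite linearZ fe ?cJ//; exact: set_mem kJ.
  apply: cvgB; first exact: cvg_cst.
  by apply: continuous_cvg; [exact: fcont|exact: (@ell2_expansion R J (Ell2 cE))].
have we n j : J j -> (j < n)%N -> Q (w n) (e j) = 0.
  move=> Jj jn; rewrite positive_formBl//.
  by rewrite (orthonormal_dot posT eo (fun k => Q v (e k)))// jn subrr.
have y0 : y = 0.
  apply: gsep => m; have [N [b zz']] := gJ m.
  pose z := g m - \sum_(k < N | (k : nat) \in J) b k *: e k.
  have zz : Q z z = 0 := zz'.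
  (* For n >= N the residual [w n] is orthogonal to all the e k used to approximate g m, and to the
     null vector z by Cauchy-Schwarz. *)
  have gmE n : (N <= n)%N -> g m (T (w n)) = 0.
    move=> Nn; rewrite -[LHS]/(Q (w n) (g m)).
    rewrite -[g m](subrK (\sum_(k < N | (k : nat) \in J) b k *: e k)) positive_formDr//.
    rewrite -/z [X in X + _](_ : _ = 0) ?add0r; last first.
      apply/eqP; rewrite -sqrf_eq0 eq_le sqr_ge0 andbT.
      by have := positive_form_Cauchy posT (w n) z; rewrite zz mulr0.
    rewrite positive_form_sumr// big1// => k kJ.
    rewrite positive_formZr// we ?mulr0//; first exact: set_mem.
    exact: leq_trans Nn.
  apply: (@cvg_unique _ _ (g m (T (w n)) @[n --> \oo])) => //.
    by apply: continuous_cvg; [exact: dual_continuous|exact: Tw].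
  by apply: cvg_near_cst; exists N.
(* [w n] is orthogonal to the sum subtracted from [v], so the quadratic quantity equals a continuous
   functional of T (w n) and tends to v y = 0. *)
have wv n : Q (w n) (w n) = v (T (w n)).
  rewrite -[RHS]/(Q (w n) v) [X in Q _ X = _]/(w n) positive_formBr//.
  rewrite positive_form_sumr// big1 ?subr0// => k kJ.
  by rewrite positive_formZr// we ?mulr0//; exact: set_mem kJ.
have ww : Q (w n) (w n) @[n --> \oo] --> (0 : R).
  under eq_cvg do rewrite wv.
  have : v (T (w n)) @[n --> \oo] --> v y.
    by apply: continuous_cvg; [exact: dual_continuous|exact: Tw].
  by rewrite y0 dual0.
have -> : (fun n => \sum_(k < n | (k : nat) \in J) v (T (e k)) ^+ 2) =
    (fun n => Q v v - Q (w n) (w n)).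
  apply/funext => n; have /= -> := orthonormal_residual posT eo v n.
  rewrite opprB addrC subrK; apply: eq_bigr => k _.
  by rewrite (positive_formC posT v).
rewrite -[v (T v)]subr0; apply: cvgB ww; exact: cvg_cst.
Qed.

End CovarianceFactorization.

(** * Covariance in time *)

Section TimeCovariance.
Context {R : realType} d {Omega : measurableType d} (P : probability Omega R).
Local Notation E f := (Rintegral P setT f).
Local Notation L0 := {mfun_ P, Omega >-> R}.
Context {U : completeNormedModType R} (W : R -> dual U -> L0).
Context (Q : dual U -> dual U -> R).
Hypotheses (posQ : positive_form Q) (cylW : cylindrical_process W)
  (incW : gaussian_increments W (fun u => Q u u))
  (W0 : forall u, W 0 u = cst 0 %[ae P]).
Implicit Types (l : seq (R * dual U)) (s : R) (Phi : R -> R -> dual U -> R).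

Let le_time (p r : R * dual U) := p.1 <= r.1.

Let le_time_trans : transitive le_time.
Proof. by move=> p q r; exact: le_trans. Qed.

Definition total_vector l : dual U := \sum_(p <- l) p.2.

(** Summation by parts along a list of times and vectors: on each interval between successive times,
    [Phi] receives the sum of all vectors whose time is still to come. One recursion serves for the
    increments of [W] and for their variances. *)
Fixpoint abel_sum Phi s l : R := if l is p :: l' then
  Phi s p.1 (total_vector l) + abel_sum Phi p.1 l' else 0.

(** The default value continues the grid by its last point, since [gaussian_increments] takes an
    infinite nondecreasing sequence. *)
Let times s l k := let r := [seq p.1 | p <- l] in nth (last s r) (s :: r) k.

Lemma abel_sum_ord Phi s l : abel_sum Phi s l =
  \sum_(k < size l) Phi (times s l k) (times s l k.+1) (total_vector (drop k l)).
Proof.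
elim: l s => [|p l ih] s; first by rewrite big_ord0.
by rewrite /= big_ord_recl /= ih.
Qed.

Lemma times_mono s l k : path le_time (s, 0) l -> times s l k <= times s l k.+1.
Proof.
elim: l s k => [|p l ih] s [|k] //=; first by rewrite /times /= nth_nil.
  by move=> /andP[].
move=> /andP[_ pl]; have := ih p.1 k; rewrite /times /=; apply.
by case: l pl {ih}.
Qed.

(** The Brownian covariance restarted at time s: the variance of the sum of W(p.1) p.2 - W(s) p.2
    over p in l, when s is below all times. *)
Definition time_covariance s l : R :=
  \sum_(p <- l) \sum_(r <- l) (Num.min p.1 r.1 - s) * Q p.2 r.2.

Lemma time_covariance_shift s t l : time_covariance s l =
  (t - s) * Q (total_vector l) (total_vector l) + time_covariance t l.
Proof.
have -> : Q (total_vector l) (total_vector l) = \sum_(p <- l) \sum_(r <- l) Q p.2 r.2.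
  by rewrite positive_form_suml//; apply: eq_bigr => p _; rewrite positive_form_sumr.
rewrite mulr_sumr -big_split; apply: eq_bigr => p _ /=.
rewrite mulr_sumr -big_split; apply: eq_bigr => r _ /=.
by ring.
Qed.

(** Restarting at the earliest time p.1 splits off exactly the first term of [abel_sum]; afterwards
    every pair involving p contributes 0, because its minimum is p.1. *)
Lemma abel_variance s l : sorted le_time l ->
  abel_sum (fun s t v => (t - s) * Q v v) s l = time_covariance s l.
Proof.
elim: l s => [|p l ih] s pl; first by rewrite /time_covariance big_nil.
rewrite /= ih ?(path_sorted pl)// (time_covariance_shift s p.1); congr (_ + _).
have lep r : r \in l -> p.1 <= r.1.
  by have /allP := order_path_min le_time_trans pl; apply.
rewrite /time_covariance [RHS]big_cons [X in _ = X + _]big1_seq => [|r /andP[_]].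
  rewrite add0r; apply: eq_big_seq => r rl; rewrite big_cons.
  by rewrite min_r ?lep// subrr mul0r add0r.
rewrite inE => /predU1P[->|/lep pr]; first by rewrite minxx subrr mul0r.
by rewrite min_l// subrr mul0r.
Qed.

Lemma abel_sum_process s l : 0 <= s -> {in l, forall p, 0 <= p.1} ->
  \forall x \ae P, abel_sum (fun s t v => W t v x - W s v x) s l =
    \sum_(p <- l) (W p.1 p.2 x - W s p.2 x).
Proof.
elim: l s => [|p l ih] s s0 l0; first by apply/aeW => x; rewrite big_nil.
have p0 : 0 <= p.1 by apply: l0; rewrite mem_head.
have l0' : {in l, forall r, 0 <= r.1} by move=> r rl; apply: l0; rewrite inE rl orbT.
have := ih _ p0 l0'.
have := cylindrical_incr_sum cylW (p :: l) (fun=> 1) snd s0 p0.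
apply: filterS2 => x; under [X in W _ X _]eq_bigr do rewrite scale1r.
under [X in _ - W _ X _]eq_bigr do rewrite scale1r.
rewrite /= -/(total_vector (p :: l)) => <- ->.
rewrite !big_cons mul1r -addrA -big_split; congr (_ + _).
by apply: eq_bigr => r _ /=; rewrite mul1r; ring.
Qed.

Lemma measurable_time_sum (I : Type) (r : seq I) (t : I -> R) (u : I -> dual U) :
  measurable_fun setT (fun x => \sum_(i <- r) (W (t i) (u i) x : R)).
Proof. by apply: measurable_sum => i; exact: measurable_L0. Qed.

(** Both sides are invariant under permutations of [l], so the times may be sorted; summation by
    parts then expresses the sum by successive increments. *)
Lemma time_fourier l b : {in l, forall p, 0 <= p.1} ->
  E (fun x => cos (\sum_(p <- l) W p.1 p.2 x + b)) =
  cos b * expR (- (time_covariance 0 l / 2)).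
Proof.
wlog sl : l / sorted le_time l => [hw l0|l0].
  have pl : perm_eq (sort le_time l) l by rewrite perm_sort.
  have ts : time_covariance 0 l = time_covariance 0 (sort le_time l).
    rewrite /time_covariance (perm_big _ pl); apply: eq_bigr => p _.
    by rewrite (perm_big _ pl).
  rewrite ts -hw; first by under [RHS]eq_Rintegral do rewrite (perm_big _ pl).
    by apply: sort_sorted => p r; exact: le_total.
  by move=> p; rewrite mem_sort; exact: l0.
have pl : path le_time (0, 0) l.
  by case: l sl l0 => //= p l -> l0; rewrite andbT; apply: l0; exact: mem_head.
rewrite -abel_variance// abel_sum_ord.
transitivity (E (fun x => cos (\sum_(k < size l)
    (W (times 0 l k.+1) (total_vector (drop k l)) x -
     W (times 0 l k) (total_vector (drop k l)) x) + b))).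
  apply: ae_eq_Exp_cos.
  - exact: measurable_time_sum.
  - by apply: measurable_sum => k; apply: measurable_funB; exact: measurable_L0.
  - have W0l : \forall x \ae P, {in l, forall p, W 0 p.2 x = 0}.
      elim: l {l0 sl pl} => [|p l ih]; first exact/aeW.
      move: (W0 p.2) ih; apply: filterS2 => x px lx r.
      by rewrite inE => /predU1P[->|/lx//]; exact: px.
    move: (abel_sum_process (lexx 0) l0) W0l; apply: filterS2 => x lx W0x _.
    rewrite -(abel_sum_ord (fun s t v => W t v x - W s v x)) lx.
    by apply: eq_big_seq => p /W0x ->; rewrite subr0.
have := @incW (size l) (times 0 l) (fun k => total_vector (drop k l))
  (index_enum 'I_(size l)) b.
rewrite /times /= => ->//; last 2 first.
- by move=> k; exact: times_mono.
- exact: index_enum_uniq.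
by rewrite -expR_sum sumrN mulr_suml.
Qed.

(** By [time_fourier] the transform of any finite combination of values is governed by a double sum
    of covariances. Pairs from different processes carry the factor Q (u k) (u j) = 0, so the
    exponential factorizes over the processes. *)
Lemma orthogonal_processes_independent (J : set nat) (u : nat -> dual U) :
  (forall i j, J i -> J j -> i != j -> Q (u i) (u j) = 0) ->
  independent_processes J (fun k t => W t (u k)).
Proof.
move=> uo.
(* The absolute value gives a family indexed by all reals that coincides with the process for t >=
   0, so that nothing is asked of [W] at negative times. *)
pose X (k : nat) (t : R) : Omega -> R := W `|t| (u k).
have mX k t : measurable_fun setT (X k t) by exact: measurable_L0.
pose L k (a : seq (R * R)) : seq (R * dual U) := [seq (`|p.1|, p.2 *: u k) | p <- a].
have L0 k a : {in L k a, forall p, 0 <= p.1} by move=> p /mapP[r _ ->] /=.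
have LE k a : \forall x \ae P, lincomb (X k) a x = \sum_(p <- L k a) W p.1 p.2 x.
  elim: a => [|p a ih]; first by apply/aeW => x; rewrite /lincomb !big_nil.
  have := cylW (normr_ge0 p.1) p.2 (u k) 0; rewrite addr0.
  move: (cylindrical0 cylW (normr_ge0 p.1)) ih.
  apply: filterS3 => x /(_ Logic.I) /= z ih /(_ Logic.I) h.
  by rewrite lincomb_cons ih big_cons h z addr0.
have Xfourier k a b : E (fun x => cos (lincomb (X k) a x + b)) =
    cos b * expR (- (time_covariance 0 (L k a) / 2)).
  rewrite -time_fourier//; apply: ae_eq_Exp_cos.
  - exact: measurable_lincomb.
  - exact: measurable_time_sum.
  - by have := LE k a; apply: filterS => x h _.
have indX : independent_systems P J (fun k => coordinate_algebra (X k)).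
  apply: independent_of_fourier => // s us sJ a b.
  pose G := flatten [seq L k (a k) | k <- s].
  transitivity (E (fun x => cos (\sum_(p <- G) W p.1 p.2 x + b))).
    apply: ae_eq_Exp_cos.
    - by apply: measurable_sum => k; exact: measurable_lincomb.
    - exact: measurable_time_sum.
    - have : \forall x \ae P, \sum_(k <- s) lincomb (X k) (a k) x =
          \sum_(p <- G) W p.1 p.2 x.
        rewrite /G; elim: s {us sJ G} => [|k s ih].
          by apply/aeW => x; rewrite !big_nil.
        move: (LE k (a k)) ih; apply: filterS2 => x h ih.
        by rewrite big_cons ih h /= big_cat.
      by apply: filterS => x h _.
  rewrite time_fourier; last first.
    by move=> p /flattenP[r /mapP[k _ ->]]; exact: L0.
  congr (_ * _); under eq_bigr => k _ do under eq_Rintegral do rewrite -[X in cos X]addr0.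
  under eq_bigr do rewrite Xfourier cos0 mul1r.
  rewrite -expR_sum; congr expR; rewrite sumrN -mulr_suml; congr (- (_ / 2)).
  rewrite /time_covariance big_flatten big_map; apply: eq_big_seq => k ks.
  apply: eq_big_seq => p /mapP[p' _ ->] /=.
  rewrite big_flatten big_map (bigD1_seq k)//= [X in _ + X]big1_seq ?addr0// => j /andP[jk js].
  apply: big1_seq => r /andP[_ /mapP[r' _ ->]] /=.
  rewrite (positive_formZl posQ) (positive_formZr posQ).
  have kj : Q (u k) (u j) = 0 by apply: uo; [exact: sJ|exact: sJ|rewrite eq_sym].
  by rewrite kj !mulr0.
move=> s us sJ A As; apply: (indX s us sJ A) => k ks; have := As k ks.
apply: sub_sigma_algebra2 => D [t t0 BD]; exists t => //.
by rewrite /X ger0_norm.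
Qed.

Lemma gaussian_second_moment t u : 0 <= t ->
  P.-integrable setT (EFin \o (fun x => W t u x ^+ 2)) /\
  E (fun x => W t u x ^+ 2) = t * Q u u.
Proof.
move=> t0; apply: fourier_second_moment.
- exact: measurable_L0.
- by rewrite mulr_ge0// positive_form_ge0.
- move=> r; have l0 : {in [:: (t, r *: u)], forall p, 0 <= p.1}.
    by move=> p; rewrite inE => /eqP ->.
  have := time_fourier 0 l0; rewrite cos0 mul1r.
  rewrite /time_covariance !big_seq1 /= minxx subr0 (positive_formZ posQ) mulrCA => <-.
  under eq_Rintegral do rewrite -[X in cos X]addr0.
  apply: ae_eq_Exp_cos.
  + by apply: measurable_funM => //; exact: measurable_L0.
  + exact: measurable_time_sum.
  + have := cylW t0 r u 0; rewrite addr0; move: (cylindrical0 cylW t0).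
    apply: filterS2 => x /(_ Logic.I) /= z /(_ Logic.I) h _.
    by rewrite big_seq1 h z !addr0.
Qed.

(** Polarization from the second moments at u + v and v - u, which also supplies integrability of
    the product. *)
Lemma gaussian_covariance u v : covariance_operator (W 1) u v = (Q u v)%:E.
Proof.
have [iD eD] := gaussian_second_moment (u + v) ler01.
have [iB eB] := gaussian_second_moment (- u + v) ler01.
rewrite /covariance_operator expectation.unlock.
pose g x := 4^-1 * (W 1 (u + v) x ^+ 2 - W 1 (- u + v) x ^+ 2).
have ig : P.-integrable setT (EFin \o g).
  have := integrableZl measurableT 4^-1 (integrableB measurableT iD iB).
  by [].
transitivity (\int[P]_x (EFin \o g) x)%E.
  apply: ae_eq_integral => //.
  - by apply/measurable_EFinP; apply: measurable_funM; exact: measurable_L0.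
  - exact: measurable_int ig.
  - have := cylW ler01 1 u v; have := cylW ler01 (-1) u v.
    rewrite scale1r scaleN1r; apply: filterS2 => x /(_ Logic.I) hB /(_ Logic.I) hD _.
    by rewrite /g /= hB hD; congr EFin; field.
rewrite -[LHS]fineK; last exact: integrable_fin_num.
congr EFin; rewrite -[LHS]/(E g) /g.
rewrite RintegralZl//; last exact: (integrableB measurableT iD iB).
rewrite RintegralB// eD eB !mul1r.
rewrite -(scaleN1r u) !(positive_formDl posQ, positive_formDr posQ).
rewrite !(positive_formZl posQ, positive_formZr posQ) (positive_formC posQ v u).
by field.
Qed.

End TimeCovariance.

(** * From the Wiener process to the expansion *)

Section CylindricalExpansion.
Context {R : realType} d {Omega : measurableType d} (P : probability Omega R).
Local Notation L0 := {mfun_ P, Omega >-> R}.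
Context {U : completeNormedModType R} (F : R -> set (set Omega))
        (W : R -> dual U -> L0).

(** Since v (T u) is linear in v by definition, linearity in u follows from the symmetry of the
    covariance, with no expectation of a sum to expand. *)
Lemma covariance_positive_form (X : dual U -> L0) (T : dual U -> U) :
  (forall u v : dual U, covariance_operator X u v = (v (T u))%:E) ->
  positive_form (fun u v : dual U => v (T u)).
Proof.
move=> XT.
have TC (u v : dual U) : v (T u) = u (T v).
  apply: EFin_inj; rewrite -!XT /covariance_operator; congr expectation.
  by apply/funext => x; rewrite mulrC.
split=> // [a u v w|u]; first by rewrite TC dual_combE !(TC w).
rewrite -lee_fin -XT /covariance_operator expectation.unlock.
by apply: integral_ge0 => x _; rewrite lee_fin -expr2 sqr_ge0.
Qed.

Lemma weakly_standard_wiener (q : dual U -> R) u : weakly_cylindrical_wiener F W ->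
  (forall v, covariance_operator (W 1) v v = (q v)%:E) -> q u = 1 ->
  standard_real_wiener F (fun t => W t u).
Proof.
move=> wW qW qu; have [_ _ /(_ 1%N (fun=> u))[C [_ C0 wC]]] := wW.
suff C1 : C = 1%:M by rewrite /standard_real_wiener -C1.
apply/matrixP => i j; rewrite !ord1 mxE eqxx.
by rewrite (weakly_cylindrical_variance wW qW wC C0).
Qed.

Lemma weakly_cylindrical_start : weakly_cylindrical_wiener F W ->
  forall u, W 0 u = cst 0 %[ae P].
Proof.
move=> [_ _ h] u; have [C [_ _ wC]] := h 1%N (fun=> u).
exact: (wiener_start wC ord0).
Qed.

(** The error of the n-th partial sum is almost surely W t (w n), where w n is the residual of u;
    its second moment is t Q (w n) (w n), that is, t times the defect in Parseval's identity. *)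
Lemma strongly_cylindrical_expansion : separable U ->
  strongly_cylindrical_wiener F W ->
  exists (H : completeNormedModType R) (ip : {dot H for idfun})
         (J : set nat) (e : nat -> H) (f : {linear H -> U})
         (B : nat -> R -> L0),
    [/\ hilbert_norm ip, orthonormal_basis ip J e, continuous f,
        (forall k, J k -> standard_real_wiener F (B k)) /\
        independent_processes J B &
        forall (t : R) (u : dual U), 0 <= t ->
          L2_cvg P
            (fun n w => \sum_(k < n | (k : nat) \in J) u (f (e k)) * B k t w)
            (W t u)].
Proof.
move=> sepU [wW /choice[T WT]]; have [cylW _ _] := wW.
have posT := covariance_positive_form WT.
have [J [e [f [Jinit eo fcont fe eT]]]] := covariance_factorization sepU posT.
have incW := weakly_gaussian_increments wW (fun u => WT u u).
have W0 := weakly_cylindrical_start wW.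
exists (ell2 J), (@ell2_dot R J : {dot ell2 J for idfun}), J, (@ell2_unit R J), f,
  (fun k t => W t (e k)).
split.
- exact: ell2_hilbert_norm.
- exact: ell2_orthonormal_basis.
- exact: fcont.
- split => [k Jk|].
    by apply: (weakly_standard_wiener wW (fun u => WT u u)); rewrite eo// eqxx.
  apply: (orthogonal_processes_independent posT cylW incW W0) => i j Ji Jj ij.
  by rewrite eo// (negbTE ij).
move=> t u t0; apply/L2_cvgP.
pose Q (u v : dual U) : R := v (T u); have posQ : positive_form Q := posT.
pose w n := u - \sum_(k < n | (k : nat) \in J) Q u (e k) *: e k.
have Ww n : \forall x \ae P, W t (w n) x =
    W t u x - \sum_(k < n | (k : nat) \in J) u (f (ell2_unit J k)) * W t (e k) x.
  pose r := [seq k : 'I_n <- index_enum 'I_n | (k : nat) \in J].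
  have -> : w n = -1 *: (\sum_(k <- r) Q u (e k) *: e k) + u.
    by rewrite scaleN1r addrC big_filter.
  move: (cylindrical_sum cylW r (fun k : 'I_n => Q u (e k)) (fun k : 'I_n => e k) t0).
  move: (cylW _ t0 (-1) (\sum_(k <- r) Q u (e k) *: e k) u).
  apply: filterS2 => x /(_ Logic.I) -> /(_ Logic.I) ->.
  rewrite mulN1r addrC -[in RHS]big_filter -/r.
  congr (_ - _); apply: eq_big_seq => k; rewrite mem_filter => /andP[/set_mem Jk _].
  by rewrite fe// -[u (T _)]/(Q (e k) u) (positive_formC posQ).
have WE n : (\int[P]_x ((W t u x -
    \sum_(k < n | (k : nat) \in J) u (f (ell2_unit J k)) * W t (e k) x) ^+ 2)%:E =
    (t * Q (w n) (w n))%:E)%E.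
  have [iw <-] := gaussian_second_moment posT cylW incW W0 (w n) t0.
  rewrite /Rintegral fineK; last exact: integrable_fin_num.
  apply: ae_eq_integral => //.
  - apply/measurable_EFinP; apply: measurable_funX; apply: measurable_funB.
      exact: measurable_L0.
    under eq_fun do rewrite -big_filter.
    apply: measurable_sum => k; apply: measurable_funM => //; exact: measurable_L0.
  - exact: measurable_int iw.
  - by have := Ww n; apply: filterS => x h _ /=; rewrite h.
rewrite /mean_square_null; under eq_cvg do rewrite WE.
have wn : Q (w n) (w n) @[n --> \oo] --> (0 : R).
  have -> : (fun n => Q (w n) (w n)) =
      (fun n => Q u u - \sum_(k < n | (k : nat) \in J) u (T (e k)) ^+ 2).
    apply/funext => n; rewrite (orthonormal_residual posQ eo u n); congr (_ - _).
    by apply: eq_bigr => k _; rewrite (positive_formC posQ).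
  rewrite -[X in _ --> X](subrr (Q u u)); apply: cvgB; [exact: cvg_cst|exact: eT].
apply: cvg_EFin; first exact: nearW.
by rewrite -[X in _ --> X](mulr0 t); apply: cvgMr.
Qed.

End CylindricalExpansion.

(** * From the expansion to the Wiener process *)

Section ExpansionIsCylindricalWiener.
Context {R : realType} d {Omega : measurableType d} (P : probability Omega R).
Local Notation L0 := {mfun_ P, Omega >-> R}.

Lemma dot_positive_form (H : completeNormedModType R) (ip : {dot H for idfun}) :
  hilbert_norm ip -> positive_form ip.
Proof.
move=> nH; split => [a u v w|u v|u]; last by rewrite nH sqr_ge0.
  by rewrite linearDl linearZl_LR.
by rewrite hermC mul1r.
Qed.

Context {U : completeNormedModType R}.

(* Bessel's inequality makes u composed with f an element of ell2, and ell2
   maps back to H through the orthonormal basis. *)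
Lemma expansion_covariance (H : completeNormedModType R) (ip : {dot H for idfun})
    (J : set nat) (e : nat -> H) (f : {linear H -> U}) :
  hilbert_norm ip -> orthonormal_basis ip J e -> continuous f ->
  exists T : dual U -> U, positive_form (fun u v : dual U => v (T u)) /\
    forall u : dual U, \sum_(k < n | (k : nat) \in J) u (f (e k)) ^+ 2 @[n --> \oo] -->
      u (T u).
Proof.
move=> nH [_ eo _] fcont; have posH := dot_positive_form nH.
(* Off [J] the vectors e k are arbitrary; replacing them by 0 gives the bound of [ell2_operator] on
   all intervals. *)
pose e' k := if k \in J then e k else 0.
have e'E k : J k -> e' k = e k by move=> Jk; rewrite /e' mem_set.
have e'off k : ~ J k -> e' k = 0 by move=> Jk; rewrite /e' memNset.
have eo' i j : J i -> J j -> ip (e' i) (e' j) = (i == j)%:R.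
  by move=> Ji Jj; rewrite !e'E//; exact: eo.
have [g [gcont ge]] : exists g : {linear @ell2 R J -> H}, continuous g /\
    forall k, J k -> g (ell2_unit J k) = e' k.
  apply: (ell2_operator J (C := 1)) => m n c.
  by rewrite -nH mul1r; exact: (orthonormal_interval posH eo' m n c e'off).
pose c (u : dual U) k : R^o := if k \in J then u (f (e k)) else 0.
have Bessel (u : dual U) : exists M : R, forall n, \sum_(k < n) c u k ^+ 2 <= M.
  have ucont : {for 0, continuous (fun x => u (f x) : R^o)}.
    by apply: continuous_comp; [exact: fcont|exact: dual_continuous].
  have [r r0 hr] : exists2 r, 0 < r & forall x : H, `|x| < r -> `|u (f x)| < 1.
    have : \forall x \near (0 : H), `|u (f x)| < 1.
      have /cvgr0_norm_lt : u (f x) @[x --> (0 : H)] --> (0 : R).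
        by rewrite -[X in _ --> X](dual0 u) -(linear0 f); exact: ucont.
      by apply; exact: ltr01.
    move=> /nbhs_normP[r /= r0 h]; exists r => // x xr; apply: h.
    by rewrite /ball_/= sub0r normrN.
  (* The vector S = sum of c u k e' k satisfies |S|^2 = s = u (f S). Rescaled to norm r / 2 it lies
     in the ball where |u (f x)| < 1, so r |S| / 2 < 1 and s < 4 / r^2. *)
  exists (4 / r ^+ 2) => n; set s := \sum_(k < n) c u k ^+ 2.
  pose S := \sum_(k < n) c u k *: e' k.
  have SJ : S = \sum_(k < n | (k : nat) \in J) c u k *: e' k.
    rewrite [RHS]big_mkcond; apply: eq_bigr => k _ /=.
    by rewrite /c; case: ((k : nat) \in J); rewrite // scale0r.
  have sJ : s = \sum_(k < n | (k : nat) \in J) c u k * c u k.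
    rewrite [RHS]big_mkcond; apply: eq_bigr => k _ /=.
    by rewrite /c; case: ((k : nat) \in J); rewrite ?expr0n// expr2.
  have S2 : `|S| ^+ 2 = s by rewrite -nH SJ sJ (orthonormal_dot_sum posH eo' (c u) (c u)).
  have uS : u (f S) = s.
    rewrite /S linear_sum (big_morph u (dualD u) (dual0 u)); apply: eq_bigr => k _.
    rewrite linearZ dualZ /c /e'; case: ((k : nat) \in J); last by rewrite mul0r expr0n.
    by rewrite expr2.
  have [S0|S0] := eqVneq S 0.
    by rewrite -S2 S0 normr0 expr0n divr_ge0// sqr_ge0.
  have Sp : 0 < `|S| by rewrite normr_gt0.
  have rS : 0 < r / (2 * `|S|) by rewrite divr_gt0// mulr_gt0.
  have := hr (r / (2 * `|S|) *: S); rewrite linearZ dualZ uS -S2 normrZ.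
  rewrite (gtr0_norm rS) normrM (gtr0_norm rS) (ger0_norm (sqr_ge0 _)).
  have -> : r / (2 * `|S|) * `|S| = r / 2 by field; rewrite gt_eqF.
  have -> : r / (2 * `|S|) * `|S| ^+ 2 = r * `|S| / 2 by field; rewrite gt_eqF.
  rewrite ltr_pdivrMr// ltr_pdivrMr// ler_pdivlMr ?exprn_gt0//.
  have : r < r * 2 by lra.
  move=> rr /(_ rr) h; have : 0 < r * `|S| by rewrite mulr_gt0.
  by nra.
have cE (u : dual U) : c u \in @ell2_pred R J.
  by rewrite inE; split => [k Jk|]; [rewrite /c memNset|exact: Bessel].
pose a u := Ell2 (cE u); pose T u := f (g (a u)).
(* In l^2 the functional v o f o g is the scalar product with [a v]: both are continuous and agree
   on the unit vectors. Positivity of the form and the limit of the sums of squares are then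
   properties of [ell2_dot]. *)
have TE (u v : dual U) : v (T u) = ell2_dot (a u) (a v).
  apply/esym/cvg_lim => //.
  have -> : (fun n => \sum_(k < n) a u k * a v k : R) = (fun n =>
      v (f (g (\sum_(k < n | (k : nat) \in J) a u k *: ell2_unit J k)))).
    apply/funext => n; apply/esym.
    rewrite !linear_sum (big_morph v (dualD v) (dual0 v)) [LHS]big_mkcond.
    apply: eq_bigr => k _ /=; have [Jk|Jk] := boolP ((k : nat) \in J); last first.
      by rewrite {1}/c (negbTE Jk) mul0r.
    have Jk' : J k by exact: set_mem Jk.
    by rewrite !linearZ dualZ ge// e'E//; congr (_ * _); rewrite /= /c Jk.
  apply: continuous_cvg; first exact: dual_continuous.
  apply: continuous_cvg; first exact: fcont.
  by apply: continuous_cvg; [exact: gcont|exact: (@ell2_expansion R J (a u))].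
have aD r (u v : dual U) : a (r *: u + v) = r *: a u + a v.
  apply: ell2_ext => k; rewrite ell2_linE /= /c.
  by case: (k \in J); rewrite ?mulr0 ?addr0// dual_combE.
exists T; split.
  have [DD DC D0] := @ell2_dot_positive R J.
  by split => [r u v w|u v|u]; rewrite !TE ?aD; [exact: DD|exact: DC|exact: D0].
move=> u; rewrite TE.
have -> : (fun n => \sum_(k < n | (k : nat) \in J) u (f (e k)) ^+ 2) =
    (fun n => \sum_(k < n) a u k * a u k).
  apply/funext => n; rewrite [LHS]big_mkcond; apply: eq_bigr => k _ /=.
  by rewrite /c; case: ((k : nat) \in J); rewrite ?mul0r// expr2.
exact: ell2_dot_cvg.
Qed.

Lemma expansion_strongly_cylindrical (F : R -> set (set Omega)) (W : R -> dual U -> L0)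
    (H : completeNormedModType R) (ip : {dot H for idfun}) (J : set nat)
    (e : nat -> H) (f : {linear H -> U}) (B : nat -> R -> L0) :
  cylindrical_process W -> adapted F W ->
  hilbert_norm ip -> orthonormal_basis ip J e -> continuous f ->
  (forall k, J k -> standard_real_wiener F (B k)) -> independent_processes J B ->
  (forall (t : R) (u : dual U), 0 <= t -> L2_cvg P
    (fun n w => \sum_(k < n | (k : nat) \in J) u (f (e k)) * B k t w) (W t u)) ->
  strongly_cylindrical_wiener F W.
Proof.
move=> cylW adW nH be fcont wB iB WB.
have [T [posT Tq]] := expansion_covariance nH be fcont.
have incW := expansion_gaussian_increments (c := fun u k => u (f (e k))) wB iB WB Tq.
have W0 u : W 0 u = cst 0 %[ae P].
  apply: (expansion_start (c := fun u k => u (f (e k))) WB) => k /wB wk.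
  exact: wiener_start wk ord0.
split; last first.
  by move=> u; exists (T u) => v; exact: gaussian_covariance posT cylW incW W0 u v.
split => // n u; pose Q (v w : dual U) : R := w (T v).
have posQ : positive_form Q by [].
pose C : 'M[R]_n := \matrix_(i, j) Q (u i) (u j).
have CE (a : 'rV[R]_n) : Q (\sum_i a 0 i *: u i) (\sum_i a 0 i *: u i) =
    (a *m C *m a^T) 0 0.
  rewrite (positive_form_sumr posQ) mxE; apply: eq_bigr => j _.
  rewrite (positive_formZr posQ) (positive_form_suml posQ) !mxE mulrC; congr (_ * _).
  by apply: eq_bigr => i _; rewrite (positive_formZl posQ) mxE.
exists C; split.
- by apply/matrixP => i j; rewrite !mxE (positive_formC posQ).
- by move=> a; rewrite -CE (positive_form_ge0 posQ).
- exact: (gaussian_increments_weakly cylW incW adW W0 CE (positive_form_ge0 posQ)).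
Qed.

End ExpansionIsCylindricalWiener.

Theorem theorem7p1 (R : realType) (d : measure_display)
    (Omega : measurableType d) (P : probability Omega R)
    (F : R -> set (set Omega)) (hF : filtration F)
    (U : completeNormedModType R) (hU : separable U)
    (W : R -> dual U -> {mfun_ P, Omega >-> R})
    (cylW : cylindrical_process W) (adW : adapted F W) :
  strongly_cylindrical_wiener F W <->
  exists (H : completeNormedModType R) (ip : {dot H for idfun})
         (J : set nat) (e : nat -> H) (f : {linear H -> U})
         (B : nat -> R -> {mfun_ P, Omega >-> R}),
    [/\ hilbert_norm ip, orthonormal_basis ip J e, continuous f,
        (forall k, J k -> standard_real_wiener F (B k)) /\
        independent_processes J B &
        forall (t : R) (u : dual U), 0 <= t ->
          L2_cvg P
            (fun n w => \sum_(k < n | (k : nat) \in J) u (f (e k)) * B k t w)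
            (W t u)].
Proof.
split; first exact: strongly_cylindrical_expansion.
move=> [H [ip [J [e [f [B [nH be fcont [wB iB] WB]]]]]]].
exact: expansion_strongly_cylindrical cylW adW nH be fcont wB iB WB.
Qed.
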